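(* Let $T>0$ and let $\Sigma_0,\Sigma_T$ be real symmetric positive definite $n\times n$ matrices. Consider the linear stochastic system $$dx(t)=Ax(t)\,dt+Bu(t)\,dt+B_1\,dw(t),\qquad dy(t)=Cx(t)\,dt+D\,dv(t),$$ where $x(0)$ has the Gaussian density $$\rho_0(x)=(2\pi)^{-n/2}\det(\Sigma_0)^{-1/2}\exp\left(-\tfrac12 x'\Sigma_0^{-1}x\right),$$ with $(A,B)$ controllable, $(A,C)$ observable and $D$ invertible. Let $P(t)$, $t\in[0,T]$, be the solution of the Riccati equation $$\dot P(t)=AP(t)+P(t)A'+B_1B_1'-P(t)C'(DD')^{-1}CP(t),\qquad P(0)=\Sigma_0 .$$ If $\Sigma_T>P(T)$, then there exists a control process $u(t)$, $t\in[0,T]$, adapted to the output process $y(t)$, such that the state vector $x(T)$ at time $t=T$ has the probability density $$\rho_T(x)=(2\pi)^{-n/2}\det(\Sigma_T)^{-1/2}\exp\left(-\tfrac12 x'\Sigma_T^{-1}x\right).$$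
   Context: Here $A\in\mathbb{R}^{n\times n}$, $B\in\mathbb{R}^{n\times m}$, $B_1\in\mathbb{R}^{n\times m_1}$, $C\in\mathbb{R}^{p\times n}$, $D\in\mathbb{R}^{p\times p}$ are constant matrices. The processes $x,y,u,w,v$ are the state, output, control input, process noise and measurement noise. $w$ and $v$ are standard Wiener processes (of dimensions $m_1$ and $p$), independent of each other, and $x(0)$ is independent of $(w,v)$; $y(0)=0$. Prime denotes transpose, and $M>N$ for symmetric matrices means that $M-N$ is positive definite. A control $u$ is adapted to the output process if, for each $t\in[0,T]$, $u(t)$ depends only on $t$ and on $\{y(s): 0\le s\le t\}$, where $y$ is the output produced by that control. *)

(* Defs.v *)
From HB Require Import structures.
From mathcomp Require Import all_boot all_order all_algebra.
From mathcomp Require Import all_classical all_reals all_analysis.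
Set Implicit Arguments.
Unset Strict Implicit.
Unset Printing Implicit Defensive.
Import Order.TTheory GRing.Theory Num.Theory.
Import numFieldNormedType.Exports.
Local Open Scope classical_set_scope.
Local Open Scope ring_scope.

Definition posdef (R : realType) (n : nat) (S : 'M[R]_n) : Prop :=
  S^T = S /\ forall z : 'cV[R]_n, z != 0 -> 0 < (z^T *m S *m z) 0 0.

Definition borel_cV (R : realType) (n : nat) : set (set 'cV[R]_n) :=
  g_sigma_preimage (fun (i : 'I_n) (z : 'cV[R]_n) => z i 0).

(* [int_cV f] is the integral of [f] against Lebesgue measure on R^n, written
   as an iterated integral over the coordinates; by Tonelli's theorem this is
   the usual integral when [f] is Borel and nonnegative, which is the only case
   in which it is used. *)
Fixpoint int_cV (R : realType) (n : nat) : ('cV[R]_n -> \bar R) -> \bar R :=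
  match n return ('cV[R]_n -> \bar R) -> \bar R with
  | 0 => fun f => f 0
  | n'.+1 => fun f =>
      (\int[@lebesgue_measure R]_(t in setT)
        int_cV (fun z : 'cV[R]_n' => f (col_mx (t%:M : 'cV[R]_1) z)))%E
  end.

Definition gaussian_density (R : realType) (n : nat) (S : 'M[R]_n)
    (z : 'cV[R]_n) : R :=
  (2 * pi) `^ (- (n%:R / 2)) * (\det S) `^ (- 2^-1)
    * expR (- 2^-1 * (z^T *m invmx S *m z) 0 0).

Section random_vectors.
Context (R : realType) (d : measure_display) (Omega : measurableType d).
Context (Pr : probability Omega R).

Definition random_vector (n : nat) (X : Omega -> 'cV[R]_n) : Prop :=
  forall i, measurable_fun setT (fun omega => X omega i 0).

Definition has_density (n : nat) (X : Omega -> 'cV[R]_n)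
    (rho : 'cV[R]_n -> R) : Prop :=
  random_vector X /\
  forall E, borel_cV E ->
    Pr (X @^-1` E) = int_cV (fun z => (rho z * \1_E z)%:E).

(* sigma-algebra generated by the random vectors [Z t], [t] in [J] *)
Definition sigma_gen (I : Type) (n : nat) (J : set I)
    (Z : I -> Omega -> 'cV[R]_n) : set (set Omega) :=
  <<s \bigcup_(t in J) [set Z t @^-1` E | E in @borel_cV R n] >>.

Definition independent (F G : set (set Omega)) : Prop :=
  forall E1 E2, F E1 -> G E2 -> Pr (E1 `&` E2) = (Pr E1 * Pr E2)%E.

(* standard k-dimensional Wiener process on [0, T] *)
Definition wiener (k : nat) (T : R) (W : R -> Omega -> 'cV[R]_k) : Prop :=
  [/\ forall t, 0 <= t <= T -> random_vector (W t),
      {ae Pr, forall omega, W 0 omega = 0},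
      {ae Pr, forall omega, {within `[0, T], continuous (W ^~ omega)}},
      forall s t, 0 <= s -> s < t -> t <= T ->
        has_density (fun omega => W t omega - W s omega)
          (gaussian_density (t - s)%:M) &
      forall s t, 0 <= s -> s < t -> t <= T ->
        independent (sigma_gen `[0, s] W)
          (sigma_gen [set t] (fun t' omega => W t' omega - W s omega))].

(* [u t] is measurable with respect to the sigma-algebra of the past outputs *)
Definition adapted (m p : nat) (T : R) (u : R -> Omega -> 'cV[R]_m)
    (y : R -> Omega -> 'cV[R]_p) : Prop :=
  forall t, 0 <= t <= T -> sigma_gen [set t] u `<=` sigma_gen `[0, t] y.

End random_vectors.

Definition integrable_cV (R : realType) (k : nat) (T : R) (b : R -> 'cV[R]_k)
    : Prop :=
  forall i, (@lebesgue_measure R).-integrable `[0, T]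
              (fun s => (b s i 0)%:E).

(* dz = b dt + dg on [0, T], z(0) = z0, in integrated form, for a noise path
   [g] with g(0) = 0. Since the diffusion coefficients of the systems below are
   constant matrices, their stochastic differential equations are exactly such
   equations along almost every sample path. *)
Definition solves (R : realType) (k : nat) (T : R) (z0 : 'cV[R]_k)
    (b g z : R -> 'cV[R]_k) : Prop :=
  integrable_cV T b /\
  forall t, 0 <= t <= T ->
    z t = z0 + (\col_i \int[@lebesgue_measure R]_(s in `[0, t]) (b s i 0))
          + g t.

(* [law t eta] depends only on [t] and on the restriction of [eta] to [0, t] *)
Definition causal (R : realType) (m p : nat) (T : R)
    (law : R -> (R -> 'cV[R]_p) -> 'cV[R]_m) : Prop :=
  forall t (eta eta' : R -> 'cV[R]_p), 0 <= t <= T ->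
    (forall s, 0 <= s <= t -> eta s = eta' s) -> law t eta = law t eta'.

(* The paths [x] and [y] solve, on [0, T], the system with initial state [x0],
   noise paths [w] and [v], and control u(t) = law(t, y). *)
Definition closed_loop (R : realType) (n m m1 p : nat)
    (A : 'M[R]_n) (B : 'M[R]_(n, m)) (B1 : 'M[R]_(n, m1))
    (C : 'M[R]_(p, n)) (D : 'M[R]_p)
    (law : R -> (R -> 'cV[R]_p) -> 'cV[R]_m)
    (T : R) (x0 : 'cV[R]_n) (w : R -> 'cV[R]_m1) (v : R -> 'cV[R]_p)
    (x : R -> 'cV[R]_n) (y : R -> 'cV[R]_p) : Prop :=
  solves T x0 (fun t => A *m x t + B *m law t y) (fun t => B1 *m w t) x /\
  solves T 0 (fun t => C *m x t) (fun t => D *m v t) y.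

(* [x] and [y] are the state and output paths produced by the control law [law]: up to
   each time they are the only solution of the closed loop. Without uniqueness
   a law could read from [y] information about the initial state and the noises
   that was only put there by the choice of the solution itself. *)
Definition produced_by (R : realType) (n m m1 p : nat)
    (A : 'M[R]_n) (B : 'M[R]_(n, m)) (B1 : 'M[R]_(n, m1))
    (C : 'M[R]_(p, n)) (D : 'M[R]_p)
    (law : R -> (R -> 'cV[R]_p) -> 'cV[R]_m)
    (T : R) (x0 : 'cV[R]_n) (w : R -> 'cV[R]_m1) (v : R -> 'cV[R]_p)
    (x : R -> 'cV[R]_n) (y : R -> 'cV[R]_p) : Prop :=
  closed_loop A B B1 C D law T x0 w v x y /\
  forall t x' y', 0 <= t <= T ->
    closed_loop A B B1 C D law t x0 w v x' y' ->
    forall s, 0 <= s <= t -> x' s = x s /\ y' s = y s.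

(* every state can be steered to every other state in finite time *)
Definition controllable (R : realType) (n m : nat)
    (A : 'M[R]_n) (B : 'M[R]_(n, m)) : Prop :=
  forall a b : 'cV[R]_n,
    exists (tau : R) (u : R -> 'cV[R]_m) (z : R -> 'cV[R]_n),
      [/\ 0 < tau,
          solves tau a (fun s => A *m z s + B *m u s) (fun=> 0) z &
          z tau = b].

(* the initial state is determined by the output on a finite time interval *)
Definition observable (R : realType) (n p : nat)
    (A : 'M[R]_n) (C : 'M[R]_(p, n)) : Prop :=
  exists2 tau : R, 0 < tau &
    forall (a a' : 'cV[R]_n) (z z' : R -> 'cV[R]_n),
      solves tau a (fun s => A *m z s) (fun=> 0) z ->
      solves tau a' (fun s => A *m z' s) (fun=> 0) z' ->
      (forall t, 0 <= t <= tau -> C *m z t = C *m z' t) -> a = a'.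

Definition riccati_solution (R : realType) (n m1 p : nat) (A : 'M[R]_n)
    (B1 : 'M[R]_(n, m1)) (C : 'M[R]_(p, n)) (D : 'M[R]_p) (T : R)
    (Sigma0 : 'M[R]_n) (P : R -> 'M[R]_n) : Prop :=
  [/\ P 0 = Sigma0,
      {within `[0, T], continuous P} &
      forall t, 0 < t < T ->
        is_derive t 1 P
          (A *m P t + P t *m A^T + B1 *m B1^T
           - P t *m C^T *m invmx (D *m D^T) *m C *m P t)].

(* Main.v *)
(* The control vanishes up to a time tau < T; afterwards it follows the open-loop
   control that adds z to the state at time T, where z is the integral of
   (dF/dt) y over [0, tau] and F is a C^1 matrix gain that vanishes after tau.
   Integrating by parts, x(T) = L(0) x(0) + (integral of L B1 dw)
   - (integral of F D dv), where dL/dt = - L A + F C and L(T) = 1. This is a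
   centred Gaussian vector with covariance
   L(0) Sigma0 L(0)' + integral of (L B1 B1' L' + F D D' F'), and it
   remains to choose F so that this covariance is SigmaT. The Kalman gain gives
   P(T). Cutting it off near T changes the covariance by so little that SigmaT
   minus the covariance stays positive definite. Adding to the resulting gain
   G Psi(t), Psi(t) = r(t) exp(tA)' C', with a C^1 weight r that vanishes
   near T, makes the covariance a quadratic polynomial in G whose leading
   coefficient is positive definite by observability, and one solves for G by
   completing the square.

   Gaussian laws, degenerate ones included, are handled through the
   expectations of exp(-|Mx - a|^2 / 2): these determine the law, and they
   behave well under linear maps, independent sums and almost sure limits. *)
From HB Require Import structures.
Require Import Defs.
From mathcomp Require Import all_boot all_order all_algebra.
From mathcomp Require Import ring lra.
From mathcomp Require Import all_classical all_reals all_analysis.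
From mathcomp Require Import measurable_realfun.
Set Implicit Arguments.
Unset Strict Implicit.
Unset Printing Implicit Defensive.
Import Order.TTheory GRing.Theory Num.Theory.
Import numFieldNormedType.Exports.
Local Open Scope classical_set_scope.
Local Open Scope ring_scope.

(** * Positive definite matrices *)

Section posdef_theory.
Context (R : realType).

(** The output depends on the control, so a law that reads the output while acting on it creates a
    loop. As long as the control is zero, the output is that of the uncontrolled system; reading it
    only up to tau makes existence, uniqueness and adaptedness of the closed loop elementary. The
    price is a gain that vanishes near T and a control that must do its work in the remaining time:
    controllability provides the second, and the strict inequality between SigmaT and P(T) pays for
    the first. Since z equals minus the integral of F dy, x(T) is the free final state minus a
    linear functional of the observations: an estimation error, whose covariance is P(T) for the
    Kalman gain. The target covariance is larger, and it is reached by spoiling the filter by the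
    right amount. L and F are deterministic and C^1, so every integral against the noise is an
    integral by parts along a continuous path, and the state equation is solved path by path.
    Probability enters only in the law of x(T), as a limit of sums over independent increments. *)

Definition qf n (S : 'M[R]_n) (z : 'cV[R]_n) : R := (z^T *m S *m z) 0 0.

Lemma mx11E (A : 'M[R]_1) : A = (A 0 0)%:M.
Proof. exact: mx11_scalar. Qed.

Lemma qf_sqr m n (L : 'M[R]_(m, n)) z : qf (L^T *m L) z = \sum_i (L *m z) i 0 ^+ 2.
Proof.
rewrite /qf mulmxA -trmx_mul -mulmxA mxE; apply: eq_bigr => i _.
by rewrite mxE expr2.
Qed.

Lemma qf_sqr_ge0 m n (L : 'M[R]_(m, n)) z : 0 <= qf (L^T *m L) z.
Proof. by rewrite qf_sqr; apply: sumr_ge0 => i _; rewrite sqr_ge0. Qed.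

Lemma qfD n (S1 S2 : 'M[R]_n) z : qf (S1 + S2) z = qf S1 z + qf S2 z.
Proof. by rewrite /qf mulmxDr mulmxDl mxE. Qed.

Lemma posdef_qf_ge0 n (S : 'M[R]_n) z : posdef S -> 0 <= qf S z.
Proof.
move=> [_ h]; have [->|/h/ltW//] := eqVneq z 0.
by rewrite /qf mulmx0 mxE.
Qed.

Lemma posdef_unit n (S : 'M[R]_n) : posdef S -> S \in unitmx.
Proof.
move=> [Ssym h]; rewrite -row_free_unit -kermx_eq0; apply/eqP/row_matrixP => i.
rewrite row0; apply: contrapT => /eqP v0.
have : (row i (kermx S))^T != 0 by rewrite -trmx0 (inj_eq trmx_inj).
move=> /h; rewrite trmxK -row_mul mulmx_ker row0 mul0mx mxE.
by rewrite ltxx.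
Qed.

Lemma posdefD n (S1 S2 : 'M[R]_n) : posdef S1 -> S2^T = S2 ->
  (forall z, 0 <= qf S2 z) -> posdef (S1 + S2).
Proof.
move=> [s1 h1] s2 h2; split; first by rewrite linearD /= s1 s2.
by move=> z z0; rewrite -/(qf _ _) qfD ltr_wpDr// ?h2// h1.
Qed.

Lemma posdef_congr n (S : 'M[R]_n) (L : 'M[R]_n) : L \in unitmx -> posdef S ->
  posdef (L^T *m S *m L).
Proof.
move=> uL [s h]; split; first by rewrite !trmx_mul trmxK s mulmxA.
move=> z z0; have := h (L *m z); rewrite trmx_mul !mulmxA; apply.
by apply: contra z0 => /eqP/(congr1 (mulmx (invmx L))); rewrite mulKmx// mulmx0 => /eqP.
Qed.

Lemma invmxM n (A B : 'M[R]_n) : A \in unitmx -> B \in unitmx ->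
  invmx (A *m B) = invmx B *m invmx A.
Proof.
move=> uA uB; have uAB : A *m B \in unitmx by rewrite unitmx_mul uA.
apply: (can_inj (mulKmx uAB)); rewrite mulmxV// mulmxA mulmxK// mulmxV//.
Qed.

Lemma posdef_inv n (S : 'M[R]_n) : posdef S -> posdef (invmx S).
Proof.
move=> pS; have uS := posdef_unit pS; have [s _] := pS.
have -> : invmx S = (invmx S)^T *m S *m invmx S.
  by rewrite trmx_inv s mulVmx// mul1mx.
by apply: posdef_congr => //; rewrite unitmx_inv.
Qed.

Lemma posdef_scalar n (c : R) : 0 < c -> posdef (c%:M : 'M[R]_n).
Proof.
move=> c0; split; first by rewrite tr_scalar_mx.
move=> z z0; rewrite -/(qf _ _).
have -> : qf c%:M z = c * qf ((1%:M)^T *m 1%:M) z.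
  by rewrite /qf trmx1 mulmx1 -(scalemx1 n c) -scalemxAr -scalemxAl mxE.
rewrite mulr_gt0// lt0r qf_sqr_ge0 andbT qf_sqr.
under eq_bigr do rewrite mul1mx.
apply: contra z0 => /eqP h; apply/eqP/colP => i; rewrite mxE.
have /eqP := @psumr_eq0P _ _ xpredT _ (fun i _ => sqr_ge0 (z i 0)) h i isT.
by rewrite sqrf_eq0 => /eqP.
Qed.

(** Completing the square in [b]; the coefficient of [a ^+ 2] is the Schur complement of [Q].
    Splitting off a single first coordinate matches the recursion of [int_cV]. *)
Lemma qf_block n q (r : 'cV[R]_n) (Q : 'M[R]_n) (a : R) b : posdef Q ->
  qf (block_mx q%:M r^T r Q) (col_mx (a%:M : 'cV_1) b) =
  (q - (r^T *m invmx Q *m r) 0 0) * a ^+ 2 + qf Q (b + a *: (invmx Q *m r)).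
Proof.
move=> pQ; have uQ := posdef_unit pQ; have [sQ _] := pQ.
set s := r^T *m invmx Q *m r.
rewrite (_ : b + _ = b + invmx Q *m r *m a%:M); last by rewrite mul_mx_scalar.
have E : (col_mx (a%:M : 'cV_1) b)^T *m block_mx q%:M r^T r Q *m col_mx (a%:M : 'cV_1) b =
    a%:M *m (q%:M - s) *m a%:M +
    (b + invmx Q *m r *m a%:M)^T *m Q *m (b + invmx Q *m r *m a%:M).
  rewrite tr_col_mx tr_scalar_mx mul_row_block mul_row_col /s.
  have -> : (b + invmx Q *m r *m a%:M)^T = b^T + a%:M *m r^T *m invmx Q.
    by rewrite linearD /= !trmx_mul trmx_inv sQ tr_scalar_mx mulmxA.
  rewrite mulmxBr mulmxBl !mulmxDl !mulmxDr !mulmxA mulmxKV// mulmxK//.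
  move: (a%:M *m r^T *m invmx Q *m r *m a%:M) (b^T *m r *m a%:M) (a%:M *m r^T *m b) => x y z.
  move: (a%:M *m q%:M *m a%:M) (b^T *m Q *m b) => p t.
  by apply/matrixP => i j; rewrite !mxE; ring.
rewrite /qf E [LHS]mxE; congr (_ + _).
by rewrite [q%:M - s]mx11E -!scalar_mxM !mxE eqxx !mulr1n mulrAC expr2 mulrC mulrA.
Qed.
Lemma posdef_blockP n (S : 'M[R]_(1 + n)) : posdef S ->
  exists q (r : 'cV[R]_n) (Q : 'M[R]_n), [/\ S = block_mx q%:M r^T r Q,
    posdef Q & 0 < q - (r^T *m invmx Q *m r) 0 0].
Proof.
move=> pS; have [s h] := pS.
exists (ulsubmx S 0 0), (dlsubmx S), (drsubmx S).
have E : S = block_mx (ulsubmx S 0 0)%:M (dlsubmx S)^T (dlsubmx S) (drsubmx S).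
  by rewrite -mx11E trmx_dlsub s submxK.
have pQ : posdef (drsubmx S).
  split; first by rewrite trmx_drsub s.
  move=> z z0; have := h (col_mx (0 : 'cV_1) z).
  rewrite {1}E tr_col_mx mul_row_block !trmx0 !mul0mx !add0r mul_row_col mulmx0 add0r; apply.
  by apply: contra z0 => /eqP; rewrite -(col_mx0 R 1 n 1) => /eq_col_mx[_ ->].
split=> //.
set q := ulsubmx S 0 0 in E *; set r := dlsubmx S in E *; set Q := drsubmx S in E pQ *.
have uQ := posdef_unit pQ; have [sQ _] := pQ.
(* At this vector the completed square vanishes and only the Schur complement is left. *)
have := h (col_mx (1%:M : 'cV_1) (- (invmx Q *m r))).
rewrite E -/(qf _ _) qf_block// scale1r addNr expr1n mulr1 (_ : qf Q 0 = 0) ?addr0; last by rewrite /qf mulmx0 mxE.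
apply.
apply/negP => /eqP; rewrite -(col_mx0 R 1 n 1) => /eq_col_mx[/matrixP/(_ 0 0)].
by rewrite !mxE eqxx => /eqP; rewrite oner_eq0.
Qed.

Lemma det_posdef_block n q (r : 'cV[R]_n) (Q : 'M[R]_n) : Q \in unitmx ->
  \det (block_mx q%:M r^T r Q) = (q - (r^T *m invmx Q *m r) 0 0) * \det Q.
Proof.
move=> uQ.
have : block_mx q%:M r^T r Q *m block_mx 1%:M 0 (- (invmx Q *m r)) 1%:M =
       block_mx (q - (r^T *m invmx Q *m r) 0 0)%:M r^T 0 Q.
  rewrite mulmx_block !mulmx1 !mulmx0 !add0r !mulmxN mulKVmx// subrr mulmxA.
  by congr block_mx; rewrite {1}[r^T *m _ *m r]mx11E -raddfB.
move=> /(congr1 determinant); rewrite det_mulmx det_lblock !det1 !mulr1 => ->.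
by rewrite det_ublock det_scalar1.
Qed.

Lemma posdef_det_gt0 n (S : 'M[R]_n) : posdef S -> 0 < \det S.
Proof.
elim: n S => [|n IH] S pS; first by rewrite det_mx00.
have [q [r [Q [E pQ q0]]]] := @posdef_blockP n S pS.
rewrite E.
by rewrite (det_posdef_block _ _ (posdef_unit pQ)) mulr_gt0// IH.
Qed.

Lemma posdef_cholesky n (S : 'M[R]_n) : posdef S -> exists L : 'M[R]_n, S = L *m L^T.
Proof.
elim: n S => [|n IH] S pS; first by exists 0; rewrite [LHS]flatmx0 [RHS]flatmx0.
have [q [r [Q [E pQ q0]]]] := @posdef_blockP n S pS.
have [L QL] := IH _ pQ.
suff : exists L : 'M[R]_(1 + n), S = L *m L^T :> 'M[R]_(1 + n) by [].
have uL : L \in unitmx by have := posdef_unit pQ; rewrite QL unitmx_mul => /andP[].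
have uL' : L^T \in unitmx by rewrite unitmx_tr.
(* An upper triangular factor: the first row is chosen so that its product with [L^T] is [r^T], and
   the Schur complement is what remains for the corner. *)
exists (block_mx (Num.sqrt (q - (r^T *m invmx Q *m r) 0 0))%:M (r^T *m invmx L^T) 0 L : 'M[R]_(1 + n)%N).
rewrite {}E.
rewrite tr_block_mx mulmx_block !tr_scalar_mx !trmx0 !mul0mx !mulmx0 !add0r -QL.
rewrite trmx_mul trmx_inv !trmxK mulKVmx// mulmxKV//; congr block_mx.
rewrite -scalar_mxM -expr2 sqr_sqrtr ?ltW// raddfB/= -mx11E QL.
by rewrite invmxM// !mulmxA subrK.
Qed.

Lemma posdef_factor n (S : 'M[R]_n) : posdef S -> exists2 L, L \in unitmx & S = L^T *m L.
Proof.
move=> pS; have [L E] := posdef_cholesky pS; exists L^T; last by rewrite trmxK.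
by have := posdef_unit pS; rewrite E unitmx_mul => /andP[].
Qed.

(** Sylvester's identity: both sides are determinants of the same block matrix [X], triangularised
    by a unipotent factor on the left or on the right. *)
Lemma det_1DmulC m n (A : 'M[R]_(m, n)) (B : 'M[R]_(n, m)) :
  \det (1%:M + A *m B) = \det (1%:M + B *m A).
Proof.
pose X := block_mx 1%:M (- A) B 1%:M.
transitivity (\det X).
  have : block_mx 1%:M A 0 1%:M *m X = block_mx (1%:M + A *m B) 0 B 1%:M.
    by rewrite mulmx_block !mul1mx !mul0mx !mulmx1 !add0r addNr.
  move=> /(congr1 determinant); rewrite det_mulmx det_ublock !det1 !mul1r => ->.
  by rewrite det_lblock det1 mulr1.
have : X *m block_mx 1%:M A 0 1%:M = block_mx 1%:M 0 B (1%:M + B *m A).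
  by rewrite mulmx_block !mul1mx !mulmx1 !mulmx0 !addr0 subrr [_ + 1%:M]addrC.
move=> /(congr1 determinant); rewrite det_mulmx det_ublock !det1 !mulr1 => ->.
by rewrite det_lblock det1 mul1r.
Qed.

End posdef_theory.

(** * Integration over column vectors *)

Lemma borel_cV0 (R : realType) n : @borel_cV R n set0.
Proof. exact: sigma_algebra0. Qed.
Lemma borel_cVC (R : realType) n A : @borel_cV R n A -> borel_cV (~` A).
Proof. exact: sigma_algebraC. Qed.
Lemma borel_cV_bigcup (R : realType) n (F : (set 'cV[R]_n)^nat) :
  (forall i, borel_cV (F i)) -> borel_cV (\bigcup_i F i).
Proof. exact: sigma_algebra_bigcup. Qed.

Definition cV_display : measure_display. Proof. exact: default_measure_display. Qed.

HB.instance Definition _ (R : realType) n := @isMeasurable.Build cV_display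
  'cV[R]_n (@borel_cV R n) (@borel_cV0 R n) (@borel_cVC R n) (@borel_cV_bigcup R n).

Lemma measurable_coord (R : realType) n (i : 'I_n) :
  measurable_fun setT (fun z : 'cV[R]_n => z i 0).
Proof.
move=> _ Y mY; rewrite setTI; apply: sub_sigma_algebra => /=.
rewrite -bigcup_seq/=; exists i => /=; first by rewrite mem_index_enum.
by exists Y => //; rewrite setTI.
Qed.

Lemma measurable_fun_cVP d (T : measurableType d) (R : realType) n (f : T -> 'cV[R]_n) :
  measurable_fun setT f <-> forall i, measurable_fun setT (fun x => f x i 0).
Proof.
split=> [mf i|mf].
  exact: (measurableT_comp (@measurable_coord R n i)).
apply: (@measurability _ _ _ _ _ _ (\big[setU/set0]_(i < n) preimage_set_system setT (fun z : 'cV[R]_n => z i 0) measurable)) => //.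
move=> _ [B + <-]; rewrite -bigcup_seq => -[i _ [C mC <-]].
rewrite !setTI; have := mf i measurableT C mC; by rewrite setTI.
Qed.

Lemma random_vectorP d (T : measurableType d) (R : realType) n (f : T -> 'cV[R]_n) :
  random_vector f <-> measurable_fun setT f.
Proof. by rewrite measurable_fun_cVP. Qed.

Lemma measurable_cV_cons d (T : measurableType d) (R : realType) n (f : T -> R) (g : T -> 'cV[R]_n) :
  measurable_fun setT f -> measurable_fun setT g ->
  measurable_fun setT (fun x => col_mx ((f x)%:M : 'cV_1) (g x) : 'cV[R]_n.+1).
Proof.
move=> mf mg; apply/measurable_fun_cVP => i.
have E x : (col_mx ((f x)%:M : 'cV_1) (g x) : 'cV[R]_n.+1) i 0 =
    match fintype.split (i : 'I_(1 + n)) with inl _ => f x | inr j => g x j 0 end.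
  rewrite mxE; case: fintype.split => // j; by rewrite ord1 mxE eqxx mulr1n.
under eq_fun do rewrite E.
case: fintype.split => // j; by move/measurable_fun_cVP : mg; exact.
Qed.

Section int_cV_theory.
Context (R : realType).
Local Open Scope ereal_scope.

Lemma int_cV_ge0 n (f : 'cV[R]_n -> \bar R) : (forall z, 0 <= f z) -> 0 <= int_cV f.
Proof.
elim: n f => [|n IH] f f0 /=; first exact: f0.
by apply: integral_ge0 => t _; apply: IH => z; exact: f0.
Qed.

(** The parameter space is arbitrary so that the induction can move the first coordinate into it;
    what remains is the measurability half of Tonelli's theorem. *)
Lemma measurable_int_cV n d (U : measurableType d) (f : U * 'cV[R]_n -> \bar R) :
  measurable_fun setT f -> (forall x, 0 <= f x) ->
  measurable_fun setT (fun u => int_cV (fun z => f (u, z))).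
Proof.
elim: n d U f => [|n IH] d U f mf f0 /=.
  apply: (measurableT_comp mf); apply: measurable_fun_pair => //.
pose f2 (uz : (U * R) * 'cV[R]_n) := f (uz.1.1, col_mx (uz.1.2%:M : 'cV_1) uz.2).
have mf2 : measurable_fun setT f2.
  apply: (measurableT_comp mf); apply: measurable_fun_pair.
    exact: measurableT_comp.
  apply: measurable_cV_cons => //; exact: measurableT_comp.
have mh := IH _ _ f2 mf2 (fun=> f0 _).
exact: (measurable_fun_fubini_tonelli_F (m2 := @lebesgue_measure R) _ mh (fun=> int_cV_ge0 (fun=> f0 _))).
Qed.

Lemma measurable_int_cV_slice n (f : 'cV[R]_n.+1 -> \bar R) :
  measurable_fun setT f -> (forall x, 0 <= f x) ->
  measurable_fun setT (fun t : R => int_cV (fun z : 'cV[R]_n => f (col_mx (t%:M : 'cV_1) z))).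
Proof.
move=> mf f0.
apply: (@measurable_int_cV n _ R (fun uz => f (col_mx (uz.1%:M : 'cV_1) uz.2))) => //.
apply: (measurableT_comp mf); exact: measurable_cV_cons.
Qed.

Lemma measurable_slice n (f : 'cV[R]_n.+1 -> \bar R) (t : R) :
  measurable_fun setT f ->
  measurable_fun setT (fun z : 'cV[R]_n => f (col_mx (t%:M : 'cV_1) z)).
Proof. by move=> mf; apply: (measurableT_comp mf); exact: measurable_cV_cons. Qed.

Lemma le_int_cV n (f g : 'cV[R]_n -> \bar R) :
  measurable_fun setT f -> measurable_fun setT g ->
  (forall x, 0 <= f x) -> (forall x, f x <= g x) -> int_cV f <= int_cV g.
Proof.
elim: n f g => [|n IH] f g mf mg f0 fg /=; first exact: fg.
have g0 x : 0 <= g x by exact: le_trans (fg x).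
apply: ge0_le_integral => //.
- by move=> t _; exact: int_cV_ge0.
- exact: measurable_int_cV_slice.
- exact: measurable_int_cV_slice.
- by move=> t _; apply: IH => //; exact: measurable_slice.
Qed.

Lemma int_cVD n (f g : 'cV[R]_n -> \bar R) :
  measurable_fun setT f -> measurable_fun setT g ->
  (forall x, 0 <= f x) -> (forall x, 0 <= g x) ->
  int_cV (fun z => f z + g z) = int_cV f + int_cV g.
Proof.
elim: n f g => [|n IH] f g mf mg f0 g0 //=.
rewrite -ge0_integralD//.
- by apply: eq_integral => t _; apply: IH => //; exact: measurable_slice.
- by move=> t _; exact: int_cV_ge0.
- exact: measurable_int_cV_slice.
- by move=> t _; exact: int_cV_ge0.
- exact: measurable_int_cV_slice.
Qed.

Lemma int_cVZl n (f : 'cV[R]_n -> \bar R) (c : R) :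
  measurable_fun setT f -> (forall x, 0 <= f x) -> (0 <= c)%R ->
  int_cV (fun z => c%:E * f z) = c%:E * int_cV f.
Proof.
move=> + + c0; elim: n f => [|n IH] f mf f0 //=.
rewrite -ge0_integralZl//.
- by apply: eq_integral => t _; apply: IH => //; exact: measurable_slice.
- exact: measurable_int_cV_slice.
- by move=> t _; exact: int_cV_ge0.
Qed.

Lemma cvg_int_cV n (f_ : ('cV[R]_n -> \bar R)^nat) (f : 'cV[R]_n -> \bar R) :
  (forall k, measurable_fun setT (f_ k)) -> (forall k x, 0 <= f_ k x) ->
  (forall x, nondecreasing_seq (f_ ^~ x)) -> (forall x, f_ ^~ x @ \oo --> f x) ->
  int_cV (f_ k) @[k --> \oo] --> int_cV f.
Proof.
elim: n f_ f => [|n IH] f_ f mf f0 ndf ff /=; first exact: ff.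
have H t : int_cV (fun z : 'cV[R]_n => f_ k (col_mx (t%:M : 'cV_1) z)) @[k --> \oo] -->
           int_cV (fun z : 'cV[R]_n => f (col_mx (t%:M : 'cV_1) z)).
  apply: (IH (fun k z => f_ k (col_mx (t%:M : 'cV_1) z))) => //.
  by move=> k; exact: measurable_slice.
rewrite (_ : \int[_]_(t in _) _ = \int[@lebesgue_measure R]_(t in setT)
   limn (fun k => int_cV (fun z : 'cV[R]_n => f_ k (col_mx (t%:M : 'cV_1) z)))); last first.
  by apply: eq_integral => t _; apply/esym/cvg_lim => //; exact: H.
apply: cvg_monotone_convergence => //.
- by move=> k; exact: measurable_int_cV_slice.
- by move=> k t _; exact: int_cV_ge0.
- move=> t _ a b ab; apply: le_int_cV => //; try exact: measurable_slice.
  by move=> x; exact: ndf.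
Qed.

Lemma int_cV0 n : int_cV (fun _ : 'cV[R]_n => 0) = 0.
Proof. by elim: n => [//|n IH] /=; rewrite (eq_integral (cst 0)) ?integral0. Qed.

End int_cV_theory.

(** * Integration against a density *)

Section density.
Context (R : realType).
Local Open Scope ereal_scope.
Import HBNNSimple.

(* A functional that is additive, homogeneous and monotonically continuous is
   determined by its values on indicators. *)
Lemma ge0_functional_integral d (T : measurableType d) (mu : {measure set T -> \bar R})
    (I : (T -> \bar R) -> \bar R) :
  (forall f g, measurable_fun setT f -> measurable_fun setT g ->
    (forall x, 0 <= f x) -> (forall x, 0 <= g x) -> I (fun x => f x + g x) = I f + I g) ->
  (forall f (c : R), measurable_fun setT f -> (forall x, 0 <= f x) -> (0 <= c)%R ->
    I (fun x => c%:E * f x) = c%:E * I f) ->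
  (forall f_ f, (forall k, measurable_fun setT (f_ k)) -> (forall k x, 0 <= f_ k x) ->
    (forall x, nondecreasing_seq (f_ ^~ x)) -> (forall x, f_ ^~ x @ \oo --> f x) ->
    I (f_ k) @[k --> \oo] --> I f) ->
  (forall E, measurable E -> I (fun x => (\1_E x)%:E) = mu E) ->
  forall f, measurable_fun setT f -> (forall x, 0 <= f x) -> I f = \int[mu]_x f x.
Proof.
move=> ID IZ Icvg I1 f mf f0.
have I0 : I (fun=> 0) = 0.
  have := IZ (fun=> 0) 0%R (measurable_cst _) (fun=> lexx _) (lexx _).
  rewrite [RHS]mul0e => I0; transitivity (I (fun x : T => 0%:E * 0)); last exact: I0.
  by congr I; apply/funext => x; rewrite mul0e.
have Isum (s : seq R) (c : R -> R) (E : R -> set T) :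
    (forall r, 0 <= c r)%R -> (forall r, measurable (E r)) ->
    I (fun x => \sum_(r <- s) (c r)%:E * (\1_(E r) x)%:E) = \sum_(r <- s) (c r)%:E * mu (E r).
  move=> c0 mE; elim: s => [|r s IH].
    transitivity (I (fun=> 0)); last by rewrite big_nil.
    by congr (I _); apply/funext => x; rewrite big_nil.
  rewrite big_cons -IH -I1// -IZ//; first last.
  - by apply/measurable_EFinP; exact: measurable_indic.
  rewrite -ID.
  - by congr I; apply/funext => x; rewrite big_cons.
  - by apply: measurable_funeM; apply/measurable_EFinP; exact: measurable_indic.
  - by apply: emeasurable_sum => i; apply: measurable_funeM; apply/measurable_EFinP; exact: measurable_indic.
  - by move=> x; rewrite mule_ge0// lee_fin.
  - by move=> x; apply: sume_ge0 => i _; rewrite mule_ge0// lee_fin.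
pose g := nnsfun_approx measurableT mf.
have Ig k : I (EFin \o g k) = \int[mu]_x (g k x)%:E.
  rewrite integralT_nnsfun sintegralE fsbig_finite//=.
  (* [Isum] wants coefficients that are nonnegative for every real r; on the range of the simple
     function the maximum with 0 changes nothing. *)
  transitivity (I (fun x => \sum_(r <- finmap.enum_fset (fset_set (range (g k))))
      (Num.max r 0%R)%:E * (\1_(g k @^-1` [set r]) x)%:E)).
    congr I; apply/funext => x /=; rewrite fimfunE fsbig_finite//= -sumEFin big_seq [RHS]big_seq.
    apply: eq_bigr => r; rewrite in_fset_set// inE => -[y _ <-].
    by rewrite EFinM max_l// ?lee_fin.
  rewrite Isum//; last by move=> r; rewrite le_max lexx orbT.
  rewrite big_seq [RHS]big_seq.
  apply: eq_bigr => r; rewrite in_fset_set// inE => -[y _ <-].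
  by rewrite max_l// ?lee_fin.
have gf x : (EFin \o g k) x @[k --> \oo] --> f x by exact: cvg_nnsfun_approx.
have g0 k x : 0 <= (EFin \o g k) x by rewrite /= lee_fin.
have mg k : measurable_fun setT (EFin \o g k) by exact/measurable_EFinP.
have ndg x : nondecreasing_seq (fun k => (EFin \o g k) x).
  by move=> a b ab; rewrite /= lee_fin; exact/lefP/nd_nnsfun_approx.
have := Icvg (fun k => EFin \o g k) f mg g0 ndg gf.
have := @cvg_monotone_convergence _ _ _ mu _ measurableT (fun k => EFin \o g k) mg (fun k x _ => g0 k x) (fun x _ => ndg x).
have -> : (fun x => limn (EFin \o g ^~ x)) = f.
  by apply/funext => x; apply/cvg_lim => //; exact: gf.
under eq_fun do rewrite -Ig.
by move=> h1 h2; exact: (cvg_unique _ h2 h1).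
Qed.

(** Makes the iterated integral with weight [rho] a genuine measure, so that general integration
    theory applies to [has_density]. *)
Lemma density_measure n (rho : 'cV[R]_n -> R) :
  measurable_fun setT rho -> (forall z, 0 <= rho z)%R ->
  exists mu : {measure set 'cV[R]_n -> \bar R},
    (forall E, measurable E -> mu E = int_cV (fun z => (rho z * \1_E z)%:E)) /\
    (forall f, measurable_fun setT f -> (forall z, 0 <= f z) ->
       \int[mu]_z f z = int_cV (fun z => (rho z)%:E * f z)).
Proof.
move=> mrho rho0.
pose m (E : set 'cV[R]_n) := int_cV (fun z => (rho z * \1_E z)%:E).
have m0 : m set0 = 0.
  rewrite /m -[RHS](int_cV0 R n); congr int_cV.
  by apply/funext => z; rewrite indic0 mulr0.
have mge0 E : 0 <= m E.
  by apply: int_cV_ge0 => z; rewrite lee_fin mulr_ge0// ler0n.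
have mind (E : set 'cV[R]_n) : measurable E -> measurable_fun setT (fun z => (rho z * \1_E z)%:E).
  by move=> mE; apply/measurable_EFinP; apply: measurable_funM => //; exact: measurable_indic.
have mU : semi_sigma_additive m.
  move=> F mF tF mUF.
  pose g k z := \sum_(0 <= i < k) (rho z * \1_(F i) z)%:E.
  have mg k : measurable_fun setT (g k).
    by apply: emeasurable_sum => i; exact: mind.
  have p0 i z : 0 <= (rho z * \1_(F i) z)%:E by rewrite lee_fin mulr_ge0// ler0n.
  have E k : \sum_(0 <= i < k) m (F i) = int_cV (g k).
    elim: k => [|k IH].
      by rewrite big_geq// -[LHS](int_cV0 R n); congr int_cV; apply/funext => z; rewrite /g big_geq.
    rewrite big_nat_recr//= IH /m -int_cVD//; [|exact: mind|by move=> z; exact: sume_ge0].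
    by congr int_cV; apply/funext => z; rewrite /g big_nat_recr.
  under eq_fun do rewrite E.
  apply: cvg_int_cV => //.
  - by move=> k z; exact: sume_ge0.
  - move=> z; apply/nondecreasing_seqP => k; rewrite /g big_nat_recr//=.
    by rewrite leeDl.
  - move=> z; rewrite EFinM indic_bigcup// -nneseriesZl//.
    exact: (@is_cvg_nneseries R (fun i => (rho z * \1_(F i) z)%:E) xpredT).
pose mu : {measure set 'cV[R]_n -> \bar R} := HB.pack m (isMeasure.Build _ _ _ m m0 mge0 mU).
exists mu; split=> // f mf f0; apply/esym.
pose J (h : 'cV[R]_n -> \bar R) := int_cV (fun z => (rho z)%:E * h z).
have mrh h : measurable_fun setT h -> measurable_fun setT (fun z : 'cV[R]_n => (rho z)%:E * h z).
  by move=> mh; apply: emeasurable_funM => //; exact/measurable_EFinP.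
have rh0 h : (forall z : 'cV[R]_n, 0 <= h z) -> forall z, 0 <= (rho z)%:E * h z.
  by move=> h0 z; rewrite mule_ge0// lee_fin.
apply: (@ge0_functional_integral _ _ mu J) => //.
- move=> h k mh mk h0 k0; rewrite /J -int_cVD//; [|exact: mrh|exact: mrh|exact: rh0|exact: rh0].
  by congr int_cV; apply/funext => z; rewrite ge0_muleDr.
- move=> h c mh h0 c0; rewrite /J -int_cVZl//; [|exact: mrh|exact: rh0].
  by congr int_cV; apply/funext => z; rewrite muleCA.
- move=> h_ h mh h0 nh hh; apply: cvg_int_cV.
  + by move=> k; exact: mrh.
  + by move=> k; exact: rh0.
  + by move=> z a b ab; rewrite lee_wpmul2l// ?lee_fin//; exact: nh.
  + by move=> z; apply: cvgeZl.
Qed.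
End density.

Section measurable_cV.
Context (R : realType) d (T : measurableType d).

Lemma measurable_mulmx m n (M : 'M[R]_(m, n)) (f : T -> 'cV[R]_n) :
  measurable_fun setT f -> measurable_fun setT (fun x => M *m f x).
Proof.
move=> /measurable_fun_cVP mf; apply/measurable_fun_cVP => i.
under eq_fun do rewrite mxE.
by apply: measurable_sum => j; apply: measurable_funM.
Qed.

Lemma measurable_cVD n (f g : T -> 'cV[R]_n) :
  measurable_fun setT f -> measurable_fun setT g -> measurable_fun setT (fun x => f x + g x).
Proof.
move=> /measurable_fun_cVP mf /measurable_fun_cVP mg; apply/measurable_fun_cVP => i.
by under eq_fun do rewrite mxE; apply: measurable_funD.
Qed.

Lemma measurable_cVB n (f g : T -> 'cV[R]_n) :
  measurable_fun setT f -> measurable_fun setT g -> measurable_fun setT (fun x => f x - g x).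
Proof.
move=> /measurable_fun_cVP mf /measurable_fun_cVP mg; apply/measurable_fun_cVP => i.
by under eq_fun do rewrite !mxE; apply: measurable_funB.
Qed.

Lemma measurable_qf n (S : 'M[R]_n) (f : T -> 'cV[R]_n) :
  measurable_fun setT f -> measurable_fun setT (fun x => qf S (f x)).
Proof.
move=> mf; rewrite /qf.
under eq_fun do rewrite -mulmxA mxE.
apply: measurable_sum => j; apply: measurable_funM.
  by under eq_fun do rewrite mxE; move/measurable_fun_cVP : mf; exact.
by move/measurable_fun_cVP : (measurable_mulmx S mf); exact.
Qed.
End measurable_cV.

(** * Gaussian integrals *)

Section gauss_int.
Context (R : realType).

Lemma integral_gauss1 (q u : R) : 0 < q ->
  (\int[lebesgue_measure]_t (expR (- 2^-1 * (q * (t - u) ^+ 2)))%:E = (Num.sqrt (2 * pi / q))%:E)%E.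
Proof.
move=> q0; pose s : R := (Num.sqrt q)^-1.
have s0 : s != 0 by rewrite invr_eq0 sqrtr_eq0 -ltNge.
have ss : s ^+ 2 = q^-1 by rewrite exprVn sqr_sqrtr// ltW.
have := integral_normal_pdf u s.
rewrite normal_pdfE//.
under eq_integral do rewrite EFinM.
rewrite ge0_integralZl//; first last.
- by rewrite lee_fin normal_peak_ge0.
- by move=> x _; rewrite lee_fin normal_fun_ge0.
- by apply/measurable_EFinP; exact: measurable_normal_fun.
have -> : (fun t => (normal_fun u s t)%:E) = (fun t => (expR (- 2^-1 * (q * (t - u) ^+ 2)))%:E).
  apply/funext => t; rewrite /normal_fun ss; congr (expR _)%:E.
  by rewrite -mulr_natl invfM invrK; ring.
have np : (0 < normal_peak s) by rewrite normal_peak_gt0.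
move=> /(congr1 (fun x => ((normal_peak s)^-1)%:E * x)%E).
rewrite muleA -EFinM mulVf ?gt_eqF// mul1e mule1 => ->.
by rewrite /normal_peak invrK ss; congr (Num.sqrt _)%:E; rewrite -mulr_natl; ring.
Qed.

(** The centre [u] is arbitrary because fixing the first coordinate shifts the centre of the
    Gaussian in the other ones. The value does not depend on the centre, so the inner integral
    factors out and the Schur complement governs the remaining one-dimensional integral. *)
Lemma int_cV_gauss n (Q : 'M[R]_n) (u : 'cV[R]_n) : posdef Q ->
  int_cV (fun z => (expR (- 2^-1 * qf Q (z - u)))%:E) =
  (Num.sqrt (2 * pi) ^+ n / Num.sqrt (\det Q))%:E.
Proof.
elim: n Q u => [|n IH] Q u pQ.
  by rewrite /= /qf mxE big_ord0 mulr0 expR0 expr0 det_mx00 sqrtr1 divr1.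
have [q [r [Q2 [E pQ2 q0]]]] := @posdef_blockP R n Q pQ.
set q1 := q - _ in q0.
rewrite [LHS]/=.
have H t : int_cV (fun z : 'cV[R]_n => (expR (- 2^-1 * qf Q ((col_mx (t%:M : 'cV_1) z : 'cV[R]_n.+1) - u)))%:E) =
   ((Num.sqrt (2 * pi) ^+ n / Num.sqrt (\det Q2)) * expR (- 2^-1 * (q1 * (t - (usubmx (u : 'cV[R]_(1 + n)) 0 0)) ^+ 2)))%:E.
  set u1 := usubmx _ 0 0; pose u2 : 'cV[R]_n := dsubmx (u : 'cV[R]_(1 + n)).
  pose c : 'cV[R]_n := u2 - (t - u1) *: (invmx Q2 *m r).
  transitivity (int_cV (fun z : 'cV[R]_n => (expR (- 2^-1 * (q1 * (t - u1) ^+ 2)))%:E * (expR (- 2^-1 * qf Q2 (z - c)))%:E)%E).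
    congr int_cV; apply/funext => z; rewrite -EFinM -expRD -mulrDr; congr (expR (_ * _))%:E.
    have -> : (col_mx (t%:M : 'cV_1) z : 'cV[R]_n.+1) - u = col_mx ((t - u1)%:M : 'cV_1) (z - u2) :> 'cV[R]_(1 + n).
      rewrite -[u in LHS](vsubmxK (u : 'cV[R]_(1 + n))) (opp_col_mx (usubmx (u : 'cV[R]_(1 + n)))) (add_col_mx (t%:M : 'cV_1)).
      by congr col_mx; rewrite raddfB/= -mx11E.
    have -> : qf Q = @qf R (1 + n) (block_mx q%:M r^T r Q2) by rewrite -E.
    rewrite qf_block//; congr (_ + qf _ _).
    by rewrite /c opprB addrA addrAC.
  rewrite int_cVZl ?expR_ge0//; first last.
  - apply/measurable_EFinP; apply: measurableT_comp => //; apply: measurable_funM => //.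
    by apply: measurable_qf; exact: measurable_cVB.
  by rewrite IH// -EFinM mulrC.
under eq_integral do rewrite H EFinM.
rewrite ge0_integralZl//; first last.
- apply/measurable_EFinP; apply: measurableT_comp => //; apply: measurable_funM => //.
  by apply: measurable_funM => //; apply: measurable_funX; exact: measurable_funB.
rewrite integral_gauss1//.
rewrite E (det_posdef_block _ _ (posdef_unit pQ2)) -/q1 -EFinM; congr (_%:E).
have d0 := posdef_det_gt0 pQ2.
rewrite (sqrtrM _ (ltW q0)) (sqrtrM (q1^-1)) ?mulr_ge0 ?pi_ge0// sqrtrV ?ltW// exprSr.
by rewrite invfM; ring.
Qed.
End gauss_int.

(** * Gaussian laws *)

Section matrix_cvg.
Context (R : realType).

Definition mxcvg m n (A_ : nat -> 'M[R]_(m, n)) (A : 'M[R]_(m, n)) : Prop :=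
  forall i j, A_ k i j @[k --> \oo] --> A i j.

Lemma cvg_sumR (I : Type) (s : seq I) (P : pred I) (f : I -> nat -> R) (l : I -> R) :
  (forall i, f i k @[k --> \oo] --> l i) ->
  (\sum_(i <- s | P i) f i k) @[k --> \oo] --> \sum_(i <- s | P i) l i.
Proof.
move=> h; elim: s => [|i s IH].
  by under eq_fun do rewrite big_nil; rewrite big_nil; exact: cvg_cst.
under eq_fun do rewrite big_cons; rewrite big_cons.
by case: (P i) => //; apply: cvgD.
Qed.

Lemma cvg_prodR (I : Type) (s : seq I) (P : pred I) (f : I -> nat -> R) (l : I -> R) :
  (forall i, f i k @[k --> \oo] --> l i) ->
  (\prod_(i <- s | P i) f i k) @[k --> \oo] --> \prod_(i <- s | P i) l i.
Proof.
move=> h; elim: s => [|i s IH].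
  by under eq_fun do rewrite big_nil; rewrite big_nil; exact: cvg_cst.
under eq_fun do rewrite big_cons; rewrite big_cons.
by case: (P i) => //; apply: cvgM.
Qed.

Lemma mxcvg_cst m n (A : 'M[R]_(m, n)) : mxcvg (fun=> A) A.
Proof. by move=> i j; exact: cvg_cst. Qed.

Lemma mxcvgD m n (A_ B_ : nat -> 'M[R]_(m, n)) A B :
  mxcvg A_ A -> mxcvg B_ B -> mxcvg (fun k => A_ k + B_ k) (A + B).
Proof.
by move=> hA hB i j; under eq_fun do rewrite mxE; rewrite mxE; exact: cvgD.
Qed.

Lemma mxcvgB m n (A_ B_ : nat -> 'M[R]_(m, n)) A B :
  mxcvg A_ A -> mxcvg B_ B -> mxcvg (fun k => A_ k - B_ k) (A - B).
Proof.
by move=> hA hB i j; under eq_fun do rewrite !mxE; rewrite !mxE; exact: cvgB.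
Qed.

Lemma mxcvgM m n p (A_ : nat -> 'M[R]_(m, n)) (B_ : nat -> 'M[R]_(n, p)) A B :
  mxcvg A_ A -> mxcvg B_ B -> mxcvg (fun k => A_ k *m B_ k) (A *m B).
Proof.
move=> hA hB i j; under eq_fun do rewrite mxE; rewrite mxE.
by apply: cvg_sumR => l; exact: cvgM.
Qed.

Lemma mxcvgT m n (A_ : nat -> 'M[R]_(m, n)) A : mxcvg A_ A -> mxcvg (fun k => (A_ k)^T) A^T.
Proof. by move=> hA i j; under eq_fun do rewrite mxE; rewrite mxE; exact: hA. Qed.

Lemma cvg_det n (A_ : nat -> 'M[R]_n) A : mxcvg A_ A -> \det (A_ k) @[k --> \oo] --> \det A.
Proof.
move=> h; apply: cvg_sumR => s; apply: cvgM; first exact: cvg_cst.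
exact: cvg_prodR.
Qed.

Lemma mxcvg_inv n (A_ : nat -> 'M[R]_n) A : mxcvg A_ A ->
  (forall k, A_ k \in unitmx) -> A \in unitmx -> mxcvg (fun k => invmx (A_ k)) (invmx A).
Proof.
move=> h u_ u i j.
have E k : invmx (A_ k) i j = (\det (A_ k))^-1 * (\adj (A_ k)) i j.
  by rewrite /invmx u_ mxE.
under eq_fun do rewrite E.
rewrite /invmx u mxE; apply: cvgM.
  by apply: cvgV; [rewrite -unitfE -unitmxE|exact: cvg_det].
rewrite mxE; under eq_fun do rewrite mxE.
rewrite /cofactor; apply: cvgM; first exact: cvg_cst.
by apply: cvg_det => a b; under eq_fun do rewrite !mxE; rewrite !mxE; exact: h.
Qed.

Lemma cvg_qf n (S_ : nat -> 'M[R]_n) S (z_ : nat -> 'cV[R]_n) z :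
  mxcvg S_ S -> mxcvg z_ z -> qf (S_ k) (z_ k) @[k --> \oo] --> qf S z.
Proof. by move=> hS hz; apply: mxcvgM => //; apply: mxcvgM => //; exact: mxcvgT. Qed.

End matrix_cvg.

Section isgauss.
Context (R : realType) (d : measure_display) (Omega : measurableType d).
Context (Pr : probability Omega R).

(** Up to the factor (2 pi)^(-k/2), the density at [a] of M x plus a standard normal vector. Hence
    its mean under N(0, S) is [gauss_bump] at the covariance 1 + M S M', which is invertible even
    when S is singular. *)
Definition bump k n (M : 'M[R]_(k, n)) (a : 'cV[R]_k) (x : 'cV[R]_n) : R :=
  expR (- 2^-1 * qf 1%:M (M *m x - a)).

Definition gauss_bump k (W : 'M[R]_k) (a : 'cV[R]_k) : R :=
  (Num.sqrt (\det W))^-1 * expR (- 2^-1 * qf (invmx W) a).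

Definition psd n (S : 'M[R]_n) : Prop := S^T = S /\ forall z, 0 <= qf S z.

(* The law is Gaussian, centred, with possibly singular covariance [S]: tested
   on the functions exp(-|Mx-a|^2/2), a class stable under linear maps, limits
   and convolution. *)
Definition isgauss n (X : Omega -> 'cV[R]_n) (S : 'M[R]_n) : Prop :=
  [/\ measurable_fun setT X, psd S &
   forall k (M : 'M[R]_(k, n)) a,
     (\int[Pr]_w (bump M a (X w))%:E = (gauss_bump (1%:M + M *m S *m M^T) a)%:E)%E].

Lemma qf_congr m n (S : 'M[R]_n) (M : 'M[R]_(m, n)) z : qf (M *m S *m M^T) z = qf S (M^T *m z).
Proof. by rewrite /qf trmx_mul trmxK !mulmxA. Qed.

Lemma qf_mulmx m n (S : 'M[R]_n) (L : 'M[R]_(n, m)) z : qf (L^T *m S *m L) z = qf S (L *m z).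
Proof. by rewrite -[L in RHS]trmxK -qf_congr trmxK. Qed.

Lemma qfN n (S : 'M[R]_n) z : qf S (- z) = qf S z.
Proof. by rewrite /qf [(- z)^T]linearN /= !mulNmx mulmxN opprK. Qed.

Lemma posdef_psd n (S : 'M[R]_n) : posdef S -> psd S.
Proof. by move=> pS; split; [case: pS|move=> z; exact: posdef_qf_ge0]. Qed.

Lemma psd_congr m n (S : 'M[R]_n) (M : 'M[R]_(m, n)) : psd S -> psd (M *m S *m M^T).
Proof.
move=> [s h]; split; first by rewrite !trmx_mul trmxK s mulmxA.
by move=> z; rewrite qf_congr.
Qed.

Lemma psdD n (S S' : 'M[R]_n) : psd S -> psd S' -> psd (S + S').
Proof.
move=> [s h] [s' h']; split; first by rewrite linearD /= s s'.
by move=> z; rewrite qfD addr_ge0.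
Qed.

Lemma posdef1D n (V : 'M[R]_n) : psd V -> posdef (1%:M + V).
Proof. by move=> [s h]; apply: posdefD => //; exact: posdef_scalar. Qed.

Lemma bump_ge0 k n (M : 'M[R]_(k, n)) a x : 0 <= bump M a x.
Proof. exact: expR_ge0. Qed.

Lemma qf1_ge0 n (z : 'cV[R]_n) : 0 <= qf 1%:M z.
Proof. exact: (posdef_qf_ge0 _ (@posdef_scalar R n 1 ltr01)). Qed.

Lemma bump_le1 k n (M : 'M[R]_(k, n)) a x : bump M a x <= 1.
Proof.
rewrite /bump -[leRHS]expR0 ler_expR mulNr oppr_le0.
apply: mulr_ge0; first by rewrite invr_ge0.
exact: qf1_ge0.
Qed.

Lemma measurable_bump d' (T : measurableType d') k n (M : 'M[R]_(k, n)) (a : T -> 'cV[R]_k) (X : T -> 'cV[R]_n) :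
  measurable_fun setT a -> measurable_fun setT X -> measurable_fun setT (fun t => bump M (a t) (X t)).
Proof.
move=> ma mX; apply: measurableT_comp => //; apply: measurable_funM => //.
by apply: measurable_qf; apply: measurable_cVB => //; exact: measurable_mulmx.
Qed.

Lemma isgauss_linear m n (L : 'M[R]_(m, n)) X S :
  isgauss X S -> isgauss (fun w => L *m X w) (L *m S *m L^T).
Proof.
move=> [mX pS h]; split; [exact: measurable_mulmx|exact: psd_congr|].
move=> k M a; rewrite (_ : M *m (L *m S *m L^T) *m M^T = (M *m L) *m S *m (M *m L)^T).
  by rewrite -h; apply: eq_integral => w _; rewrite /bump mulmxA.
by rewrite trmx_mul !mulmxA.
Qed.

(** Bumps are bounded by 1, so dominated convergence handles the expectations; on the other side 1 +
    M S M' stays positive definite in the limit, so determinant and inverse are continuous there. *)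
Lemma isgauss_lim n (X_ : nat -> Omega -> 'cV[R]_n) (S_ : nat -> 'M[R]_n) X S :
  (forall k, isgauss (X_ k) (S_ k)) -> measurable_fun setT X ->
  {ae Pr, forall w, mxcvg (X_ ^~ w) (X w)} -> mxcvg S_ S -> isgauss X S.
Proof.
move=> gX mX XX SS.
have psS k : psd (S_ k) by have [] := gX k.
have pS : psd S.
  split.
    apply/matrixP => i j; rewrite mxE.
    apply: (@cvg_unique _ _ (S_ k i j @[k --> \oo])) => //; last exact: SS.
    rewrite (_ : (fun k => S_ k i j) = (fun k => S_ k j i)); first exact: SS.
    by apply/funext => k; have [E _] := psS k; rewrite -{1}E mxE.
  move=> z; have h := cvg_qf SS (@mxcvg_cst _ _ _ z).
  apply: (@closed_cvg _ _ _ _ _ (fun x : R => 0 <= x) _ _ _ h); first exact: closed_ge.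
  by near=> k; have [_] := psS k; exact.
split=> // k M a.
have u_ i : 1%:M + M *m S_ i *m M^T \in unitmx.
  by apply: posdef_unit; apply: posdef1D; exact: psd_congr.
have pW : posdef (1%:M + M *m S *m M^T) by apply: posdef1D; exact: psd_congr.
have WW : mxcvg (fun i => 1%:M + M *m S_ i *m M^T) (1%:M + M *m S *m M^T).
  apply: mxcvgD; first exact: mxcvg_cst.
  apply: mxcvgM; last exact: mxcvg_cst.
  by apply: mxcvgM => //; exact: mxcvg_cst.
have gg : gauss_bump (1%:M + M *m S_ i *m M^T) a @[i --> \oo] --> gauss_bump (1%:M + M *m S *m M^T) a.
  apply: cvgM.
    apply: cvgV; first by rewrite gt_eqF// sqrtr_gt0 posdef_det_gt0.
    apply: continuous_cvg; [exact: sqrt_continuous|exact: cvg_det].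
  apply: continuous_cvg; first exact: continuous_expR.
  apply: cvgM; first exact: cvg_cst.
  apply: cvg_qf; last exact: mxcvg_cst.
  by apply: mxcvg_inv => //; exact: posdef_unit.
have mb i : measurable_fun setT (fun w => (bump M a (X_ i w))%:E).
  by apply/measurable_EFinP; apply: measurable_bump => //; case: (gX i).
have mb' : measurable_fun setT (fun w => (bump M a (X w))%:E).
  by apply/measurable_EFinP; apply: measurable_bump.
have cvgb : {ae Pr, forall w, setT w -> (bump M a (X_ i w))%:E @[i --> \oo] --> (bump M a (X w))%:E}.
  apply: filterS XX => w h _.
  have hr : bump M a (X_ i w) @[i --> \oo] --> bump M a (X w).
    rewrite /bump; apply: continuous_cvg; first exact: continuous_expR.
    apply: cvgM; first exact: cvg_cst.
    apply: cvg_qf; first exact: mxcvg_cst.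
    by apply: mxcvgB; [apply: mxcvgM => //; exact: mxcvg_cst|exact: mxcvg_cst].
  by apply: cvg_EFin; [near=> i|exact: hr].
have bb : {ae Pr, forall w i, setT w -> (`|(bump M a (X_ i w))%:E| <= (cst 1%E) w)%E}.
  by apply: aeW => w i _ /=; rewrite lee_fin ger0_norm ?bump_ge0// bump_le1.
have i1 : Pr.-integrable setT (cst 1%E : Omega -> \bar R).
  exact: finite_measure_integrable_cst.
have [_ _ h] := dominated_convergence measurableT mb mb' cvgb i1 bb.
apply: (cvg_unique _ h) => //.
rewrite (_ : (fun i => _) = (fun i => (gauss_bump (1%:M + M *m S_ i *m M^T) a)%:E)).
  by apply: cvg_EFin => //; near=> i.
by apply/funext => i; have [_ _ ->] := gX i.
Unshelve. all: by end_near. Qed.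

Lemma pushforward_prob d' (T : measurableType d') (X : Omega -> T) : measurable_fun setT X ->
  exists P : probability T R, (forall A, P A = Pr (X @^-1` A)) /\
   (forall f, measurable_fun setT f -> (forall x, 0 <= f x)%E ->
      (\int[P]_x f x = \int[Pr]_w f (X w))%E).
Proof.
move=> mX; pose X' : {mfun Omega >-> T} := HB.pack X (isMeasurableFun.Build _ _ _ _ X mX).
exists (distribution Pr X'); split=> // f mf f0.
by rewrite ge0_integral_pushforward//= preimage_setT.
Qed.

(** The joint law agrees with the product of the marginals on rectangles, hence everywhere, and
    Tonelli applies. *)
Lemma indep_integral d1 d2 (T1 : measurableType d1) (T2 : measurableType d2)
    (X : Omega -> T1) (Y : Omega -> T2) (f : T1 * T2 -> \bar R) :
  measurable_fun setT X -> measurable_fun setT Y ->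
  (forall A B, measurable A -> measurable B ->
     Pr (X @^-1` A `&` Y @^-1` B) = (Pr (X @^-1` A) * Pr (Y @^-1` B))%E) ->
  measurable_fun setT f -> (forall z, 0 <= f z)%E ->
  (\int[Pr]_w f (X w, Y w) = \int[Pr]_w \int[Pr]_w' f (X w, Y w'))%E.
Proof.
move=> mX mY ind mf f0.
have [PX [PXE PXi]] := pushforward_prob mX.
have [PY [PYE PYi]] := pushforward_prob mY.
have [P [PE Pi]] := pushforward_prob (measurable_fun_pair mX mY).
have mslice x : measurable_fun setT (fun y => f (x, y)).
  by apply: (measurableT_comp mf); exact: measurable_fun_pair.
transitivity (\int[P]_z f z)%E; first by rewrite Pi.
rewrite (eq_measure_integral (PX \x PY)%E); last first.
  move=> A mA _; apply/esym; apply: product_measure_unique => // B C mB mC.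
  transitivity (Pr ((fun w => (X w, Y w)) @^-1` (B `*` C))); first exact: PE.
  transitivity (Pr (X @^-1` B) * Pr (Y @^-1` C))%E; first exact: ind.
  by congr (_ * _)%E; [exact/esym/PXE|exact/esym/PYE].
rewrite fubini_tonelli1// PXi//.
- by apply: eq_integral => w _; rewrite /fubini_F PYi.
- exact: (measurable_fun_fubini_tonelli_F (m2 := PY)).
- by move=> x; apply: integral_ge0.
Qed.

(** Averaging over Y alone turns a bump of X + Y into a multiple of another bump of X, with matrix L
    M where L' L is the inverse of 1 + M S' M'; the hypothesis on X then applies to this bump. *)
Lemma isgauss_add n (X Y : Omega -> 'cV[R]_n) S S' :
  isgauss X S -> isgauss Y S' ->
  (forall A B, measurable A -> measurable B ->
     Pr (X @^-1` A `&` Y @^-1` B) = (Pr (X @^-1` A) * Pr (Y @^-1` B))%E) ->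
  isgauss (fun w => X w + Y w) (S + S').
Proof.
move=> [mX pS hX] [mY pS' hY] ind; split; [exact: measurable_cVD|exact: psdD|].
move=> k M a.
pose f (z : 'cV[R]_n * 'cV[R]_n) := (bump M a (z.1 + z.2))%:E.
have -> : (\int[Pr]_w (bump M a (X w + Y w))%:E = \int[Pr]_w f (X w, Y w))%E by [].
have mf : measurable_fun setT f.
  apply/measurable_EFinP; apply: measurable_bump; first exact: measurable_cst.
  exact: measurable_cVD.
rewrite indep_integral//; last by move=> z; rewrite lee_fin bump_ge0.
set V := M *m S *m M^T; set W' := 1%:M + M *m S' *m M^T.
have pV : psd V by exact: psd_congr.
have pW' : posdef W' by apply: posdef1D; exact: psd_congr.
have -> : 1%:M + M *m (S + S') *m M^T = W' + V.
  by rewrite mulmxDr mulmxDl -addrA [X in _ = _ + X]addrC.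
have [L uL WL] := posdef_factor (posdef_inv pW').
have inner w : (\int[Pr]_w' f (X w, Y w') = (Num.sqrt (\det W'))^-1%:E * (bump (L *m M) (L *m a) (X w))%:E)%E.
  transitivity (\int[Pr]_w' (bump M (a - M *m X w) (Y w'))%:E)%E.
    apply: eq_integral => w' _; rewrite /f /bump /= mulmxDr.
    by congr (expR (_ * qf _ _))%:E; rewrite opprB addrCA addrA.
  rewrite hY -EFinM; congr (_ * _)%:E; rewrite /bump; congr (expR (_ * _)).
  rewrite WL -{1}[L^T]mulmx1 qf_mulmx.
  rewrite -[RHS](_ : qf 1%:M (- (L *m M *m X w - L *m a)) = _); last first.
    exact: qfN.
  by rewrite opprB mulmxBr mulmxA.
under eq_integral do rewrite inner.
have mb : measurable_fun setT (fun w => (bump (L *m M) (L *m a) (X w))%:E).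
  by apply/measurable_EFinP; apply: measurable_bump => //; exact: measurable_cst.
rewrite ge0_integralZl//; last by move=> w _; rewrite lee_fin bump_ge0.
rewrite hX -EFinM /gauss_bump mulrA; congr (_%:E).
have eW : L *m W' *m L^T = 1%:M.
  have uL' : L^T \in unitmx by rewrite unitmx_tr.
  have -> : W' = invmx (L^T *m L) by rewrite -WL invmxK.
  by rewrite invmxM// mulmxA mulmxV// mul1mx mulVmx.
have E : 1%:M + L *m M *m S *m (L *m M)^T = L *m (W' + V) *m L^T.
  by rewrite mulmxDr mulmxDl eW trmx_mul /V !mulmxA.
have pWV : posdef (W' + V) by case: pV => ? ?; exact: posdefD.
rewrite E; congr (_ * expR (_ * _)).
  rewrite -invfM -sqrtrM ?ltW ?posdef_det_gt0//; congr (Num.sqrt _)^-1.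
  rewrite !det_mulmx det_tr.
  have := congr1 determinant eW; rewrite !det_mulmx det_tr det1 => dE.
  by rewrite -[RHS]mulr1 -dE; ring.
have uL' : L^T \in unitmx by rewrite unitmx_tr.
have uWV := posdef_unit pWV.
rewrite invmxM ?unitmx_mul ?uL ?uWV// invmxM//.
rewrite -trmx_inv mulmxA.
by rewrite qf_mulmx mulKmx.
Qed.

Lemma measurable_gaussian_density n (S : 'M[R]_n) : measurable_fun setT (gaussian_density S).
Proof.
apply: measurable_funM => //; apply: measurableT_comp => //; apply: measurable_funM => //.
by apply: (@measurable_qf R _ _ n (invmx S) id).
Qed.

Lemma gaussian_densityE n (S : 'M[R]_n) z : posdef S ->
  gaussian_density S z = ((Num.sqrt (2 * pi)) ^+ n * Num.sqrt (\det S))^-1 * expR (- 2^-1 * qf (invmx S) z).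
Proof.
move=> /posdef_det_gt0 d0; rewrite /gaussian_density invfM; congr (_ * _ * _).
  rewrite powRN [n%:R / 2]mulrC powRrM powR12_sqrt ?mulr_ge0 ?pi_ge0// powR_mulrn//.
by rewrite powRN powR12_sqrt// ltW.
Qed.

Lemma gaussian_density_ge0 n (S : 'M[R]_n) z : 0 <= gaussian_density S z.
Proof. by rewrite /gaussian_density !mulr_ge0 ?powR_ge0 ?expR_ge0. Qed.

(** Gaussian conditioning on the observation a of M z plus standard noise: the posterior precision
    is S^-1 + M' M and the posterior mean is S M' W^-1 a. *)
Lemma qf_complete k n (S : 'M[R]_n) (M : 'M[R]_(k, n)) a z : posdef S ->
  let W := 1%:M + M *m S *m M^T in
  qf (invmx S) z + qf 1%:M (M *m z - a) =
  qf (invmx S + M^T *m M) (z - S *m M^T *m invmx W *m a) + qf (invmx W) a.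
Proof.
move=> pS W.
have pW : posdef W by apply: posdef1D; apply: psd_congr; exact: posdef_psd.
have uW := posdef_unit pW; have uS := posdef_unit pS.
set c := invmx W *m a.
have Wc : W *m c = a by rewrite mulKVmx.
have Wc' : c = a - M *m S *m M^T *m c by rewrite -{1}Wc {1}/W mulmxDl mul1mx addrK.
set u := S *m M^T *m invmx W *m a.
have uE : u = S *m M^T *m c by rewrite /u /c mulmxA.
set Q := invmx S + M^T *m M.
have Qu : Q *m u = M^T *m a.
  by rewrite /Q mulmxDl uE -!mulmxA mulKmx// -Wc /W mulmxDl mul1mx mulmxDr !mulmxA.
have sQ : Q^T = Q.
  by rewrite /Q linearD /= trmx_inv trmx_mul trmxK; case: pS => ->.
have uQ : u^T *m Q = a^T *m M by rewrite -{1}sQ -trmx_mul Qu trmx_mul trmxK.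
have Ea : a^T *m invmx W *m a = a^T *m a - a^T *m M *m u.
  by rewrite -mulmxA -/c {1}Wc' mulmxBr uE !mulmxA.
have R1 : (z - u)^T *m Q *m (z - u) = z^T *m Q *m z - z^T *m M^T *m a - (a^T *m M *m z - a^T *m M *m u).
  by rewrite [(z - u)^T]linearB /= mulmxBl uQ mulmxBl !mulmxBr -(mulmxA z^T Q u) Qu mulmxA.
have R2 : (M *m z - a)^T *m 1%:M *m (M *m z - a) =
    z^T *m M^T *m M *m z - z^T *m M^T *m a - (a^T *m M *m z - a^T *m a).
  by rewrite mulmx1 [(_ - a)^T]linearB /= trmx_mul mulmxBl !mulmxBr !mulmxA.
have R3 : z^T *m Q *m z = z^T *m invmx S *m z + z^T *m M^T *m M *m z.
  by rewrite /Q mulmxDr mulmxDl !mulmxA.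
have addE (X Y : 'M[R]_1) : X 0 0 + Y 0 0 = (X + Y) 0 0 by rewrite mxE.
rewrite /qf !addE R1 R2 R3 Ea; congr (fun_of_matrix _ 0 0).
move: (z^T *m invmx S *m z) (z^T *m M^T *m M *m z) (z^T *m M^T *m a) (a^T *m M *m z) (a^T *m M *m u) (a^T *m a).
by move=> x1 x2 x3 x4 x5 x6; apply/matrixP => i j; rewrite !mxE; ring.
Qed.

Lemma int_gaussian_bump k n (S : 'M[R]_n) (M : 'M[R]_(k, n)) a : posdef S ->
  int_cV (fun z => (gaussian_density S z * bump M a z)%:E) =
  (gauss_bump (1%:M + M *m S *m M^T) a)%:E.
Proof.
move=> pS; set W := 1%:M + _.
have pW : posdef W by apply: posdef1D; apply: psd_congr; exact: posdef_psd.
pose Q := invmx S + M^T *m M.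
have pQ : posdef Q.
  apply: posdefD; first exact: posdef_inv.
    by rewrite trmx_mul trmxK.
  by move=> z; exact: qf_sqr_ge0.
pose K : R := (Num.sqrt (2 * pi) ^+ n * Num.sqrt (\det S))^-1 * expR (- 2^-1 * qf (invmx W) a).
have K0 : 0 <= K by rewrite mulr_ge0 ?expR_ge0// invr_ge0 mulr_ge0// ?exprn_ge0// sqrtr_ge0.
pose u := S *m M^T *m invmx W *m a.
transitivity (int_cV (fun z => K%:E * (expR (- 2^-1 * qf Q (z - u)))%:E)%E).
  congr int_cV; apply/funext => z; rewrite gaussian_densityE// /bump -EFinM /K -!mulrA; congr (_ * _)%:E.
  by rewrite -!expRD -!mulrDr qf_complete// addrC.
have mQ : measurable_fun setT (fun z : 'cV[R]_n => (expR (- 2^-1 * qf Q (z - u)))%:E).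
  apply/measurable_EFinP; apply: measurableT_comp => //; apply: measurable_funM => //.
  by apply: measurable_qf; exact: measurable_cVB.
rewrite int_cVZl// int_cV_gauss// -EFinM; congr (_%:E).
have dS := posdef_det_gt0 pS; have dQ := posdef_det_gt0 pQ.
rewrite /gauss_bump (_ : \det W = \det S * \det Q).
  rewrite (sqrtrM _ (ltW dS)) /K.
  have p0 : Num.sqrt (2 * pi) ^+ n != 0 :> R.
    by rewrite expf_neq0// sqrtr_eq0 -ltNge mulr_gt0// pi_gt0.
  have s1 : Num.sqrt (\det S) != 0 by rewrite sqrtr_eq0 -ltNge.
  have s2 : Num.sqrt (\det Q) != 0 by rewrite sqrtr_eq0 -ltNge.
  move: (Num.sqrt (2 * pi) ^+ n) p0 => p p0.
  by field; rewrite s1 s2 p0.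
(* By Sylvester's identity det W = det (1 + S M' M), and 1 + S M' M = S Q. *)
rewrite /W -mulmxA det_1DmulC -det_mulmx mulmxDr mulmxV ?posdef_unit//.
by rewrite mulmxA -(mulmxA S) .
Qed.

Lemma density_isgauss n (S : 'M[R]_n) X : posdef S ->
  has_density Pr X (gaussian_density S) -> isgauss X S.
Proof.
move=> pS [/random_vectorP mX hX]; split=> //; first exact: posdef_psd.
move=> k M a; rewrite -int_gaussian_bump//.
have [mu [muE mui]] := density_measure (measurable_gaussian_density S) (gaussian_density_ge0 S).
have mb : measurable_fun setT (fun z => (bump M a z)%:E).
  by apply/measurable_EFinP; apply: measurable_bump => //; exact: measurable_cst.
have [P [PE Pi]] := pushforward_prob mX.
rewrite -(Pi (fun z => (bump M a z)%:E))//; last by move=> z; rewrite lee_fin bump_ge0.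
transitivity (\int[mu]_z (bump M a z)%:E)%E.
  by apply: eq_measure_integral => A mA _; transitivity (Pr (X @^-1` A)); [exact: PE|rewrite muE// hX].
by rewrite mui// => z; rewrite lee_fin bump_ge0.
Qed.

End isgauss.

(** * Bump expectations determine a law *)

Section smoothing.
Context (R : realType).

(** The normal density at [a] with mean [x] and variance 1/q. In [x] it is a one-dimensional bump,
    in [a] it has mass one: mixing it over a half-line of values of [a] approximates the indicator
    of that half-line. *)
Definition nb (q x a : R) : R := (Num.sqrt (2 * pi / q))^-1 * expR (- 2^-1 * (q * (a - x) ^+ 2)).

Lemma nb_ge0 q x a : 0 <= nb q x a.
Proof. by rewrite mulr_ge0 ?expR_ge0// invr_ge0 sqrtr_ge0. Qed.

Lemma measurable_nb d (T : measurableType d) q (f g : T -> R) :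
  measurable_fun setT f -> measurable_fun setT g -> measurable_fun setT (fun t => nb q (f t) (g t)).
Proof.
move=> mf mg; apply: measurable_funM => //; apply: measurableT_comp => //.
by apply: measurable_funM => //; apply: measurable_funM => //; apply: measurable_funX; exact: measurable_funB.
Qed.

Lemma integral_nb q x : 0 < q -> (\int[lebesgue_measure]_a (nb q x a)%:E = 1)%E.
Proof.
move=> q0; rewrite /nb; under eq_integral do rewrite EFinM.
rewrite ge0_integralZl//; first last.
- apply/measurable_EFinP; apply: measurableT_comp => //; apply: measurable_funM => //.
  by apply: measurable_funM => //; apply: measurable_funX; exact: measurable_funB.
rewrite integral_gauss1// -EFinM mulVf// gt_eqF// sqrtr_gt0 divr_gt0// mulr_gt0// pi_gt0//.
Qed.

(** Half of the exponent is spent on the factor that is small away from [x]; the other half is the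
    normal density of twice the variance, whose normalisation costs the square root of 2. *)
Lemma nb_tail q x a e : 0 < q -> 0 <= e -> e <= `|a - x| ->
  nb q x a <= Num.sqrt 2 * expR (- (q * e ^+ 2 / 4)) * nb (q / 2) x a.
Proof.
move=> q0 e0 ea; rewrite /nb.
have -> : 2 * pi / (q / 2) = 2 * (2 * pi / q) :> R by field; rewrite gt_eqF.
rewrite (sqrtrM (2 * pi / q))// [in leRHS]invfM.
have s2 : Num.sqrt (2 : R) != 0 by rewrite sqrtr_eq0 -ltNge.
set c := (Num.sqrt (2 * pi / q))^-1.
rewrite (_ : _ * _ * _ = c * (expR (- (q * e ^+ 2 / 4)) * expR (- 2^-1 * (q / 2 * (a - x) ^+ 2)))); last by field.
rewrite ler_wpM2l// ?invr_ge0 ?sqrtr_ge0// -expRD ler_expR.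
have : e ^+ 2 <= (a - x) ^+ 2 by rewrite -[leRHS]real_normK ?num_real// ler_sqr// ?nnegrE.
move: (e ^+ 2) ((a - x) ^+ 2) => u v uv.
have : q * u <= q * v by rewrite ler_pM2l.
rewrite mulrAC; lra.
Qed.

Lemma integral_nb_tail q x e (A : set R) : 0 < q -> 0 <= e -> measurable A ->
  (forall a, A a -> e <= `|a - x|) ->
  (\int[lebesgue_measure]_a (nb q x a * \1_A a)%:E <= (Num.sqrt 2 * expR (- (q * e ^+ 2 / 4)))%:E)%E.
Proof.
move=> q0 e0 mA hA.
set K := _ * expR _; have K0 : 0 <= K by rewrite mulr_ge0 ?expR_ge0 ?sqrtr_ge0.
rewrite -[leRHS]mule1 -(@integral_nb (q / 2) x) ?divr_gt0//.
have mn q' : measurable_fun setT (fun a => nb q' x a) by exact: measurable_nb.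
have mnI : measurable_fun setT (fun a : R => (nb q x a * \1_A a)%:E).
  by apply/measurable_EFinP; apply: measurable_funM => //; exact: measurable_indic.
rewrite -ge0_integralZl//; last 2 first.
- by apply/measurable_EFinP; exact: mn.
- by move=> a _; rewrite lee_fin nb_ge0.
apply: ge0_le_integral => //.
- by move=> a _; rewrite lee_fin mulr_ge0// nb_ge0.
- by apply: measurable_funeM; apply/measurable_EFinP; exact: mn.
move=> a _; rewrite -EFinM lee_fin indicE.
have [/set_mem Aa|_] := boolP (a \in A); last by rewrite mulr0 mulr_ge0// nb_ge0.
by rewrite mulr1; apply: nb_tail => //; exact: hA.
Qed.

(** Bounds the tail of [nb] at distance e = 1/(m+1) for the precision q = (m+1)^4: e tends to 0
    while q e^2 = (m+1)^2 diverges. *)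
Definition bnd (m : nat) : R := Num.sqrt 2 * 4 * m.+1%:R^-1.

Lemma bnd_cvg0 : bnd m @[m --> \oo] --> 0.
Proof.
rewrite -[X in _ --> X](mulr0 (Num.sqrt 2 * 4)).
by apply: cvgM; [exact: cvg_cst|exact: cvg_harmonic].
Qed.

Lemma expR_bnd (m : nat) : Num.sqrt 2 * expR (- (m.+1%:R ^+ 4 * (m.+1%:R^-1) ^+ 2 / 4)) <= bnd m.
Proof.
rewrite /bnd -[leRHS]mulrA ler_wpM2l ?sqrtr_ge0//.
have m0 : (0 : R) < m.+1%:R by [].
rewrite (_ : _ / 4 = m.+1%:R ^+ 2 / 4); last by field; rewrite gt_eqF.
rewrite expRN -[leRHS]invrK invfM invrK lef_pV2 ?posrE ?expR_gt0 ?mulr_gt0 ?invr_gt0//.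
apply: le_trans (expR_ge1Dx _).
have h1 : (1 : R) <= m.+1%:R by rewrite ler1n.
have : (m.+1%:R : R) * 1 <= m.+1%:R * m.+1%:R by rewrite ler_pM2l.
rewrite expr2; lra.
Qed.

(** The half-line is prolonged by 1/(m+1), much more than the standard deviation (m+1)^-2, so that
    the limit at x = b is 1 and not 1/2. Convergence then holds at every point, as it must for laws
    that may charge the boundary. *)
Definition smooth_step (b : R) (m : nat) (x : R) : \bar R :=
  (\int[lebesgue_measure]_a (nb (m.+1%:R ^+ 4) x a * \1_`]-oo, (b + m.+1%:R^-1)%R] a)%:E)%E.

Lemma smooth_step_ge0 b m x : (0 <= smooth_step b m x)%E.
Proof. by apply: integral_ge0 => a _; rewrite lee_fin mulr_ge0// nb_ge0. Qed.

Lemma smooth_stepD b m x : (smooth_step b m x +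
  \int[lebesgue_measure]_a (nb (m.+1%:R ^+ 4) x a * \1_(~` `]-oo, (b + m.+1%:R^-1)%R]) a)%:E = 1)%E.
Proof.
have mn q' : measurable_fun setT (fun a => nb q' x a) by exact: measurable_nb.
have mI (A : set R) : measurable A -> measurable_fun setT (fun a : R => (nb (m.+1%:R ^+ 4) x a * \1_A a)%:E).
  by move=> mA; apply/measurable_EFinP; apply: measurable_funM => //; exact: measurable_indic.
rewrite -ge0_integralD//.
- rewrite -(@integral_nb (m.+1%:R ^+ 4) x) ?exprn_gt0//.
  apply: eq_integral => a _; rewrite -EFinD -mulrDr indicC indicE.
  by case: (_ \in _); rewrite ?addr0 ?add0r mulr1.
- by move=> a _; rewrite lee_fin mulr_ge0// nb_ge0.
- exact: mI.
- by move=> a _; rewrite lee_fin mulr_ge0// nb_ge0.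
- by apply: mI; exact: measurableC.
Qed.

Lemma smooth_step_le1 b m x : (smooth_step b m x <= 1)%E.
Proof.
rewrite -(smooth_stepD b m x) leeDl//.
by apply: integral_ge0 => a _; rewrite lee_fin mulr_ge0// nb_ge0.
Qed.

Lemma cvg_smooth_step b x : smooth_step b m x @[m --> \oo] --> (\1_`]-oo, b] x)%:E.
Proof.
have tail m (A : set R) : measurable A -> (forall a, A a -> m.+1%:R^-1 <= `|a - x|) ->
    (\int[lebesgue_measure]_a (nb (m.+1%:R ^+ 4) x a * \1_A a)%:E <= (bnd m)%:E)%E.
  move=> mA hA; apply: le_trans (integral_nb_tail _ _ mA hA) _.
  - by rewrite exprn_gt0.
  - by rewrite invr_ge0.
  - by rewrite lee_fin expR_bnd.
have [xb|bx] := leP x b.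
- rewrite indicE mem_set /= ?in_itv//=.
  apply: (@squeeze_cvge _ _ _ _ (fun m => (1 - bnd m)%:E) _ (cst 1%E)).
  + apply: nearW => m; rewrite smooth_step_le1 andbT EFinB -(smooth_stepD b m x).
    rewrite leeBlDr//; apply: leeD => //.
    apply: tail; first exact: measurableC.
    move=> a /= /negP; rewrite in_itv /= -ltNge => ba.
    by rewrite ler_normr; apply/orP; left; move: (m.+1%:R^-1) ba => r ba; lra.
  + apply: cvg_EFin; first by near=> m.
    rewrite -[X in _ --> X]subr0; apply: cvgB; [exact: cvg_cst|exact: bnd_cvg0].
  + exact: cvg_cst.
- rewrite indicE memNset /= ?in_itv/= ?leNgt ?bx//.
  apply: (@squeeze_cvge _ _ _ _ (cst 0%E) _ (fun m => (bnd m)%:E)).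
  + have : 0 < (x - b) / 2 by rewrite divr_gt0// subr_gt0.
    move=> /(cvgr_lt _ (@cvg_harmonic R)) hh.
    near=> m; rewrite smooth_step_ge0/=; apply: tail => // a /=; rewrite in_itv /= => ba.
    rewrite ler_normr; apply/orP; right.
    have : m.+1%:R^-1 < (x - b) / 2 by near: m.
    move: (m.+1%:R^-1) ba => r ba; lra.
  + exact: cvg_cst.
  + by apply: cvg_EFin; [near=> m|exact: bnd_cvg0].
Unshelve. all: by end_near. Qed.
End smoothing.

Section bump_unique.
Context (R : realType) (n : nat).

Definition step_fun (b : R) (x : R) : R := \1_`]-oo, b] x.

Lemma measurable_step b : measurable_fun setT (step_fun b).
Proof. exact: measurable_indic. Qed.

Definition half (b : 'I_n -> R) : set 'cV[R]_n := [set z | forall i, z i 0 <= b i].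

Lemma measurable_half_cV (b : 'I_n -> R) : measurable (half b).
Proof.
rewrite (_ : half b = \bigcap_(i in [set: 'I_n]) ((fun z : 'cV[R]_n => z i 0) @^-1` `]-oo, b i])).
  apply: fin_bigcap_measurable => // i _.
  by rewrite -[X in measurable X]setTI; apply: measurable_coord.
apply/seteqP; split=> z /= h i; first by move=> _; rewrite /= in_itv /= h.
by have := h i I; rewrite /= in_itv.
Qed.

Definition halves : set (set 'cV[R]_n) := [set A | exists b, A = half b].

Lemma borel_cV_half : (measurable : set (set 'cV[R]_n)) = <<s halves >>.
Proof.
apply/seteqP; split; last first.
  apply: smallest_sub; first exact: sigma_algebra_measurable.
  by move=> _ [b ->]; exact: measurable_half_cV.
apply: smallest_sub; first exact: smallest_sigma_algebra.
move=> A; rewrite -bigcup_seq => -[i _ [B mB <-]].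
pose T := g_sigma_algebraType halves.
suff : measurable_fun (setT : set T) (fun z : T => (z : 'cV[R]_n) i 0) by apply.
apply: (measurability _ (RGenOInfty.measurableE R)).
move=> _ [_ [x ->] <-]; rewrite setTI.
(* The half-space where coordinate i is at most x is the increasing union of orthants whose other
   bounds are k. *)
rewrite (_ : _ @^-1` _ = ~` \bigcup_(k : nat) half (fun j => if j == i then x else k%:R)).
  apply: measurableC; apply: bigcup_measurable => k _.
  by apply: sub_sigma_algebra; eexists.
apply/seteqP; split=> z /=; rewrite in_itv/= andbT.
  by move=> xz [k _ /(_ i)]; rewrite eqxx leNgt xz.
move=> h; rewrite ltNge; apply/negP => zx; apply: h.
have [k hk] : exists k : nat, forall j, z j 0 <= k%:R.
  exists (\max_j (Num.truncn `|z j ord0|).+1)%N => j.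
  apply: le_trans (ler_norm _) _; apply: le_trans (ltW (truncnS_gt _)) _.
  by rewrite ler_nat (leq_bigmax j).
by exists k => // j; case: eqP => [->|_].
Qed.

(* Coordinate by coordinate, a Gaussian bump is replaced by an indicator of a
   half-line, which is a limit of mixtures of bumps. *)
Lemma bump_half_integral (mu nu : probability 'cV[R]_n R) :
  (forall k (M : 'M[R]_(k, n)) a, \int[mu]_z (bump M a z)%:E = \int[nu]_z (bump M a z)%:E)%E ->
  forall (k : nat) (g : 'I_n -> R -> R),
  (forall i : 'I_n, (i < k)%N -> exists b, g i = step_fun b) ->
  (forall i : 'I_n, (k <= i)%N -> exists q a, 0 < q /\ g i = fun x => nb q x a) ->
  (\int[mu]_z (\prod_i g i (z i 0))%:E = \int[nu]_z (\prod_i g i (z i 0))%:E)%E.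
Proof.
move=> munu; elim=> [|k IH] g g1 g2.
  have /choice[q /choice[a h]] : forall i, exists q a, 0 < q /\ g i = fun x => nb q x a.
    by move=> i; exact: g2.
  (* A product of one-dimensional bumps in the separate coordinates is a multiple of one bump with
     diagonal matrix. *)
  pose M : 'M[R]_n := diag_mx (\row_i Num.sqrt (q i)).
  pose a' : 'cV[R]_n := \col_i (Num.sqrt (q i) * a i).
  pose C := \prod_i (Num.sqrt (2 * pi / q i))^-1.
  have C0 : 0 <= C by apply: prodr_ge0 => i _; rewrite invr_ge0 sqrtr_ge0.
  have E (z : 'cV[R]_n) : (\prod_i g i (z i 0))%:E = (C%:E * (bump M a' z)%:E)%E.
    rewrite -EFinM; congr (_%:E).
    under eq_bigr do rewrite (h _).2 /nb.
    rewrite big_split/= -/C; congr (_ * _).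
    rewrite -expR_sum /bump -mulr_sumr; congr (expR (_ * _)).
    rewrite /qf mulmx1 [RHS]mxE; apply: eq_bigr => i _.
    rewrite mul_diag_mx !mxE -mulrBr -expr2 exprMn sqr_sqrtr ?ltW ?(h _).1//.
    by rewrite -sqrrN opprB.
  have mb : measurable_fun setT (fun z => (bump M a' z)%:E).
    by apply/measurable_EFinP; apply: measurable_bump => //; exact: measurable_cst.
  under eq_integral do rewrite E; under [RHS]eq_integral do rewrite E.
  by rewrite !ge0_integralZl ?munu// => z _; rewrite lee_fin bump_ge0.
have [kn|nk] := ltnP k n; last first.
  apply: IH => [i ik|i ki]; first by apply: g1; exact: ltnW.
  by have := ltn_ord i; rewrite ltnNge (leq_trans nk ki).
pose i0 := Ordinal kn.
have [b gb] := g1 i0 (leqnn _).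
pose h (z : 'cV[R]_n) := \prod_(i | i != i0) g i (z i 0).
have gE (z : 'cV[R]_n) : \prod_i g i (z i 0) = step_fun b (z i0 0%R) * h z.
  by rewrite (bigD1 i0)//= gb.
have mg i : measurable_fun setT (g i).
  have [ik|ki] := ltnP i k.+1; first by have [b' ->] := g1 i ik; exact: measurable_step.
  by have [q [a [q0 ->]]] := g2 i ki; exact: measurable_nb.
have bg i : exists c, forall x, 0 <= g i x <= c.
  have [ik|ki] := ltnP i k.+1.
    have [b' ->] := g1 i ik; exists 1 => x; rewrite /step_fun indicE.
    by case: (_ \in _); rewrite ?lexx ler01.
  have [q [a [q0 ->]]] := g2 i ki; exists (Num.sqrt (2 * pi / q))^-1 => x.
  rewrite nb_ge0 /nb ler_piMr// ?invr_ge0 ?sqrtr_ge0// -[leRHS]expR0 ler_expR.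
  by rewrite mulNr oppr_le0 mulr_ge0// mulr_ge0 ?(ltW q0)// sqr_ge0.
have [c hc] := choice bg.
have mh : measurable_fun setT h.
  rewrite /h; under eq_fun do rewrite big_mkcond.
  apply: measurable_prod => i _ /=; case: (i != i0) => //.
  by apply: measurableT_comp => //; exact: measurable_coord.
have h0 z : 0 <= h z by apply: prodr_ge0 => i _; have /andP[] := hc i (z i 0).
pose Ch := \prod_(i | i != i0) c i.
have hC z : h z <= Ch by apply: ler_prod => i _; exact: hc.
(* Tonelli makes the integral with a smoothed step a mixture over [a] of integrals in which
   coordinate [i0] carries a Gaussian factor again; the induction hypothesis covers those. *)
have main (P : probability 'cV[R]_n R) m :
   (\int[P]_z (smooth_step b m (z i0 0%R) * (h z)%:E) =
    \int[lebesgue_measure]_a ((\1_`]-oo, (b + m.+1%:R^-1)%R] a)%:E *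
       \int[P]_z (nb (m.+1%:R ^+ 4) (z i0 0%R) a * h z)%:E))%E.
  pose q : R := m.+1%:R ^+ 4.
  pose f (za : 'cV[R]_n * R) := (nb q (za.1 i0 0%R) za.2 * \1_`]-oo, (b + m.+1%:R^-1)%R] za.2 * h za.1)%:E.
  have mf : measurable_fun setT f.
    apply/measurable_EFinP; apply: measurable_funM; last exact: measurableT_comp.
    apply: measurable_funM; last by apply: measurableT_comp => //; exact: measurable_indic.
    apply: measurable_nb => //.
    by apply: (measurableT_comp (f := fun z : 'cV[R]_n => z i0 0%R)) => //; exact: measurable_coord.
  have f0 za : (0 <= f za)%E by rewrite lee_fin !mulr_ge0// nb_ge0.
  have := @fubini_tonelli _ _ _ _ R P lebesgue_measure f mf f0.
  rewrite (_ : (\int[P]_x \int[lebesgue_measure]_y f (x, y))%E = (\int[P]_z (smooth_step b m (z i0 0%R) * (h z)%:E))%E); last first.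
    apply: eq_integral => z _; rewrite /smooth_step -ge0_integralZr//.
    - by apply/measurable_EFinP; apply: measurable_funM; [exact: measurable_nb|exact: measurable_indic].
    - by move=> a _; rewrite lee_fin mulr_ge0// nb_ge0.
    - by rewrite lee_fin.
  move=> ->; apply: eq_integral => a _.
  rewrite -ge0_integralZl//.
  - by apply: eq_integral => z _; rewrite /f /= -EFinM mulrAC mulrC mulrA.
  - apply/measurable_EFinP; apply: measurable_funM => //.
    by apply: measurable_nb => //; exact: measurable_coord.
  - by move=> z _; rewrite lee_fin mulr_ge0// nb_ge0.
have eqm m : (\int[mu]_z (smooth_step b m (z i0 0%R) * (h z)%:E) = \int[nu]_z (smooth_step b m (z i0 0%R) * (h z)%:E))%E.
  rewrite !main; apply: eq_integral => a _; congr (_ * _)%E.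
  pose g' i := if i == i0 then (fun x => nb (m.+1%:R ^+ 4) x a) else g i.
  have E (z : 'cV[R]_n) : (nb (m.+1%:R ^+ 4) (z i0 0%R) a * h z) = \prod_i g' i (z i 0).
    rewrite (bigD1 i0)//= /g' eqxx; congr (_ * _).
    by apply: eq_bigr => i /negbTE ->.
  under eq_integral do rewrite E; under [RHS]eq_integral do rewrite E.
  apply: IH => i ik; rewrite /g'.
    case: eqP => [ii|_]; first by move: ik; rewrite ii /= ltnn.
    by apply: g1; exact: ltnW.
  have [ii|/eqP ii] := eqP; first by exists (m.+1%:R ^+ 4), a; rewrite exprn_gt0.
  apply: g2; rewrite ltn_neqAle ik andbT; apply: contra ii => /eqP ki.
  by apply/eqP/val_inj.
have lim (P : probability 'cV[R]_n R) :
   (\int[P]_z (smooth_step b m (z i0 0%R) * (h z)%:E) @[m --> \oo] --> \int[P]_z (\prod_i g i (z i 0))%:E)%E.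
  have ms m : measurable_fun setT (fun z : 'cV[R]_n => (smooth_step b m (z i0 0%R) * (h z)%:E)%E).
    apply: emeasurable_funM; last exact/measurable_EFinP.
    apply: (measurableT_comp (f := smooth_step b m)); last exact: measurable_coord.
    apply: (measurable_fun_fubini_tonelli_F (m2 := @lebesgue_measure R) (fun xa : R * R => (nb (m.+1%:R ^+ 4) xa.1 xa.2 * \1_`]-oo, (b + m.+1%:R^-1)%R] xa.2)%:E)).
      apply/measurable_EFinP; apply: measurable_funM; first exact: measurable_nb.
      by apply: measurableT_comp => //; exact: measurable_indic.
    by move=> xa; rewrite lee_fin mulr_ge0// nb_ge0.
  have [] := @dominated_convergence _ _ R P setT measurableT (fun m z => (smooth_step b m (z i0 0%R) * (h z)%:E)%E)
    (fun z => (\prod_i g i (z i 0))%:E) (cst Ch%:E) ms.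
  - apply/measurable_EFinP; apply: measurable_prod => i _; apply: measurableT_comp => //; exact: measurable_coord.
  - apply: aeW => z _; rewrite gE EFinM; apply: cvgeM => //.
    + exact: cvg_smooth_step.
    + exact: cvg_cst.
  - exact: finite_measure_integrable_cst.
  - apply: aeW => z m _; rewrite gee0_abs ?mule_ge0 ?smooth_step_ge0 ?lee_fin//=.
    rewrite -[leRHS]mul1e; apply: lee_pmul; rewrite ?smooth_step_ge0 ?smooth_step_le1 ?lee_fin//.
  by move=> _ _.
apply: (cvg_unique _ (lim mu)) => //.
rewrite (_ : (fun m => _) = (fun m => \int[nu]_z (smooth_step b m (z i0 0%R) * (h z)%:E))%E); first exact: lim.
by apply/funext => m; rewrite eqm.
Qed.

(** Closed lower orthants form a pi-system that generates the Borel sets, and their indicators are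
    products of steps in all n coordinates. *)
Lemma bump_unique (mu nu : probability 'cV[R]_n R) :
  (forall k (M : 'M[R]_(k, n)) a, \int[mu]_z (bump M a z)%:E = \int[nu]_z (bump M a z)%:E)%E ->
  forall A, measurable A -> mu A = nu A.
Proof.
move=> munu A mA.
apply: (measure_unique halves (fun k => half (fun=> k%:R))) => //.
- exact: borel_cV_half.
- move=> _ _ [b ->] [b' ->]; exists (fun i => Num.min (b i) (b' i)).
  apply/seteqP; split=> z /=.
    by move=> [h1 h2] i; rewrite le_min h1 h2.
  by move=> h; split=> i; have := h i; rewrite le_min => /andP[].
- by move=> k; eexists.
- apply/seteqP; split=> // z _.
  exists (\max_j (Num.truncn `|z j ord0|).+1)%N => // j.
  apply: le_trans (ler_norm _) _; apply: le_trans (ltW (truncnS_gt _)) _.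
  by rewrite ler_nat (leq_bigmax j).
- move=> _ [b ->].
  have E (P : probability 'cV[R]_n R) : P (half b) = (\int[P]_z (\prod_i step_fun (b i) (z i 0))%:E)%E.
    transitivity (\int[P]_z (\1_(half b) z)%:E)%E.
      by rewrite integral_indic ?setIT//; exact: measurable_half_cV.
    apply: eq_integral => z _; congr (_%:E).
    rewrite /step_fun indicE; have [/set_mem hz|] := boolP (z \in half b).
      by rewrite big1// => i _; rewrite indicE mem_set//= in_itv/= hz.
    move=> /negP hz; have [i hi] : exists i, ~ z i 0 <= b i.
      by apply/existsNP => h; apply: hz; apply/mem_set.
    rewrite (bigD1 i)//= indicE memNset ?mul0r//= in_itv/=; exact/negP.
  apply: etrans; first exact: (E mu).
  apply: etrans; last exact/esym/(E nu).
  apply: (bump_half_integral munu (k := n) (g := fun i => step_fun (b i))).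
  + by move=> i _; eexists.
  + by move=> i; rewrite leqNgt ltn_ord.
- by move=> k; apply: (le_lt_trans (probability_le1 _ _)); rewrite ?ltry//; exact: measurable_half_cV.
Qed.
End bump_unique.

Lemma isgauss_density (R : realType) d (Omega : measurableType d) (Pr : probability Omega R)
    n (X : Omega -> 'cV[R]_n) S :
  isgauss Pr X S -> posdef S -> has_density Pr X (gaussian_density S).
Proof.
move=> [mX pS hX] pdS; split; first exact/random_vectorP.
have [P [PE Pi]] := pushforward_prob Pr mX.
have [mu [muE mui]] := density_measure (measurable_gaussian_density S) (gaussian_density_ge0 S).
have mb k (M : 'M[R]_(k, n)) a : measurable_fun setT (fun z => (bump M a z)%:E).
  by apply/measurable_EFinP; apply: measurable_bump => //; exact: measurable_cst.
have mub k (M : 'M[R]_(k, n)) a : (\int[mu]_z (bump M a z)%:E = (gauss_bump (1%:M + M *m S *m M^T) a)%:E)%E.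
  by rewrite mui -?int_gaussian_bump// => z; rewrite lee_fin bump_ge0.
have Pb k (M : 'M[R]_(k, n)) a : (\int[P]_z (bump M a z)%:E = (gauss_bump (1%:M + M *m S *m M^T) a)%:E)%E.
  by rewrite Pi ?hX// => z; rewrite lee_fin bump_ge0.
(* A bump with zero rows is the constant 1, so its integral is the total mass. This is what lets
   [mu] be treated as a probability. *)
have mu1 : mu setT = 1%E.
  have : (\int[mu]_z (bump (0 : 'M[R]_(0, n)) 0 z)%:E = \int[P]_z (bump (0 : 'M[R]_(0, n)) 0 z)%:E)%E.
    by rewrite mub Pb.
  have E z : (bump (0 : 'M[R]_(0, n)) 0 z)%:E = 1%E.
    by rewrite /bump /qf mxE big_ord0 mulr0 expR0.
  under eq_integral do rewrite E; under [RHS]eq_integral do rewrite E.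
  by rewrite !integral_cst//= !mul1e probability_setT.
have nuE A : mnormalize mu P A = mu A by rewrite /mnormalize mu1 onee_eq0 /= invr1 mule1.
move=> A mA; rewrite -muE// -nuE -PE.
apply: (bump_unique _ mA) => k M a; rewrite Pb -mub.
apply: eq_measure_integral => B mB _; first [exact: nuE | exact/esym/nuE].
Qed.

(** * Calculus on an interval *)

Section calculus.
Context (R : realType).
Notation leb := (@lebesgue_measure R).

Lemma heine_cantor (phi : R -> R) (a b e : R) : continuous phi -> 0 < e ->
  exists2 dl : R, 0 < dl & forall s t, a <= s <= b -> `|s - t| < dl -> `|phi s - phi t| < e.
Proof.
move=> cphi e0.
pose P (dl x : R) := forall t, `|x - t| < dl -> `|phi x - phi t| < e.
have hc : near_covering `[a, b].
  by apply/compact_near_coveringP; exact: segment_compact.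
have : \forall dl \near (0 : R)^'+, `[a, b] `<=` P dl.
  apply: hc => x xab.
  have /nbhs_ballP[r /= r0 hr] : \forall t \near x, `|phi x - phi t| < e / 2.
    by move/cvgrPdist_lt : (cphi x); apply; rewrite divr_gt0.
  near=> x' dl => t /= x't.
  have xx' : `|x - x'| < r / 2 by near: x'; apply: nbhsx_ballx; rewrite divr_gt0.
  have dlr : dl < r / 2 by near: dl; apply: nbhs_right_lt; rewrite divr_gt0.
  have h1 : `|phi x - phi x'| < e / 2 by apply: hr; rewrite /ball /=; lra.
  have h2 : `|phi x - phi t| < e / 2.
    apply: hr; rewrite /ball /= (_ : x - t = (x - x') + (x' - t)); last by ring.
    by apply: le_lt_trans (ler_normD _ _) _; lra.
  rewrite (_ : phi x' - phi t = (phi x - phi t) - (phi x - phi x')); last by ring.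
  by apply: le_lt_trans (ler_normB _ _) _; lra.
move=> hP.
have h : \forall dl \near (0 : R)^'+, 0 < dl by exact: nbhs_right_gt.
have [dl [dl0 hdl]] : exists dl : R, 0 < dl /\ `[a, b] `<=` P dl.
  by near ((0 : R)^'+) => dl; exists dl; split; near: dl.
by exists dl => // s t sab; apply: hdl; rewrite /= in_itv.
Unshelve. all: by end_near. Qed.

Lemma integrable_cont (f : R -> R) (a b : R) : continuous f -> leb.-integrable `[a, b] (EFin \o f).
Proof.
move=> cf; apply: continuous_compact_integrable; first exact: segment_compact.
exact: continuous_subspaceT.
Qed.

Lemma is_derive_continuous (F : R -> R) (t df : R) : is_derive t 1 F df -> {for t, continuous F}.
Proof. by move=> dFt; apply: differentiable_continuous; apply/derivable1_diffP. Qed.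

Lemma FTC2 (F f : R -> R) (a b : R) : a <= b ->
  (forall t : R, a <= t <= b -> is_derive t 1 F (f t)) -> continuous f ->
  \int[leb]_(t in `[a, b]) f t = F b - F a.
Proof.
rewrite le_eqVlt => /predU1P[->|ab] dF cf.
  by rewrite set_itv1 Rintegral_set1 subrr.
have cF t : a <= t <= b -> {for t, continuous F}.
  by move=> /dF dFt; exact: is_derive_continuous dFt.
rewrite /Rintegral (@continuous_FTC2 _ f F)//.
- exact: continuous_subspaceT.
- split.
  + by move=> t; rewrite in_itv/= => /andP[ta tb]; apply: ex_derive; apply: dF; rewrite !ltW.
  + by apply: cvg_at_right_filter; apply: cF; rewrite lexx ltW.
  + by apply: cvg_at_left_filter; apply: cF; rewrite lexx ltW.
- move=> t; rewrite in_itv/= => /andP[ta tb]; rewrite derive1E; apply: derive_val.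
  by apply: dF; rewrite !ltW.
Qed.

(** Integrating from -1 makes 0 an interior point, so that the derivative at 0 is two-sided; the
    subtracted constant makes the primitive vanish at 0. *)
Definition prim (g : R -> R) (t : R) : R :=
  \int[leb]_(s in `[-1, t]) g s - \int[leb]_(s in `[-1, 0]) g s.

Lemma is_derive_prim (g : R -> R) (t : R) : continuous g -> -1 < t -> is_derive t 1 (prim g) (g t).
Proof.
move=> cg t1.
pose G (x : R) := \int[leb]_(s in `[-1, x]) g s.
have [d1 d2] : derivable G t 1 /\ derive1 G t = g t.
  exact: (@continuous_FTC1_closed R g (-1) t (t + 1) (ltr_pwDr ltr01 (lexx t)) (integrable_cont (-1) (t+1) cg) t1 (cg t)).
have -> : prim g = G - cst (G 0) by [].
move: G d1 d2 => G d1 d2.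
have h : is_derive t 1 G (g t) by apply: (DeriveDef d1); rewrite -derive1E.
by apply: is_derive_eq; rewrite subr0.
Qed.

Lemma primE (g : R -> R) (t : R) : continuous g -> 0 <= t -> prim g t = \int[leb]_(s in `[0, t]) g s.
Proof.
move=> cg t0; have dp (s : R) : 0 <= s <= t -> is_derive s 1 (prim g) (g s).
  by move=> /andP[s0 _]; apply: is_derive_prim => //; apply: lt_le_trans s0.
by rewrite (FTC2 t0 dp cg) [X in _ - X](_ : _ = 0) ?subr0// /prim subrr.
Qed.

Lemma prim0 (g : R -> R) : prim g 0 = 0.
Proof. by rewrite /prim subrr. Qed.

Lemma deriv_le_bound (F f : R -> R) (a b c : R) : a <= b ->
  (forall t : R, a <= t <= b -> is_derive t 1 F (f t)) ->
  (forall t : R, a <= t <= b -> `|f t| <= c) -> `|F b - F a| <= c * (b - a).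
Proof.
move=> ab dF fc.
have [||x xab ->] := @MVT_segment R F f a b ab.
- by move=> x; rewrite in_itv/= => /andP[? ?]; apply: dF; rewrite !ltW.
- apply: continuous_in_subspaceT => x; rewrite inE /= in_itv /= => xab.
  exact: is_derive_continuous (dF _ xab).
rewrite normrM [`|b - a|]ger0_norm ?subr_ge0// ler_wpM2r ?subr_ge0//.
by apply: fc; move: xab; rewrite in_itv.
Qed.

Lemma cont_bounded (f : R -> R) (a b : R) : continuous f ->
  exists2 c : R, 0 <= c & forall t, a <= t <= b -> `|f t| <= c.
Proof.
move=> cf.
have /compact_bounded[M [_ hM]] : compact (f @` `[a, b]).
  by apply: continuous_compact; [exact: continuous_subspaceT|exact: segment_compact].
exists (Num.max 0 (M + 1)); first by rewrite le_max lexx.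
move=> t tab; rewrite le_max; apply/orP; right; apply: (hM (M + 1)); first by rewrite ltrDl.
by exists t => //=; rewrite in_itv.
Qed.

Definition grid (T : R) (N j : nat) : R := T * j%:R / N%:R.

Definition stieltjes (g phi : R -> R) (T : R) (N : nat) : R :=
  \sum_(j < N) g (grid T N j) * (phi (grid T N j.+1) - phi (grid T N j)).

Lemma grid_in (T : R) N j : 0 <= T -> (j <= N)%N -> 0 <= grid T N j <= T.
Proof.
move=> T0; rewrite /grid; case: N => [|N] jN.
  by rewrite invr0 mulr0 lexx.
rewrite divr_ge0 ?mulr_ge0//= ler_pdivrMr// ler_wpM2l// ler_nat//.
Qed.

Lemma gridS (T : R) N j : grid T N j.+1 - grid T N j = T / N%:R.
Proof. by rewrite /grid -mulrBl -mulrBr -natrB// subSnn mulr1. Qed.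

(** Only [g] is smooth; [phi], later a Brownian path, is merely continuous. On a cell [a, b] the
    error of summation by parts is the increment of H - g phi(b), whose derivative g' (phi - phi(b))
    is small by uniform continuity of [phi]. *)
Lemma stieltjes_cvg (g g' phi : R -> R) (T : R) : 0 <= T ->
  (forall t : R, 0 <= t <= T -> is_derive t 1 g (g' t)) -> continuous g' -> continuous phi ->
  stieltjes g phi T k.+1 @[k --> \oo] -->
    g T * phi T - g 0 * phi 0 - \int[leb]_(s in `[0, T]) (g' s * phi s).
Proof.
move=> T0 dg cg' cphi.
have cgp : continuous (fun s => g' s * phi s) by move=> s; apply: cvgM; [exact: cg'|exact: cphi].
rewrite -primE//; set H := prim _.
have dH (t : R) : 0 <= t -> is_derive t 1 H (g' t * phi t).
  by move=> t0; apply: is_derive_prim => //; apply: lt_le_trans t0.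
pose err k := \sum_(j < k.+1) ((H (grid T k.+1 j.+1) - H (grid T k.+1 j)) -
   (g (grid T k.+1 j.+1) - g (grid T k.+1 j)) * phi (grid T k.+1 j.+1)).
have telesc (f : nat -> R) N : \sum_(j < N) (f j.+1 - f j) = f N - f 0%N.
  by rewrite -(big_mkord xpredT (fun j => f j.+1 - f j)) telescope_sumr.
have g0 N : grid T N 0 = 0 by rewrite /grid mulr0 mul0r.
have gN k : grid T k.+1 k.+1 = T by rewrite /grid mulfK// pnatr_eq0.
have E k : stieltjes g phi T k.+1 = g T * phi T - g 0 * phi 0 - H T + err k.
  have HT : H T = \sum_(j < k.+1) (H (grid T k.+1 j.+1) - H (grid T k.+1 j)).
    by rewrite (telesc (fun j => H (grid T k.+1 j))) g0 gN /H prim0 subr0.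
  have GT : g T * phi T - g 0 * phi 0 = \sum_(j < k.+1)
     (g (grid T k.+1 j.+1) * phi (grid T k.+1 j.+1) - g (grid T k.+1 j) * phi (grid T k.+1 j)).
    by rewrite (telesc (fun j => g (grid T k.+1 j) * phi (grid T k.+1 j))) g0 gN.
  rewrite GT HT /err /stieltjes -sumrB -big_split /=; apply: eq_bigr => j _; ring.
have herr : err k @[k --> \oo] --> 0.
  have [c c0 hc] := @cont_bounded g' 0 T cg'.
  apply/cvgrPdist_lt => e e0.
  (* The cells add up to an error of at most c e1 T, which is below e; the summand 1 keeps the
     denominator positive. *)
  pose e1 := e / (c * T + 1).
  have cT : 0 < c * T + 1 by rewrite ltr_wpDl// mulr_ge0.
  have e10 : 0 < e1 by rewrite divr_gt0.
  have [dl dl0 hdl] := @heine_cantor phi 0 T e1 cphi e10.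
  have hT : \forall k \near \oo, T * harmonic k < dl.
    have : T * harmonic k @[k --> \oo] --> 0.
      by rewrite -(mulr0 T); apply: cvgM; [exact: cvg_cst|exact: cvg_harmonic].
    by move=> /cvgr_lt; exact.
  near=> k.
  have hk : T / k.+1%:R < dl by near: k.
  rewrite sub0r normrN.
  apply: (@le_lt_trans _ _ (\sum_(j < k.+1) (c * e1) * (T / k.+1%:R))).
    apply: le_trans (ler_norm_sum _ _ _) _; apply: ler_sum => j _.
    set a := grid T k.+1 j; set b := grid T k.+1 j.+1.
    have ba : b - a = T / k.+1%:R by rewrite gridS.
    have /andP[a0 aT] : 0 <= a <= T by apply: grid_in => //; exact: ltnW.
    have /andP[b0 bT] : 0 <= b <= T by apply: grid_in => //.
    have ab : a <= b by rewrite -subr_ge0 ba divr_ge0.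
    rewrite -ba (_ : _ - _ = (H b - g b * phi b) - (H a - g a * phi b)); last by ring.
    apply: (@deriv_le_bound (fun s => H s - g s * phi b) (fun s => g' s * phi s - g' s * phi b)) => //.
      move=> t /andP[at_ tb]; apply: is_deriveB.
        by apply: dH; apply: le_trans at_.
      have := is_deriveM (dg t _) (is_derive_cst (phi b) t 1).
      rewrite (le_trans a0 at_) (le_trans tb bT) => /(_ isT).
      by move=> h; apply: (is_derive_eq h); rewrite scaler0 add0r [LHS]mulrC.
    move=> t /andP[at_ tb]; rewrite -mulrBr normrM; apply: ler_pM => //.
      by apply: hc; rewrite (le_trans a0)//= (le_trans tb).
    apply/ltW/hdl; first by rewrite (le_trans a0)//= (le_trans tb).
    rewrite distrC ger0_norm ?subr_ge0//; apply: le_lt_trans hk; rewrite -ba; lra.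
  rewrite sumr_const card_ord -[X in X < _]mulr_natr.
  rewrite -mulrA divfK ?pnatr_eq0// mulrAC.
  rewrite /e1 mulrA ltr_pdivrMr// mulrC ltr_pM2l// ltrDl//.
rewrite (_ : (fun k => _) = (fun k => g T * phi T - g 0 * phi 0 - H T + err k)); last by apply/funext.
by rewrite -[X in _ --> X]addr0; apply: cvgD; [exact: cvg_cst|exact: herr].
Unshelve. all: by end_near. Qed.

(** Integration by parts expresses the integral as a pointwise limit of Stieltjes sums, each
    involving finitely many of the random variables [Y t]. *)
Lemma measurable_path_integral d (Om : measurableType d) (g' : R -> R) (Y : R -> Om -> R) (T : R) :
  0 <= T -> continuous g' -> (forall w, continuous (Y ^~ w)) ->
  (forall t, 0 <= t <= T -> measurable_fun setT (Y t)) ->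
  measurable_fun setT (fun w => \int[leb]_(s in `[0, T]) (g' s * Y s w)).
Proof.
move=> T0 cg' cY mY.
pose g := prim g'.
have dg (t : R) : 0 <= t <= T -> is_derive t 1 g (g' t).
  by move=> /andP[t0 _]; apply: is_derive_prim => //; apply: lt_le_trans t0.
have mS k : measurable_fun setT (fun w => stieltjes g (Y ^~ w) T k.+1).
  apply: measurable_sum => j; apply: measurable_funM => //; apply: measurable_funB; apply: mY; apply: grid_in => //.
  exact: ltnW.
rewrite (_ : (fun w => _) = (fun w => g T * Y T w - g 0 * Y 0 w -
   (g T * Y T w - g 0 * Y 0 w - \int[leb]_(s in `[0, T]) (g' s * Y s w)))); last first.
  by apply/funext => w; ring.
have mE : measurable_fun setT (fun w => g T * Y T w - g 0 * Y 0 w).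
  by apply: measurable_funB; apply: measurable_funM => //; apply: mY; rewrite lexx ?T0.
apply: measurable_funB => //.
apply: (measurable_fun_cvg mS) => w _.
exact: (stieltjes_cvg T0 dg).
Qed.

(** The product of q and exp(-c t) is nonincreasing. Derivatives are asked only inside the interval,
    which is where the Riccati equation provides them. *)
Lemma gronwall0 (q q' : R -> R) (c T : R) : {within `[0, T], continuous q} ->
  (forall t : R, 0 < t < T -> is_derive t 1 q (q' t)) ->
  (forall t : R, 0 < t < T -> q' t <= c * q t) -> q 0 <= 0 ->
  forall t, 0 <= t <= T -> q t <= 0.
Proof.
move=> cq dq hq q0 t /andP[t0 tT].
pose r s := q s * expR (- (c * s)).
have de (s : R) : is_derive s 1 (fun s => expR (- (c * s))) (- c * expR (- (c * s))).
  have h1 : is_derive s 1 (fun s : R => - (c * s)) (- c).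
    by apply: is_derive_eq; rewrite scaler1.
  have := @is_derive1_comp R expR (fun s => - (c * s)) s _ _ (is_derive_expR _) h1.
  by rewrite mulrC.
have ce : continuous (fun s => expR (- (c * s))) by move=> s; exact: is_derive_continuous (de s).
have dr s : 0 < s < T -> is_derive s 1 r ((q' s - c * q s) * expR (- (c * s))).
  move=> sT; have := is_deriveM (dq s sT) (de s) => h.
  by apply: (is_derive_eq h); rewrite /GRing.scale /=; ring.
have : r t <= r 0.
  apply: (@ler0_derive1_le_cc R r 0 T); rewrite ?in_itv/= ?lexx ?t0 ?tT ?(le_trans t0)//.
  - by move=> s; rewrite in_itv/= => sT; apply: ex_derive; exact: dr.
  - move=> s; rewrite in_itv/= => sT; have hd := dr s sT; rewrite derive1E derive_val.
    by rewrite mulr_le0_ge0 ?expR_ge0// subr_le0 hq.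
  - move=> x; apply: cvgM; [exact: cq|exact: (continuous_subspaceT ce)].
rewrite /r mulr0 oppr0 expR0 mulr1 => h.
by have := le_trans h q0; rewrite pmulr_lle0// expR_gt0.
Qed.

End calculus.

(** * Entrywise calculus for matrix functions *)

Section matrix_calculus.
Context (R : realType).
Notation leb := (@lebesgue_measure R).

Definition dmx m n (F : R -> 'M[R]_(m, n)) (D : 'M[R]_(m, n)) (t : R) : Prop :=
  forall i j, is_derive t 1 (fun s => F s i j) (D i j).

Definition cmx m n (F : R -> 'M[R]_(m, n)) : Prop := forall i j, continuous (fun s => F s i j).

Definition imx m n (F : R -> 'M[R]_(m, n)) (a b : R) : 'M[R]_(m, n) :=
  \matrix_(i, j) \int[leb]_(s in `[a, b]) F s i j.

Definition primx m n (F : R -> 'M[R]_(m, n)) (t : R) : 'M[R]_(m, n) :=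
  \matrix_(i, j) prim (fun s => F s i j) t.

Lemma is_derive_sumR (I : Type) (s : seq I) (f : I -> R -> R) (df : I -> R) (t : R) :
  (forall i, is_derive t 1 (f i) (df i)) ->
  is_derive t 1 (fun x => \sum_(i <- s) f i x) (\sum_(i <- s) df i).
Proof.
move=> h; elim: s => [|i s IH].
  rewrite big_nil (_ : (fun _ => _) = cst 0); first exact: is_derive_cst.
  by apply/funext => x; rewrite big_nil.
rewrite big_cons (_ : (fun _ => _) = (f i) + (fun x => \sum_(j <- s) f j x)).
  exact: is_deriveD.
by apply/funext => x; rewrite big_cons.
Qed.

Lemma cvg_sumF (U : Type) (F : set_system U) (FF : Filter F) (I : Type) (s : seq I) (f : I -> U -> R) (l : I -> R) :
  (forall i, f i x @[x --> F] --> l i) ->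
  (\sum_(i <- s) f i x) @[x --> F] --> \sum_(i <- s) l i.
Proof.
move=> h; elim: s => [|i s IH].
  by under eq_fun do rewrite big_nil; rewrite big_nil; exact: cvg_cst.
by under eq_fun do rewrite big_cons; rewrite big_cons; apply: cvgD.
Qed.

Lemma dmxM m n p (F : R -> 'M[R]_(m, n)) (G : R -> 'M[R]_(n, p)) F' G' t :
  dmx F F' t -> dmx G G' t -> dmx (fun s => F s *m G s) (F' *m G t + F t *m G') t.
Proof.
move=> hF hG i j.
rewrite (_ : (fun s => _) = (fun s => \sum_k F s i k * G s k j)); last first.
  by apply/funext => s; rewrite mxE.
have -> : (F' *m G t + F t *m G') i j = \sum_k (F t i k *: G' k j + G t k j *: F' i k).
  rewrite !mxE -big_split /=; apply: eq_bigr => k _; rewrite /GRing.scale /=; ring.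
apply: is_derive_sumR => k.
exact: is_deriveM (hF i k) (hG k j).
Qed.

Lemma dmx_cst m n (A : 'M[R]_(m, n)) t : dmx (fun=> A) 0 t.
Proof. by move=> i j; rewrite mxE; exact: is_derive_cst. Qed.

Lemma dmx_eq m n (F : R -> 'M[R]_(m, n)) D D' t : dmx F D t -> D = D' -> dmx F D' t.
Proof. by move=> h <-. Qed.

Lemma dmxD m n (F G : R -> 'M[R]_(m, n)) F' G' t :
  dmx F F' t -> dmx G G' t -> dmx (fun s => F s + G s) (F' + G') t.
Proof.
move=> hF hG i j; rewrite mxE (_ : (fun s => _) = (fun s => F s i j) + (fun s => G s i j)).
  exact: is_deriveD (hF i j) (hG i j).
by apply/funext => s; rewrite mxE.
Qed.

Lemma dmxN m n (F : R -> 'M[R]_(m, n)) F' t : dmx F F' t -> dmx (fun s => - F s) (- F') t.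
Proof.
move=> hF i j; rewrite mxE (_ : (fun s => _) = - (fun s => F s i j)).
  exact: is_deriveN (hF i j).
by apply/funext => s; rewrite mxE.
Qed.

Lemma dmxB m n (F G : R -> 'M[R]_(m, n)) F' G' t :
  dmx F F' t -> dmx G G' t -> dmx (fun s => F s - G s) (F' - G') t.
Proof. by move=> hF hG; apply: dmxD => //; exact: dmxN. Qed.

Lemma dmxT m n (F : R -> 'M[R]_(m, n)) F' t : dmx F F' t -> dmx (fun s => (F s)^T) F'^T t.
Proof.
move=> hF i j; rewrite mxE (_ : (fun s => _) = (fun s => F s j i)); first exact: hF.
by apply/funext => s; rewrite mxE.
Qed.

Lemma dmxZ m n (f : R -> R) f' (F : R -> 'M[R]_(m, n)) F' (t : R) : is_derive t 1 f f' ->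
  dmx F F' t -> dmx (fun s => f s *: F s) (f' *: F t + f t *: F') t.
Proof.
move=> hf hF i j; rewrite !mxE (_ : (fun s => _) = f * (fun s => F s i j)).
  by apply: (is_derive_eq (is_deriveM hf (hF i j))); rewrite /GRing.scale /=; ring.
by apply/funext => s; rewrite mxE.
Qed.

Lemma dmxMl m n p (A : 'M[R]_(m, n)) (G : R -> 'M[R]_(n, p)) G' t :
  dmx G G' t -> dmx (fun s => A *m G s) (A *m G') t.
Proof. by move=> h; apply: (dmx_eq (dmxM (dmx_cst A t) h)); rewrite mul0mx add0r. Qed.

Lemma dmxMr m n p (A : 'M[R]_(n, p)) (G : R -> 'M[R]_(m, n)) G' t :
  dmx G G' t -> dmx (fun s => G s *m A) (G' *m A) t.
Proof. by move=> h; apply: (dmx_eq (dmxM h (dmx_cst A t))); rewrite mulmx0 addr0. Qed.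

Lemma dmx_cmx m n (F F' : R -> 'M[R]_(m, n)) : (forall t, dmx F (F' t) t) -> cmx F.
Proof. by move=> h i j t; exact: is_derive_continuous (h t i j). Qed.

Lemma cmx_cst m n (A : 'M[R]_(m, n)) : cmx (fun=> A).
Proof. by move=> i j; exact: cst_continuous. Qed.

Lemma cont_sum (I : Type) (s : seq I) (f : I -> R -> R) :
  (forall i, continuous (f i)) -> continuous (fun x => \sum_(i <- s) f i x).
Proof.
move=> h x; elim: s => [|i s IH].
  by under eq_fun do rewrite big_nil; exact: cst_continuous.
rewrite (_ : (fun x => _) = (fun x => f i x + \sum_(j <- s) f j x)).
  by apply: cvgD; [exact: h|exact: IH].
by apply/funext => y; rewrite big_cons.
Qed.

Lemma cmxM m n p (F : R -> 'M[R]_(m, n)) (G : R -> 'M[R]_(n, p)) :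
  cmx F -> cmx G -> cmx (fun s => F s *m G s).
Proof.
move=> hF hG i j; under eq_fun do rewrite mxE; apply: cont_sum => k x.
by apply: cvgM; [exact: hF|exact: hG].
Qed.

Lemma cmxD m n (F G : R -> 'M[R]_(m, n)) : cmx F -> cmx G -> cmx (fun s => F s + G s).
Proof.
by move=> hF hG i j x; under eq_fun do rewrite mxE; apply: cvgD; [exact: hF|exact: hG].
Qed.

Lemma cmxN m n (F : R -> 'M[R]_(m, n)) : cmx F -> cmx (fun s => - F s).
Proof. by move=> hF i j x; under eq_fun do rewrite mxE; apply: cvgN; exact: hF. Qed.

Lemma cmxB m n (F G : R -> 'M[R]_(m, n)) : cmx F -> cmx G -> cmx (fun s => F s - G s).
Proof. by move=> hF hG; apply: cmxD => //; exact: cmxN. Qed.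

Lemma cmxT m n (F : R -> 'M[R]_(m, n)) : cmx F -> cmx (fun s => (F s)^T).
Proof. by move=> hF i j; under eq_fun do rewrite mxE; exact: hF. Qed.

Lemma cmxZ m n (f : R -> R) (F : R -> 'M[R]_(m, n)) : continuous f -> cmx F -> cmx (fun s => f s *: F s).
Proof.
by move=> hf hF i j x; under eq_fun do rewrite mxE; apply: cvgM; [exact: hf|exact: hF].
Qed.

Lemma dmx_primx m n (F : R -> 'M[R]_(m, n)) t : cmx F -> -1 < t -> dmx (primx F) (F t) t.
Proof.
move=> cF t1 i j; under eq_fun do rewrite mxE; exact: (is_derive_prim (cF i j)).
Qed.

Lemma imx_FTC m n (F f : R -> 'M[R]_(m, n)) a b : a <= b ->
  (forall t, a <= t <= b -> dmx F (f t) t) -> cmx f -> imx f a b = F b - F a.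
Proof.
move=> ab dF cf; apply/matrixP => i j; rewrite !mxE.
exact: (FTC2 ab (fun t tab => dF t tab i j) (cf i j)).
Qed.

Lemma imx_primx m n (F : R -> 'M[R]_(m, n)) a b : cmx F -> 0 <= a -> a <= b ->
  imx F a b = primx F b - primx F a.
Proof.
move=> cF a0 ab; apply: imx_FTC => // t /andP[ta _].
by apply: dmx_primx => //; apply: (lt_le_trans (ltrN10 R)); exact: le_trans ta.
Qed.

Lemma primx0 m n (F : R -> 'M[R]_(m, n)) : primx F 0 = 0.
Proof. by apply/matrixP => i j; rewrite !mxE prim0. Qed.

(** Both sides are increments of A times the primitive of F. The bound 0 <= a is there because
    [primx] is a primitive only to the right of -1. *)
Lemma imxMl m n p (A : 'M[R]_(m, n)) (F : R -> 'M[R]_(n, p)) a b : cmx F -> 0 <= a -> a <= b ->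
  A *m imx F a b = imx (fun s => A *m F s) a b.
Proof.
move=> cF a0 ab; rewrite imx_primx// mulmxBr; apply/esym.
apply: (imx_FTC (F := fun s => A *m primx F s)) => //.
  move=> t /andP[ta _]; apply: dmxMl; apply: dmx_primx => //.
  by apply: (lt_le_trans (ltrN10 R)); exact: le_trans ta.
by apply: cmxM => //; exact: cmx_cst.
Qed.

Lemma imxT m n (F : R -> 'M[R]_(m, n)) a b : (imx F a b)^T = imx (fun s => (F s)^T) a b.
Proof.
apply/matrixP => i j; rewrite !mxE; apply: eq_Rintegral => s _; by rewrite mxE.
Qed.

Lemma imxMr m n p (A : 'M[R]_(n, p)) (F : R -> 'M[R]_(m, n)) a b : cmx F -> 0 <= a -> a <= b ->
  imx F a b *m A = imx (fun s => F s *m A) a b.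
Proof.
move=> cF a0 ab; apply: trmx_inj; rewrite trmx_mul imxT imxMl//; last exact: cmxT.
by rewrite imxT; apply/matrixP => i j; rewrite !mxE; apply: eq_Rintegral => s _; rewrite -trmx_mul.
Qed.

Lemma imxD m n (F G : R -> 'M[R]_(m, n)) a b : cmx F -> cmx G -> 0 <= a -> a <= b ->
  imx (fun s => F s + G s) a b = imx F a b + imx G a b.
Proof.
move=> cF cG a0 ab; rewrite (imx_primx cF)// (imx_primx cG)// addrACA -opprD.
apply: (imx_FTC (F := fun s => primx F s + primx G s)) => //; last exact: cmxD.
move=> t /andP[ta _]; have t1 : -1 < t by apply: (lt_le_trans (ltrN10 R)); exact: le_trans ta.
by apply: dmxD; exact: dmx_primx.
Qed.

Lemma imx_eq m n (F G : R -> 'M[R]_(m, n)) a b : (forall s, a <= s <= b -> F s = G s) ->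
  imx F a b = imx G a b.
Proof.
move=> h; apply/matrixP => i j; rewrite !mxE; apply: eq_Rintegral => s.
by rewrite inE /= in_itv /= => sab; rewrite h.
Qed.

Lemma imx_qf_ge0 n (F : R -> 'M[R]_n) a b z : cmx F -> 0 <= a -> a <= b ->
  (forall s, a <= s <= b -> 0 <= qf (F s) z) -> 0 <= qf (imx F a b) z.
Proof.
move=> cF a0 ab h; rewrite /qf imxMl// imxMr//; last by apply: cmxM => //; exact: cmx_cst.
rewrite mxE; apply: Rintegral_ge0 => s /=; rewrite in_itv/= => sab; exact: h.
Qed.

(** Scalar Gronwall for the sum q of the squared entries: 2 X_ij M_ik X_kj is at most c (X_ij^2 +
    X_kj^2), and summing over i, j, k gives q' <= 2 c m q. *)
Lemma gronwall_mx m n (X : R -> 'M[R]_(m, n)) (M : R -> 'M[R]_m) (c T : R) :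
  (forall i j, {within `[0, T], continuous (fun s => X s i j)}) ->
  (forall t, 0 < t < T -> dmx X (M t *m X t) t) ->
  (forall t i j, 0 < t < T -> `|M t i j| <= c) -> X 0 = 0 ->
  forall t, 0 <= t <= T -> X t = 0.
Proof.
move=> cX dX hM X0 t tT.
pose q s := \sum_i \sum_j X s i j ^+ 2.
pose q' s := \sum_i \sum_j (2 * X s i j * (M s *m X s) i j).
have q0 s : 0 <= q s by apply: sumr_ge0 => i _; apply: sumr_ge0 => j _; exact: sqr_ge0.
have : q t <= 0.
  apply: (@gronwall0 R q q' (2 * c * m%:R) T) => //.
  - rewrite /q => x; apply: cvg_sumF => i; apply: cvg_sumF => j.
    exact: (cvgM (cX i j x) (cX i j x)).
  - move=> s sT; apply: is_derive_sumR => i; apply: is_derive_sumR => j.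
    have h := dX s sT i j.
    have h2 := is_deriveM h h.
    rewrite (_ : (fun x => _) = (fun x => X x i j) * (fun x => X x i j)); last by apply/funext => x; rewrite expr2.
    by apply: (is_derive_eq h2); rewrite /GRing.scale /=; ring.
  - move=> s sT.
    have Mij i j : 2 * X s i j * (M s *m X s) i j <= \sum_k c * (X s i j ^+ 2 + X s k j ^+ 2).
      rewrite mxE mulr_sumr; apply: ler_sum => k _.
      have hc := hM s i k sT.
      apply: le_trans (ler_norm _) _; rewrite !normrM ger0_norm//.
      have := sqr_ge0 (`|X s i j| - `|X s k j|).
      rewrite sqrrB !real_normK ?num_real// -mulr_natr => h.
      have h2 : `|X s i j| * (`|M s i k| * `|X s k j|) <= c * (`|X s i j| * `|X s k j|).
        by rewrite mulrCA ler_wpM2r// mulr_ge0.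
      have c0 : 0 <= c by exact: le_trans hc.
      apply: (@le_trans _ _ (c * (2 * (`|X s i j| * `|X s k j|)))).
        by rewrite -[leLHS]mulrA [leRHS]mulrCA ler_wpM2l.
      by rewrite ler_wpM2l//; move: h; lra.
    apply: (@le_trans _ _ (\sum_i \sum_j \sum_k c * (X s i j ^+ 2 + X s k j ^+ 2))).
      by apply: ler_sum => i _; apply: ler_sum => j _; exact: Mij.
    have E1 i j : \sum_k c * (X s i j ^+ 2 + X s k j ^+ 2) =
        m%:R * c * X s i j ^+ 2 + c * \sum_k X s k j ^+ 2.
      by rewrite -mulr_sumr big_split /= sumr_const card_ord -mulr_natr; ring.
    have E2 i : \sum_j \sum_k c * (X s i j ^+ 2 + X s k j ^+ 2) =
        m%:R * c * (\sum_j X s i j ^+ 2) + c * q s.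
      under eq_bigr do rewrite E1.
      by rewrite big_split /= -!mulr_sumr; congr (_ + _ * _); rewrite /q exchange_big.
    under eq_bigr do rewrite E2.
    rewrite big_split /= -mulr_sumr -/(q s) sumr_const card_ord -mulr_natr.
    rewrite le_eqVlt; apply/orP; left; apply/eqP; ring.
  - by rewrite /q X0 big1// => i _; rewrite big1// => j _; rewrite mxE expr0n.
move=> qt; have {}qt : q t = 0 by apply/eqP; rewrite eq_le qt q0.
apply/matrixP => i j; rewrite mxE.
have h1 := @psumr_eq0P _ _ xpredT _ (fun i _ => sumr_ge0 _ (fun j _ => sqr_ge0 (X t i j))) qt i isT.
have /eqP := @psumr_eq0P _ _ xpredT _ (fun j _ => sqr_ge0 (X t i j)) h1 j isT.
by rewrite sqrf_eq0 => /eqP.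
Qed.
End matrix_calculus.

(** * The matrix exponential *)

Section expm.
Context (R : realType) (n : nat) (A : 'M[R]_n).

Definition mpow (k : nat) : 'M[R]_n := iter k (mulmx A) 1%:M.

Definition mnorm1 : R := \sum_i \sum_j `|A i j|.

Lemma mnorm1_ge0 : 0 <= mnorm1.
Proof. by apply: sumr_ge0 => i _; apply: sumr_ge0. Qed.

Lemma le_mnorm1 i j : `|A i j| <= mnorm1.
Proof.
rewrite /mnorm1 (bigD1 i)//= (bigD1 j)//= -addrA lerDl addr_ge0 ?sumr_ge0// => k _.
exact: sumr_ge0.
Qed.

Lemma mpow_le k i j : `|mpow k i j| <= mnorm1 ^+ k.
Proof.
elim: k i j => [|k IH] i j.
  by rewrite /mpow /= expr0 mxE; case: (_ == _); rewrite ?normr1// normr0 ler01.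
rewrite /mpow /= mxE exprS; apply: le_trans (ler_norm_sum _ _ _) _.
apply: (@le_trans _ _ (\sum_l `|A i l| * mnorm1 ^+ k)).
  by apply: ler_sum => l _; rewrite normrM ler_wpM2l//; exact: IH.
rewrite -mulr_suml ler_wpM2r ?exprn_ge0 ?mnorm1_ge0//.
by rewrite /mnorm1 [leRHS](bigD1 i)//= lerDl; apply: sumr_ge0 => l _; exact: sumr_ge0.
Qed.

Lemma mpowSr k : mpow k.+1 = mpow k *m A.
Proof.
elim: k => [|k IH]; first by rewrite /mpow /= mul1mx mulmx1.
have -> : mpow k.+2 = A *m mpow k.+1 by [].
by rewrite {1}IH mulmxA.
Qed.

Definition ecoef (i j : 'I_n) (k : nat) : R := mpow k i j / k`!%:R.

Definition expm (t : R) : 'M[R]_n := \matrix_(i, j) limn (pseries (ecoef i j) t).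

Lemma is_cvg_pseries_exp (b : nat -> R) (C c x : R) : 0 <= C -> 0 <= c ->
  (forall k, `|b k| <= C * (c ^+ k / k`!%:R)) -> cvgn (pseries b x).
Proof.
move=> C0 c0 hb; apply: normed_cvg.
apply: (@series_le_cvg R _ (fun k => C * exp_coeff (c * `|x|) k)) => //.
- by move=> k /=.
- by move=> k; rewrite mulr_ge0// /exp_coeff /= divr_ge0// exprn_ge0// mulr_ge0.
- move=> k /=; rewrite normrM /exp_coeff /= exprMn normrX.
  rewrite (_ : C * _ = C * (c ^+ k / k`!%:R) * `|x| ^+ k); last by ring.
  by rewrite ler_wpM2r ?exprn_ge0.
- rewrite (_ : series _ = (fun k => C * series (exp_coeff (c * `|x|)) k)).
    by apply: is_cvgMl_tmp; exact: is_cvg_series_exp_coeff.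
  by apply/funext => k; rewrite /series /= mulr_sumr.
Qed.

Lemma ecoef_diff i j k : pseries_diffs (ecoef i j) k = mpow k.+1 i j / k`!%:R.
Proof.
by rewrite /pseries_diffs /ecoef factS natrM invfM mulrCA [X in _ * X]mulrA divff ?pnatr_eq0// mul1r.
Qed.

Lemma cvg_ecoef i j x : cvgn (pseries (ecoef i j) x).
Proof.
apply: (@is_cvg_pseries_exp _ 1 mnorm1) => // [|k]; first exact: mnorm1_ge0.
by rewrite mul1r normrM [`|_^-1|]ger0_norm// ler_wpM2r// mpow_le.
Qed.

Lemma cvg_ecoef_diff i j x : cvgn (pseries (pseries_diffs (ecoef i j)) x).
Proof.
apply: (@is_cvg_pseries_exp _ mnorm1 mnorm1) => [||k]; try exact: mnorm1_ge0.
by rewrite ecoef_diff normrM [`|_^-1|]ger0_norm// mulrA -exprS ler_wpM2r// mpow_le.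
Qed.

Lemma cvg_ecoef_diff2 i j x : cvgn (pseries (pseries_diffs (pseries_diffs (ecoef i j))) x).
Proof.
apply: (@is_cvg_pseries_exp _ (mnorm1 ^+ 2) mnorm1) => [||k]; rewrite ?exprn_ge0 ?mnorm1_ge0//.
have -> : pseries_diffs (pseries_diffs (ecoef i j)) k = mpow k.+2 i j / k`!%:R.
  transitivity (k.+1%:R * pseries_diffs (ecoef i j) k.+1) => //.
  by rewrite ecoef_diff factS natrM invfM mulrCA [X in _ * X]mulrA divff ?pnatr_eq0// mul1r.
by rewrite normrM [`|_^-1|]ger0_norm// mulrA -exprD ler_wpM2r// mpow_le.
Qed.

Lemma expm_lim t : mxcvg (fun N => \sum_(k < N) (t ^+ k / k`!%:R) *: mpow k) (expm t).
Proof.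
move=> i j; rewrite mxE.
rewrite (_ : (fun N => _) = pseries (ecoef i j) t); first exact: cvg_ecoef.
apply/funext => N; rewrite summxE /pseries /series /= big_mkord.
by apply: eq_bigr => k _; rewrite mxE /ecoef; ring.
Qed.

Lemma dmx_expm (t : R) : dmx expm (A *m expm t) t.
Proof.
move=> i j.
have h : is_derive t 1 (fun x => limn (pseries (ecoef i j) x)) (limn (pseries (pseries_diffs (ecoef i j)) t)).
  (* Termwise differentiation asks that the series and its first two formal derivatives converge at
     some point beyond |t|. *)
  apply: (@pseries_snd_diffs _ _ (`|t| + 1)).
  - exact: cvg_ecoef.
  - exact: cvg_ecoef_diff.
  - exact: cvg_ecoef_diff2.
  - by rewrite [ltRHS]ger0_norm ?addr_ge0// ltrDl.
under eq_fun do rewrite mxE; apply: (is_derive_eq h).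
rewrite mxE; apply/cvg_lim => //.
rewrite (_ : pseries _ _ = (fun N => \sum_l A i l * pseries (ecoef l j) t N)).
  apply: cvg_sumR => l; apply: cvgM; first exact: cvg_cst.
  by rewrite mxE; exact: cvg_ecoef.
apply/funext => N; rewrite /pseries /series /=.
under [RHS]eq_bigr do rewrite mulr_sumr.
rewrite exchange_big /=; apply: eq_bigr => k _.
rewrite ecoef_diff /mpow /= mxE -mulrA mulr_suml; apply: eq_bigr => l _.
by rewrite /ecoef -/(mpow k); ring.
Qed.

Lemma expm_comm t : A *m expm t = expm t *m A.
Proof.
have h1 := mxcvgM (@mxcvg_cst _ _ _ A) (@expm_lim t).
have h2 := mxcvgM (@expm_lim t) (@mxcvg_cst _ _ _ A).
apply/matrixP => i j; apply: (cvg_unique _ (h1 i j)) => //.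
rewrite (_ : (fun k => _) = (fun N => ((\sum_(k < N) (t ^+ k / k`!%:R) *: mpow k) *m A) i j)); first exact: h2.
apply/funext => N; congr (fun_of_matrix _ i j).
rewrite mulmx_sumr mulmx_suml; apply: eq_bigr => k _.
by rewrite -scalemxAr -scalemxAl -mpowSr.
Qed.

Lemma expm_mul_eq0 m p (C : 'M[R]_(m, n)) (z : 'M[R]_(n, p)) t :
  (forall k, C *m mpow k *m z = 0) -> C *m expm t *m z = 0.
Proof.
move=> h.
have h1 := mxcvgM (mxcvgM (@mxcvg_cst _ _ _ C) (@expm_lim t)) (@mxcvg_cst _ _ _ z).
apply/matrixP => i j; apply: (cvg_unique _ (h1 i j)) => //.
rewrite (_ : (fun k => _) = cst 0); first by rewrite mxE; exact: cvg_cst.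
apply/funext => N /=; rewrite mulmx_sumr mulmx_suml big1 ?mxE// => k _.
by rewrite -scalemxAr -scalemxAl h scaler0.
Qed.

Lemma expm0 : expm 0 = 1%:M.
Proof.
have h2 : mxcvg (fun N => \sum_(k < N) (0 ^+ k / k`!%:R) *: mpow k) 1%:M.
  move=> i j; rewrite -cvg_shiftS.
  rewrite (_ : (fun k => _) = cst ((1%:M : 'M[R]_n) i j)); first exact: cvg_cst.
  apply/funext => N /=; rewrite big_ord_recl /= expr0 fact0 divr1 scale1r big1 ?addr0// => k _.
  by rewrite expr0n mul0r scale0r.
by apply/matrixP => i j; apply: (cvg_unique _ (@expm_lim 0 i j) (h2 i j)).
Qed.

Lemma dmx_expmN (t : R) : dmx (fun s => expm (- s)) (- (expm (- t) *m A)) t.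
Proof.
move=> i j; have h : is_derive t (1 : R) (fun s : R => - s) (-1 : R) by exact: is_deriveNid.
have := @is_derive1_comp R (fun s => expm s i j) (fun s => - s) t _ _ (dmx_expm (- t) i j) h.
by rewrite mulrN1 expm_comm [in X in _ -> X]mxE.
Qed.

Lemma expmNK t : expm (- t) *m expm t = 1%:M.
Proof.
have E : expm (- t) *m expm t = expm (- 0) *m expm 0.
  apply/matrixP => i j.
  apply: (@is_derive_0_is_cst R (fun s => (expm (- s) *m expm s) i j)) => s.
  have := dmxM (dmx_expmN s) (dmx_expm s) i j.
  by rewrite mulNmx mulmxA addNr mxE.
by rewrite E oppr0 expm0 mul1mx.
Qed.

Lemma expmKN t : expm t *m expm (- t) = 1%:M.
Proof. exact/mulmx1C/expmNK. Qed.

Lemma cmx_expm : cmx expm.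
Proof. exact: (dmx_cmx dmx_expm). Qed.

Lemma cmx_expmN : cmx (fun t => expm (- t)).
Proof. exact: (dmx_cmx dmx_expmN). Qed.

End expm.

(** * Controllability and observability *)

Section scalar_facts.
Context (R : realType).
Notation leb := (@lebesgue_measure R).

(** Precomposition with [clamp] extends a function continuous on [0, T] to one continuous on the
    whole line, the form of continuity used by [cmx]. *)
Definition clamp (T x : R) : R := Num.max 0 (Num.min x T).

Lemma clamp_in (T x : R) : 0 <= T -> 0 <= clamp T x <= T.
Proof.
by move=> T0; rewrite /clamp le_max lexx /= ge_max T0 /= ge_min lexx orbT.
Qed.

Lemma clamp_id (T x : R) : 0 <= x <= T -> clamp T x = x.
Proof. by move=> /andP[x0 xT]; rewrite /clamp (min_idPl xT) (max_idPr x0). Qed.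

Lemma continuous_clamp (T : R) : continuous (clamp T).
Proof.
move=> x; apply: (@continuous_max R R^o (fun=> 0) (fun y => Num.min y T)); first exact: cst_continuous.
by apply: (@continuous_min R R^o id (fun=> T)); [exact: cvg_id|exact: cst_continuous].
Qed.

Lemma clamp_continuous (T : R) (f : R -> R) : 0 <= T ->
  {within `[0, T], continuous f} -> continuous (fun x => f (clamp T x)).
Proof.
move=> T0 /subspace_continuousP cf x.
have cx : `[0, T]%classic (clamp T x) by rewrite /= in_itv /=; exact: clamp_in.
apply: (@cvg_comp _ _ _ (clamp T) f (nbhs x) (within `[0, T] (nbhs (clamp T x)))) (cf _ cx).
move=> A; rewrite /within /= => hA.
have h := @continuous_clamp T x _ hA.
apply: (@filterS _ (nbhs x) _ (clamp T @^-1` (fun t => t \in `[0, T] -> A t)) _ _ h).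
by move=> y /= hy; apply: hy; exact: clamp_in.
Qed.

Lemma continuous_pos (c : R) : continuous (fun t : R => Num.max 0 (t - c)).
Proof.
move=> x; apply: (@continuous_max R R^o (fun=> 0) (fun y => y - c)); first exact: cst_continuous.
by apply: cvgB; [exact: cvg_id|exact: cst_continuous].
Qed.

(** Squaring removes the corner of the positive part: at 0 the difference quotient is bounded by
    |y|. The C^1 cut-offs of the gain are built from this function. *)
Lemma is_derive_pos2 (x : R) : is_derive x 1 (fun y : R => Num.max 0 y ^+ 2) (2 * Num.max 0 x).
Proof.
have [x0|x0|x0] := ltgtP x 0.
- rewrite mulr0.
  have h : is_derive x (1 : R) (cst (0 : R)) (0 : R) by exact: is_derive_cst.
  apply: (near_eq_is_derive _ h).
  near=> y; have y0 : y < 0 by near: y; exact: lt_nbhsl.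
  by rewrite (max_idPl (ltW y0)) expr0n.
- have h : is_derive x (1 : R) (fun y : R => y ^+ 2) (2 * x).
    have h2 := is_deriveX 2 (is_derive_id x (1 : R)).
    by apply: (is_derive_eq h2); rewrite /GRing.scale /= expr1 mulr1 mulr_natl.
  apply: (near_eq_is_derive _ h).
  near=> y; have y0 : 0 < y by near: y; exact: lt_nbhsr.
  by rewrite (max_idPr (ltW y0)).
rewrite x0 mulr0.
have h : (fun h : R => h^-1 *: ((fun y : R => Num.max 0 y ^+ 2) (h *: 1 + 0) - (fun y : R => Num.max 0 y ^+ 2) 0)) @ 0^' --> (0 : R).
  apply/cvgr0Pnorm_le => e e0.
  near=> y.
  have y0 : y != 0 by near: y; exact: nbhs_dnbhs_neq.
  have ye : `|y| < e.
    by near: y; apply: dnbhs0_lt.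
  rewrite [Num.max 0 0]max_l// expr0n /= subr0 addr0 /GRing.scale /= mulr1 normrM normfV ler_pdivrMl ?normr_gt0//.
  rewrite normrX expr2; apply: ler_pM => //.
    by rewrite /Num.max; case: ifP => // _; rewrite ?normr0.
  apply: le_trans (ltW ye); rewrite /Num.max; case: ifP => // _; by rewrite ?normr0.
apply: DeriveDef; first by apply/cvg_ex; exists 0.
by apply/cvg_lim.
Unshelve. all: by end_near. Qed.

Lemma int_zero_eq0 (f : R -> R) (T : R) : continuous f -> (forall t, 0 <= t <= T -> 0 <= f t) ->
  \int[leb]_(t in `[0, T]) f t = 0 -> forall t, 0 < t < T -> f t = 0.
Proof.
move=> cf f0 fi t0 /andP[t00 t0T]; apply/eqP; rewrite eq_le; apply/andP; split; last by apply: f0; rewrite !ltW.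
rewrite leNgt; apply/negP => ft.
have T0 : 0 <= T by apply/ltW/(lt_trans t00).
have df (t : R) : 0 <= t -> is_derive t 1 (prim f) (f t).
  by move=> h; apply: is_derive_prim => //; apply: lt_le_trans h.
have mono a b : 0 <= a -> a <= b -> b <= T -> prim f a <= prim f b.
  move=> a0 ab bT.
  have [||x xab h] := @MVT_segment R (prim f) f a b ab.
  - by move=> x; rewrite in_itv/= => /andP[ax _]; apply: df; apply: le_trans (ltW ax).
  - apply: continuous_in_subspaceT => x; rewrite inE /= in_itv /= => /andP[ax _].
    by apply: is_derive_continuous; apply: df; apply: le_trans ax.
  rewrite -subr_ge0 h mulr_ge0 ?subr_ge0//; move: xab; rewrite in_itv /= => /andP[ax xb].
  by apply: f0; rewrite (le_trans a0)//= (le_trans xb).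
have /nbhs_ballP[r /= r0 hr] : \forall t \near t0, 0 < f t.
  by have := cf t0 => /cvgr_gt; exact.
pose b := Num.min (t0 + r / 2) T.
have tb : t0 < b by rewrite lt_min t0T andbT ltrDl divr_gt0.
have bT : b <= T by rewrite ge_min lexx orbT.
have strict : prim f t0 < prim f b.
  have [||x xab h] := @MVT R (prim f) f t0 b tb.
  - by move=> x; rewrite in_itv/= => /andP[ax _]; apply: df; apply: le_trans (ltW ax); exact: ltW.
  - apply: continuous_in_subspaceT => x; rewrite inE /= in_itv /= => /andP[ax _].
    by apply: is_derive_continuous; apply: df; apply: le_trans ax; exact: ltW.
  rewrite -subr_gt0 h mulr_gt0 ?subr_gt0//; move: xab; rewrite in_itv /= => /andP[ax xb].
  apply: hr; rewrite /ball /= distrC ger0_norm ?subr_ge0 ?ltW//.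
  have : b <= t0 + r / 2 by rewrite ge_min lexx.
  by move: r0 xb; lra.
have h1 : prim f T = 0 by rewrite primE.
have h2 := mono 0 t0 (lexx _) (ltW t00) (ltW t0T).
have h3 := mono b T (ltW (lt_trans t00 tb)) bT (lexx _).
by move: h2 h3 strict; rewrite h1 prim0; lra.
Qed.

Lemma is_derive_zero (f : R -> R) (a b t df : R) : (forall s, a < s < b -> f s = 0) -> a < t < b ->
  is_derive t 1 f df -> df = 0.
Proof.
move=> f0 /andP[at_ tb] d.
have h : is_derive t 1 f 0.
  have h0 : is_derive t (1 : R) (cst (0 : R)) (0 : R) by exact: is_derive_cst.
  apply: (near_eq_is_derive _ h0).
  near=> s; rewrite f0//.
  apply/andP; split; near: s; [exact: lt_nbhsr|exact: lt_nbhsl].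
by rewrite -(@derive_val _ _ _ _ _ _ _ d) (@derive_val _ _ _ _ _ _ _ h).
Unshelve. all: by end_near. Qed.

End scalar_facts.

Section linear_systems.
Context (R : realType).
Notation leb := (@lebesgue_measure R).

Lemma integrable_scale (f : R -> R) (c a b : R) : leb.-integrable `[a, b] (fun s => (f s)%:E) ->
  leb.-integrable `[a, b] (fun s => (c * f s)%:E).
Proof.
move=> h; rewrite (_ : (fun s => _) = fun s => (c%:E * (f s)%:E)%E); last first.
  by apply/funext => s; rewrite EFinM.
exact: integrableZl.
Qed.

(** A bootstrap in regularity: an integrable solution equals the continuous function [H] on [0, T],
    hence the differentiable primitive of A H, and Gronwall applies to the latter. *)
Lemma int_fixpoint_eq0 n (A : 'M[R]_n) (T : R) (dl : R -> 'cV[R]_n) : 0 <= T ->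
  integrable_cV T (fun s => A *m dl s) ->
  (forall s, 0 <= s <= T -> dl s = \col_i \int[leb]_(r in `[0, s]) (A *m dl r) i 0) ->
  forall s, 0 <= s <= T -> dl s = 0.
Proof.
move=> T0 idl hdl.
pose f i r := (A *m dl r) i 0.
pose H (s : R) : 'cV[R]_n := \col_i \int[leb]_(r in `[0, clamp T s]) f i r.
have HE s : 0 <= s <= T -> dl s = H s by move=> sT; rewrite hdl// /H clamp_id.
have cH : cmx H.
  move=> i j; rewrite /H; under eq_fun do rewrite mxE.
  apply: (@clamp_continuous R T (fun x => \int[leb]_(r in `[0, x]) f i r)) => //.
  exact: (parameterized_integral_continuous T0 (idl i)).
have cAH : cmx (fun s => A *m H s) by apply: cmxM => //; exact: cmx_cst.
have HP s : 0 <= s <= T -> H s = primx (fun s => A *m H s) s.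
  move=> /andP[s0 sT]; rewrite -[RHS]subr0 -(primx0 (fun s => A *m H s)) -imx_primx//.
  apply/matrixP => i j; rewrite !mxE clamp_id ?s0//; apply: eq_Rintegral => r.
  rewrite inE /= in_itv /= => /andP[r0 rs].
  by rewrite /f HE ?r0 ?(le_trans rs)// (ord1 j).
move=> s sT; rewrite HE// HP//.
apply: (@gronwall_mx R n 1 (primx (fun s => A *m H s)) (fun=> A) (mnorm1 A) T) => //.
- move=> i j; apply: continuous_in_subspaceT => x; rewrite inE /= in_itv /= => /andP[x0 _].
  apply: is_derive_continuous; apply: dmx_primx => //; exact: lt_le_trans x0.
- move=> t /andP[t0 tT]; rewrite -HP ?ltW//; apply: dmx_primx => //; exact: lt_trans t0.
- by move=> t i j _; exact: le_mnorm1.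
- exact: primx0.
Qed.

Lemma mpow_expr n (A : 'M[R]_n.+1) k : mpow A k = A ^+ k.
Proof. by elim: k => [//|k IH]; rewrite exprS -IH. Qed.

(* [N] is the Krylov matrix with rows z A^k; Cayley-Hamilton makes its row space
   A-invariant. *)
Lemma krylov n (A : 'M[R]_n) (z : 'rV[R]_n) :
  exists (N M : 'M[R]_n) (r : 'rV[R]_n), [/\ N *m A = M *m N, z = r *m N &
    forall p (B : 'M[R]_(n, p)), (forall k, z *m mpow A k *m B = 0) -> N *m B = 0].
Proof.
pose N := \matrix_(k < n) (z *m mpow A k).
have zN : (z <= N)%MS.
  case: n A z @N => [|n] A z N; first by rewrite [z]thinmx0 sub0mx.
  have -> : z = row ord0 N by rewrite rowK /mpow /= mulmx1.
  exact: row_sub.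
have NA : (N *m A <= N)%MS.
  case: n A z @N zN => [|n] A z N zN; first by rewrite [N *m A]thinmx0 sub0mx.
  apply/row_subP => i; rewrite row_mul rowK -mulmxA -mpowSr.
  have [in_|ni] := ltnP i.+1 n.+1.
    by have := row_sub (Ordinal in_) N; rewrite rowK.
  have -> : i.+1 = n.+1 by apply/eqP; rewrite eqn_leq ltn_ord ni.
  have CH := Cayley_Hamilton A.
  have := size_char_poly A; have := char_poly_monic A.
  set p := char_poly A in CH * => /monicP pm sp.
  have : horner_mx A p = \sum_(k < n.+2) p`_k *: A ^+ k.
    rewrite -{1}[p]coefK poly_def sp rmorph_sum /=; apply: eq_bigr => k _.
    by rewrite linearZ /= rmorphXn /= horner_mx_X.
  rewrite CH big_ord_recr /= (_ : p`_n.+1 = 1); last by rewrite -pm lead_coefE sp.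
  rewrite scale1r => /eqP; rewrite eq_sym addr_eq0 => /eqP E.
  have E0 : mpow A n.+1 = - \sum_(k < n.+1) p`_k *: A ^+ k by rewrite mpow_expr E opprK.
  rewrite -[A *m mpow A n]/(mpow A n.+1) E0 mulmxN eqmx_opp mulmx_sumr; apply: summx_sub => k _.
  rewrite -scalemxAr; apply: scalemx_sub.
  by have := row_sub k N; rewrite rowK mpow_expr.
have /submxP[M hM] := NA; have /submxP[r hr] := zN.
exists N, M, r; split => // p B hB.
by apply/row_matrixP => k; rewrite row_mul rowK hB row0.
Qed.

(** Since N B = 0 and N A = M N, the vector N x solves an equation in which the control has
    disappeared, so from x(0) = 0 it stays zero. Steering 0 to z' gives N z' = 0, and z z' = r N z'
    = 0 forces z = 0. *)
Lemma controllable_kernel n m (A : 'M[R]_n) (B : 'M[R]_(n, m)) (z : 'rV[R]_n) :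
  controllable A B -> (forall k, z *m mpow A k *m B = 0) -> z = 0.
Proof.
move=> ctr zB.
have [N [M [r [NA zr NB]]]] := krylov A z.
have [tau [u [x [tau0 [ib hx] xtau]]]] := ctr 0 z^T.
have hN s : 0 <= s <= tau -> N *m x s = 0.
  have E s' : N *m (A *m x s' + B *m u s') = M *m (N *m x s').
    by rewrite mulmxDr !mulmxA NA NB// mul0mx addr0.
  have iE i : leb.-integrable `[0, tau] (fun s => ((N *m (A *m x s + B *m u s)) i 0)%:E).
    rewrite (_ : (fun s => _) = fun s => (\sum_l (N i l * (A *m x s + B *m u s) l 0)%:E)%E); last first.
      by apply/funext => s'; rewrite mxE -sumEFin.
    apply: integrable_sum => // j _.
    by apply: integrable_scale; exact: ib.
  apply: (@int_fixpoint_eq0 n M tau (fun s => N *m x s)); first exact: ltW.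
    move=> i; rewrite (_ : (fun s => _) = fun s => ((N *m (A *m x s + B *m u s)) i 0)%:E)//.
    by apply/funext => s'; rewrite E.
  move=> s' /andP[s0 st]; rewrite hx ?s0// add0r addr0.
  apply/matrixP => i j; rewrite !mxE.
  transitivity (\int[leb]_(r0 in `[0, s']) \sum_l N i l * (A *m x r0 + B *m u r0) l 0).
    have ib' l : leb.-integrable `[0, s'] (fun s => ((A *m x s + B *m u s) l 0)%:E).
      apply: integrableS (ib l) => //; apply: subset_itvl; exact: st.
    elim: (index_enum _) => [|l sq IH].
      by rewrite big_nil; under eq_Rintegral do rewrite big_nil; rewrite Rintegral_cst// mul0r.
    rewrite big_cons IH; under [RHS]eq_Rintegral do rewrite big_cons.
    rewrite RintegralD//.
    - by congr (_ + _); rewrite mxE RintegralZl//; exact: ib'.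
    - by apply: integrable_scale; exact: ib'.
    - rewrite (_ : _ \o _ = fun r => (\sum_(k <- sq) (N i k * (A *m x r + B *m u r) k 0)%:E)%E).
        by apply: integrable_sum => // k _; apply: integrable_scale; exact: ib'.
      by apply/funext => r0; rewrite /= sumEFin.
  by apply: eq_Rintegral => r0 _; rewrite -E [in RHS]mxE.
have : N *m x tau = 0 by apply: hN; rewrite lexx ltW.
rewrite xtau => /(congr1 (mulmx r)); rewrite mulmxA -zr mulmx0.
move=> /(congr1 (fun X : 'M[R]_1 => X 0 0)); rewrite !mxE.
under eq_bigr do rewrite mxE -expr2.
move=> h; apply/matrixP => i j; rewrite (ord1 i) mxE.
have /eqP := @psumr_eq0P _ _ xpredT _ (fun j _ => sqr_ge0 (z 0 j)) h j isT.
by rewrite sqrf_eq0 => /eqP.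
Qed.

(** Each differentiation of a function that vanishes on an open interval brings down one factor
    A. *)
Lemma expm_zero_pow n m p (A : 'M[R]_n) (L : 'M[R]_(m, n)) (z : 'M[R]_(n, p)) (a b : R) :
  (forall t, a < t < b -> L *m expm A t *m z = 0) ->
  forall k t, a < t < b -> L *m mpow A k *m expm A t *m z = 0.
Proof.
move=> h; elim=> [|k IH] t tab; first by rewrite mulmx1; exact: h.
apply/matrixP => i j; rewrite [RHS]mxE.
apply: (@is_derive_zero R (fun s => (L *m mpow A k *m expm A s *m z) i j) a b t) => //.
  by move=> s /IH ->; rewrite mxE.
have := dmxMr z (dmxMl (L *m mpow A k) (dmx_expm A t)) i j.
by rewrite mpowSr !mulmxA.
Qed.

Lemma qf_factor m n (L : 'M[R]_(m, n)) z : qf (L^T *m L) z = 0 -> L *m z = 0.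
Proof.
rewrite qf_sqr => h; apply/colP => i; rewrite [RHS]mxE.
have /eqP := @psumr_eq0P _ _ xpredT _ (fun i _ => sqr_ge0 ((L *m z) i 0)) h i isT.
by rewrite sqrf_eq0 => /eqP.
Qed.

Lemma qf_imx n (F : R -> 'M[R]_n) (T : R) z : cmx F -> 0 <= T ->
  qf (imx F 0 T) z = \int[leb]_(s in `[0, T]) qf (F s) z.
Proof.
move=> cF T0; rewrite /qf imxMl// imxMr//; last by apply: cmxM => //; exact: cmx_cst.
by rewrite mxE.
Qed.

Lemma cont_qf n (F : R -> 'M[R]_n) z : cmx F -> continuous (fun s => qf (F s) z).
Proof.
move=> cF; rewrite /qf.
have : cmx (fun s => z^T *m F s *m z).
  by apply: cmxM; [apply: cmxM => //|]; exact: cmx_cst.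
by move=> /(_ 0 0).
Qed.

(** Serves both controllability and observability. The weight need only be positive on ]a, b[: this
    lets the control be zero before tau and the gain be zero near T. *)
Lemma weighted_gramian_posdef m n (L : R -> 'M[R]_(m, n)) (be : R -> R) (T a b : R) :
  cmx L -> continuous be -> 0 <= T -> (forall t, 0 <= be t) ->
  (forall t, a < t < b -> 0 < t < T /\ 0 < be t) ->
  (forall z : 'cV[R]_n, (forall t, a < t < b -> L t *m z = 0) -> z = 0) ->
  posdef (imx (fun t => be t *: ((L t)^T *m L t)) 0 T).
Proof.
move=> cL cb T0 b0 ab inj.
have cF : cmx (fun t => be t *: ((L t)^T *m L t)).
  by apply: cmxZ => //; apply: cmxM => //; exact: cmxT.
split.
  by rewrite imxT; apply: imx_eq => s _; rewrite linearZ /= trmx_mul trmxK.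
move=> z z0; rewrite -/(qf _ _).
have qE s : qf (be s *: ((L s)^T *m L s)) z = be s * qf ((L s)^T *m L s) z.
  by rewrite /qf -scalemxAr -scalemxAl mxE.
have q0 s : 0 <= qf (be s *: ((L s)^T *m L s)) z by rewrite qE mulr_ge0// qf_sqr_ge0.
rewrite lt0r imx_qf_ge0// andbT; apply: contra z0 => /eqP; rewrite qf_imx// => h.
apply/eqP/inj => t /ab[tT bt].
have := int_zero_eq0 (@cont_qf _ _ z cF) (fun s _ => q0 s) h tT.
by rewrite qE => /eqP; rewrite mulf_eq0 gt_eqF//= => /eqP/qf_factor.
Qed.

Lemma gramian_posdef n m (A : 'M[R]_n) (B : 'M[R]_(n, m)) (T tau : R) : controllable A B ->
  0 <= tau < T ->
  posdef (imx (fun t => Num.max 0 (t - tau) *: ((B^T *m (expm A (- t))^T)^T *m (B^T *m (expm A (- t))^T))) 0 T).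
Proof.
move=> ctr /andP[tau0 tT].
apply: (weighted_gramian_posdef (a := tau) (b := T)).
- by apply: cmxM; [exact: cmx_cst|apply: cmxT; exact: cmx_expmN].
- exact: continuous_pos.
- exact: le_trans (ltW tT).
- by move=> t; rewrite le_max lexx.
- move=> t /andP[tt tT']; rewrite (le_lt_trans tau0 tt) tT'; split=> //.
  by rewrite lt_max subr_gt0 tt orbT.
move=> z hz.
have hz' s : - T < s < - tau -> z^T *m expm A s *m B = 0.
  move=> /andP[s1 s2]; have := hz (- s); rewrite opprK => h.
  apply: trmx_inj; rewrite !trmx_mul trmxK trmx0 mulmxA; apply: h; lra.
(* The Gramian involves exp(-tA), so the relevant interval is ]-T, -tau[; derivatives are taken at
   its midpoint. *)
pose t0 := - ((tau + T) / 2).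
have ht0 : - T < t0 < - tau by rewrite /t0; lra.
have := expm_zero_pow hz' => hk.
have : z^T *m expm A t0 = 0.
  apply: (controllable_kernel ctr) => k; rewrite -mulmxA.
  have comm : expm A t0 *m mpow A k = mpow A k *m expm A t0.
    elim: k => [|k IH]; first by rewrite mulmx1 mul1mx.
    by rewrite {1}/mpow iterS -/(mpow A k) mulmxA -expm_comm -mulmxA IH mulmxA.
  by rewrite -mulmxA [expm _ _ *m _]mulmxA comm !mulmxA hk.
move=> /(congr1 (fun X => X *m expm A (- t0))); rewrite -mulmxA expmKN mulmx1 mul0mx => h.
by apply: trmx_inj; rewrite h trmx0.
Qed.

Lemma expm_solves n (A : 'M[R]_n) (z : 'cV[R]_n) (T : R) :
  solves T z (fun s => A *m (expm A s *m z)) (fun=> 0) (fun s => expm A s *m z).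
Proof.
have cz : cmx (fun s => A *m (expm A s *m z)).
  by apply: cmxM; [exact: cmx_cst|apply: cmxM; [exact: cmx_expm|exact: cmx_cst]].
split=> [i|t /andP[t0 tT]]; first exact: (integrable_cont _ _ (cz i 0)).
rewrite addr0; have := @imx_FTC R n 1 (fun s => expm A s *m z) _ 0 t t0 _ cz.
rewrite expm0 mul1mx => h.
rewrite (_ : (\col_i _) = imx (fun s => A *m (expm A s *m z)) 0 t); last first.
  by apply/matrixP => i j; rewrite !mxE (ord1 j).
rewrite h; first by rewrite addrC subrK.
by move=> s _; rewrite mulmxA; apply: dmxMr; exact: dmx_expm.
Qed.

(** Analyticity: all derivatives vanish at the midpoint t0, so the power series gives zero output at
    every time from the state exp(t0 A) z, which observability cannot distinguish from 0. *)
Lemma observable_kernel n p (A : 'M[R]_n) (C : 'M[R]_(p, n)) (z : 'cV[R]_n) (a b : R) :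
  observable A C -> a < b -> (forall t, a < t < b -> C *m expm A t *m z = 0) -> z = 0.
Proof.
move=> [tau tau0 obs] ab hz.
pose t0 := (a + b) / 2; have ht0 : a < t0 < b by rewrite /t0; lra.
pose z1 := expm A t0 *m z.
have hz1 t : C *m expm A t *m z1 = 0.
  by apply: expm_mul_eq0 => k; rewrite /z1 mulmxA; exact: (expm_zero_pow hz).
have : z1 = 0.
  apply: (obs z1 0 _ _ (expm_solves A z1 tau) (expm_solves A 0 tau)) => t _.
  by rewrite mulmxA hz1 !mulmx0.
move=> /(congr1 (mulmx (expm A (- t0)))).
by rewrite /z1 mulmxA expmNK mul1mx mulmx0.
Qed.

End linear_systems.

(** * Choice of the gain *)

Section estimates.
Context (R : realType).
Notation leb := (@lebesgue_measure R).

Lemma cmx_bounded m n (F : R -> 'M[R]_(m, n)) (a b : R) : cmx F ->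
  exists2 c : R, 0 <= c & forall t i j, a <= t <= b -> `|F t i j| <= c.
Proof.
move=> cF.
have h i j : exists c : R, 0 <= c /\ forall t, a <= t <= b -> `|F t i j| <= c.
  by have [c c0 hc] := cont_bounded a b (cF i j); exists c.
pose c i j := sval (cid (h i j)).
have c0 i j : 0 <= c i j by rewrite /c; case: cid => x [].
have hc t i j : a <= t <= b -> `|F t i j| <= c i j by move=> tab; rewrite /c; case: cid => x [_ hx] /=; exact: hx.
exists (\sum_i \sum_j c i j); first by apply: sumr_ge0 => i _; apply: sumr_ge0.
move=> t i j tab; apply: le_trans (hc t i j tab) _.
rewrite (bigD1 i)//= (bigD1 j)//= -addrA lerDl addr_ge0 ?sumr_ge0// => k _.
exact: sumr_ge0.
Qed.

Lemma mulmx_entry_le m n p (A : 'M[R]_(m, n)) (B : 'M[R]_(n, p)) (a b : R) : 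
  (forall i j, `|A i j| <= a) -> (forall i j, `|B i j| <= b) -> forall i j, `|(A *m B) i j| <= n%:R * (a * b).
Proof.
move=> hA hB i j; rewrite mxE; apply: le_trans (ler_norm_sum _ _ _) _.
apply: (@le_trans _ _ (\sum_(k < n) a * b)).
  by apply: ler_sum => k _; rewrite normrM ler_pM.
by rewrite sumr_const card_ord mulr_natl.
Qed.

Lemma posdef_near_id n (S : 'M[R]_n) (e : R) : e * n%:R < 1 -> S^T = S ->
  (forall i j, `|S i j| <= e) -> posdef (1%:M + S).
Proof.
move=> en sS hS; split; first by rewrite linearD /= sS trmx1.
move=> z z0; rewrite -/(qf _ _) qfD.
pose s := \sum_i z i 0 ^+ 2.
have q1 : qf 1%:M z = s.
  have := qf_sqr (1%:M : 'M[R]_n) z; rewrite trmx1 mul1mx => ->.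
  by apply: eq_bigr => i _; rewrite mul1mx.
have s0 : 0 < s.
  rewrite lt0r sumr_ge0 ?andbT => [|i _]; last exact: sqr_ge0.
  apply: contra z0 => /eqP h; apply/eqP/colP => i; rewrite mxE.
  have /eqP := @psumr_eq0P _ _ xpredT _ (fun i _ => sqr_ge0 (z i 0)) h i isT.
  by rewrite sqrf_eq0 => /eqP.
have h : `|qf S z| <= e * n%:R * s.
  have -> : qf S z = \sum_i \sum_j z i 0 * S i j * z j 0.
    rewrite /qf mxE exchange_big /=; apply: eq_bigr => j _; rewrite mxE mulr_suml.
    by apply: eq_bigr => i _; rewrite mxE.
  apply: le_trans (ler_norm_sum _ _ _) _.
  apply: (@le_trans _ _ (\sum_i \sum_j (e / 2 * (z i 0 ^+ 2 + z j 0 ^+ 2)))).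
    apply: ler_sum => i _; apply: le_trans (ler_norm_sum _ _ _) _.
    apply: ler_sum => j _; rewrite !normrM.
    have e0 : 0 <= e by exact: le_trans (hS i j).
    have := sqr_ge0 (`|z i 0| - `|z j 0|).
    rewrite sqrrB !real_normK ?num_real// -mulr_natr => h.
    apply: (@le_trans _ _ (e * (`|z i 0| * `|z j 0|))).
      by rewrite mulrAC mulrC ler_wpM2r ?mulr_ge0.
    by rewrite -mulrA ler_wpM2l//; move: h; lra.
  rewrite le_eqVlt; apply/orP; left; apply/eqP.
  under eq_bigr do rewrite -mulr_sumr big_split /= sumr_const card_ord -/s.
  rewrite -mulr_sumr big_split /= sumr_const card_ord -/s sumrMnl -/s -mulr_natr; by field.
rewrite q1; move: h; rewrite ler_norml => /andP[h _].
have : e * n%:R * s < 1 * s by rewrite ltr_pM2r.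
by move: h; lra.
Qed.

Lemma posdef_open n (S : 'M[R]_n) : posdef S -> exists2 e : R, 0 < e &
  forall E : 'M[R]_n, E^T = E -> (forall i j, `|E i j| <= e) -> posdef (S + E).
Proof.
move=> pS; have [L uL SL] := posdef_factor pS.
pose K := invmx L; pose c := mnorm1 K; pose N : R := n%:R.
have c0 : 0 <= c by exact: mnorm1_ge0.
have hK i j : `|K i j| <= c by exact: le_mnorm1.
have hKT i j : `|K^T i j| <= c by rewrite mxE.
(* After factoring out L, the perturbation K' E K has entries at most N^2 c^2 times those of E, and
   [posdef_near_id] asks for one more factor N. *)
pose a := N ^+ 3 * c ^+ 2 + 1.
have a0 : 0 < a by rewrite ltr_wpDl// mulr_ge0 ?exprn_ge0// ler0n.
exists (2^-1 / a); first by rewrite divr_gt0.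
move=> E sE hE.
have -> : S + E = L^T *m (1%:M + K^T *m E *m K) *m L.
  rewrite mulmxDr mulmxDl mulmx1 -SL; congr (_ + _).
  by rewrite !mulmxA -trmx_mul mulVmx// trmx1 mul1mx -mulmxA mulVmx// mulmx1.
apply: posdef_congr => //.
apply: (@posdef_near_id _ _ (N * (N * (c * (2^-1 / a)) * c))).
- rewrite (_ : _ * n%:R = (N ^+ 3 * c ^+ 2) * (2^-1 / a)); last by rewrite /N; ring.
  rewrite mulrA ltr_pdivrMr// mul1r /a.
  have : 0 <= N ^+ 3 * c ^+ 2 by rewrite mulr_ge0 ?exprn_ge0// ler0n.
  lra.
- by rewrite !trmx_mul trmxK sE mulmxA.
- by apply: mulmx_entry_le => //; apply: mulmx_entry_le.
Qed.

Lemma derive_ge0_mono (f df : R -> R) (a b : R) : a <= b ->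
  (forall t : R, a <= t <= b -> is_derive t 1 f (df t)) ->
  (forall t, a <= t <= b -> 0 <= df t) -> f a <= f b.
Proof.
move=> ab dF d0.
have [||x xab h] := @MVT_segment R f df a b ab.
- by move=> x; rewrite in_itv/= => /andP[ax xb]; apply: dF; rewrite !ltW.
- apply: continuous_in_subspaceT => x; rewrite inE /= in_itv /= => xab.
  by apply: is_derive_continuous; apply: dF.
by rewrite -subr_ge0 h mulr_ge0 ?subr_ge0//; apply: d0; move: xab; rewrite in_itv.
Qed.

Lemma prim_dom (f h : R -> R) (c a b : R) : continuous f -> continuous h -> 0 <= a -> a <= b ->
  (forall t, a <= t <= b -> `|f t| <= c * h t) ->
  `|prim f b - prim f a| <= c * (prim h b - prim h a).
Proof.
move=> cf ch a0 ab fh.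
have d1 (t : R) : a <= t <= b -> -1 < t.
  by move=> /andP[ta _]; apply: lt_le_trans ta; apply: lt_le_trans a0.
have dh (t : R) : a <= t <= b -> is_derive t 1 (fun s => c * prim h s) (c * h t).
  move=> /d1 t1; have := is_deriveZ c (is_derive_prim ch t1); exact.
have df (t : R) : a <= t <= b -> is_derive t 1 (prim f) (f t).
  by move=> /d1 t1; exact: is_derive_prim.
have m1 := @derive_ge0_mono (fun s => c * prim h s - prim f s) (fun t => c * h t - f t) a b ab.
have m2 := @derive_ge0_mono (fun s => c * prim h s + prim f s) (fun t => c * h t + f t) a b ab.
have {}m1 : c * prim h a - prim f a <= c * prim h b - prim f b.
  apply: m1 => t tab; first by have := is_deriveB (dh t tab) (df t tab).
  by rewrite subr_ge0; apply: le_trans (fh t tab); exact: ler_norm.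
have {}m2 : c * prim h a + prim f a <= c * prim h b + prim f b.
  apply: m2 => t tab; first by have := is_deriveD (dh t tab) (df t tab).
  by have := fh t tab; rewrite ler_norml => /andP[]; lra.
by rewrite ler_norml; apply/andP; split; lra.
Qed.

End estimates.

(** * The Kalman gain *)

Section optimal_gain.
Context (R : realType).
Notation leb := (@lebesgue_measure R).

Lemma trmx_congr m n (S : 'M[R]_m) (X : 'M[R]_(m, n)) : (X^T *m S *m X)^T = X^T *m S^T *m X.
Proof. by rewrite !trmx_mul trmxK mulmxA. Qed.

Lemma posdef_mulmxT n (D : 'M[R]_n) : D \in unitmx -> posdef (D *m D^T).
Proof.
move=> uD; have := @posdef_congr R n 1%:M D^T.
by rewrite trmxK mulmx1 unitmx_tr uD; apply=> //; exact: posdef_scalar.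
Qed.

Lemma is_derive_dmx m n (P : R -> 'M[R]_(m, n)) (t : R) D : is_derive t 1 P D -> dmx P D t.
Proof.
move=> dP i j; have /derivable_mxP h := @ex_derive _ _ _ _ _ _ _ dP.
apply: DeriveDef; first exact: h.
rewrite -(@derive_val _ _ _ _ _ _ _ dP) derive_mx ?mxE//.
Qed.

Lemma within_coord m n (P : R -> 'M[R]_(m, n)) (A : set R) i j : {within A, continuous P} ->
  {within A, continuous (fun s => P s i j)}.
Proof.
move=> cP x; apply: (@continuous_comp _ _ _ _ (fun M : 'M[R]_(m, n) => M i j)); first exact: cP.
exact: coord_continuous.
Qed.

(* Covariance of x(T) when the output is integrated against the gain [F] and
   dL/dt = - L A + F C, L(T) = 1. *)
Definition gain_cov n m1 p (B1 : 'M[R]_(n, m1)) (D : 'M[R]_p) (S0 : 'M[R]_n) (T : R)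
    (L : R -> 'M[R]_n) (F : R -> 'M[R]_(n, p)) : 'M[R]_n :=
  L 0 *m S0 *m (L 0)^T
  + imx (fun t => L t *m (B1 *m B1^T) *m (L t)^T + F t *m (D *m D^T) *m (F t)^T) 0 T.

(** A linear flow is global and smooth, so L and F come out differentiable on the whole line
    although P solves its equation only inside ]0, T[. The derivative of X' Y serves twice: being
    positive semidefinite, it makes X(T)' Y(T) at least S0, so that X(T) is invertible; and up to
    congruence it is the integrand of the covariance. *)
Lemma optimal_gain n m1 p (A : 'M[R]_n) (B1 : 'M[R]_(n, m1)) (C : 'M[R]_(p, n)) (D : 'M[R]_p)
    (T : R) (S0 : 'M[R]_n) (P : R -> 'M[R]_n) :
  0 < T -> posdef S0 -> D \in unitmx -> riccati_solution A B1 C D T S0 P ->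
  exists (L : R -> 'M[R]_n) (F F' : R -> 'M[R]_(n, p)),
    [/\ forall t, dmx F (F' t) t, cmx F',
        forall t, dmx L (- (L t *m A) + F t *m C) t, L T = 1%:M &
        gain_cov B1 D S0 T L F = P T].
Proof.
move=> T0 pS uD [P0 cP dP].
have [sS0 _] := pS.
pose Ri := invmx (D *m D^T); pose Q := B1 *m B1^T; pose W := C^T *m Ri *m C.
have uR : D *m D^T \in unitmx by rewrite unitmx_mul unitmx_tr uD.
have sR : Ri^T = Ri by rewrite /Ri trmx_inv trmx_mul trmxK.
have sQ : Q^T = Q by rewrite trmx_mul trmxK.
have sW : W^T = W by rewrite !trmx_mul trmxK sR mulmxA.
(* The Hamiltonian flow (X, Y) linearises the Riccati equation: P = Y X^-1. *)
pose H : 'M[R]_(n + n) := block_mx (- A^T) W Q A.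
pose Z t := expm H t *m col_mx 1%:M S0.
pose X t := usubmx (Z t); pose Y t := dsubmx (Z t).
have dZ t : dmx Z (H *m Z t) t by rewrite /Z mulmxA; apply: dmxMr; exact: dmx_expm.
have HZ t : H *m Z t = col_mx (- (A^T *m X t) + W *m Y t) (Q *m X t + A *m Y t).
  by rewrite -[Z t]vsubmxK mul_block_col mulNmx.
have dX t : dmx X (- (A^T *m X t) + W *m Y t) t.
  move=> i j; have := dZ t (lshift n i) j; rewrite HZ col_mxEu.
  by under eq_fun do rewrite -[Z _]vsubmxK col_mxEu.
have dY t : dmx Y (Q *m X t + A *m Y t) t.
  move=> i j; have := dZ t (rshift n i) j; rewrite HZ col_mxEd.
  by under eq_fun do rewrite -[Z _]vsubmxK col_mxEd.
have cX := dmx_cmx dX; have cY := dmx_cmx dY.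
have X0 : X 0 = 1%:M by rewrite /X /Z expm0 mul1mx col_mxKu.
have Y0 : Y 0 = S0 by rewrite /Y /Z expm0 mul1mx col_mxKd.
have dXY t : dmx (fun s => (X s)^T *m Y s) ((X t)^T *m Q *m X t + (Y t)^T *m W *m Y t) t.
  apply: (dmx_eq (dmxM (dmxT (dX t)) (dY t))).
  rewrite linearD /= linearN /= trmx_mul trmxK [(W *m _)^T]trmx_mul sW mulmxDl mulNmx mulmxDr !mulmxA.
  by rewrite addrACA addrC addrA addrK addrC.
have cXY : cmx (fun t => (X t)^T *m Q *m X t + (Y t)^T *m W *m Y t).
  by apply: cmxD; apply: cmxM => //; apply: cmxM; (try exact: cmx_cst); exact: cmxT.
have iXY : imx (fun t => (X t)^T *m Q *m X t + (Y t)^T *m W *m Y t) 0 T = (X T)^T *m Y T - S0.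
  by rewrite (imx_FTC (ltW T0) (fun t _ => dXY t) cXY) X0 Y0 trmx1 mul1mx.
have Wpsd : psd W.
  rewrite /W -{2}[C]trmxK; apply: psd_congr.
  rewrite /Ri; apply: posdef_psd; apply: posdef_inv.
  exact: posdef_mulmxT.
have pXY : posdef ((X T)^T *m Y T).
  rewrite -[_ *m _](subrK S0) -iXY addrC; apply: posdefD => //.
    rewrite imxT; apply: imx_eq => s _.
    by rewrite linearD /= (trmx_congr Q) (trmx_congr W) sQ sW.
  move=> z; apply: imx_qf_ge0 => //; first exact: ltW.
  move=> s _; rewrite qfD addr_ge0//; last by rewrite qf_mulmx; case: Wpsd.
  by rewrite qf_mulmx /Q -{1}[B1]trmxK qf_sqr_ge0.
have uX : X T \in unitmx by have := posdef_unit pXY; rewrite unitmx_mul unitmx_tr => /andP[].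
(* The cross terms cancel so that the difference dl = Y - P X satisfies dl' = (A - P W) dl with
   dl(0) = 0; Gronwall identifies the given P with the flow. *)
have YPX : Y T = P T *m X T.
  pose dl t := Y t - P t *m X t.
  pose M t := A - P t *m W.
  apply/eqP; rewrite -subr_eq0; apply/eqP; rewrite -/(dl T).
  have cPc : cmx (fun t => P (clamp T t)).
    by move=> i j; apply: (@clamp_continuous R T (fun t => P t i j)); [exact: ltW|exact: within_coord].
  have cM : cmx (fun t => A - P (clamp T t) *m W).
    by apply: cmxB; [exact: cmx_cst|apply: cmxM => //; exact: cmx_cst].
  have [c _ hc] := cmx_bounded 0 T cM.
  apply: (@gronwall_mx R _ _ dl M c T); rewrite ?lexx ?ltW//.
  - move=> i j; rewrite /dl => x.
    have -> : (fun s => (Y s - P s *m X s) i j) = fun s => Y s i j - \sum_k P s i k * X s k j.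
      by apply/funext => s; rewrite !mxE.
    apply: cvgB; first by apply: continuous_subspaceT; exact: cY.
    apply: cvg_sumF => k; apply: cvgM; first exact: within_coord.
    by apply: continuous_subspaceT; exact: cX.
  - move=> t tT; have := dmxB (dY t) (dmxM (is_derive_dmx (dP t tT)) (dX t)).
    move=> h; apply: (dmx_eq h); rewrite /M /dl.
    rewrite -/Q -/Ri -[P t *m C^T *m Ri *m C *m P t]mulmxA.
    rewrite (_ : P t *m C^T *m Ri *m (C *m P t) = P t *m W *m P t); last by rewrite /W !mulmxA.
    move: (X t) (Y t) (P t) (Q) (W) => x y q q' w.
    rewrite !(mulmxDl, mulmxDr, mulNmx, mulmxN, mulmxBl, mulmxBr, opprD, opprK) !mulmxA.
    move: (q' *m x) (A *m y) (A *m q *m x) (q *m A^T *m x) (q *m w *m q *m x) (q *m w *m y) => a1 a2 a3 a4 a5 a6.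
    by apply/matrixP => i j; rewrite !mxE; ring.
  - move=> t i j tT; rewrite /M.
    have t0T : 0 <= t <= T by case/andP: tT => t1 t2; rewrite !ltW.
    by have := hc t i j t0T; rewrite clamp_id.
  - by rewrite /dl Y0 X0 P0 mulmx1 subrr.
(* The normalisation L(T) = 1. With Y = P X the gain below reads L P' C' (D D')^-1, the Kalman gain
   transported by L. *)
pose K := invmx (X T)^T.
exists (fun t => K *m (X t)^T), (fun t => K *m ((Y t)^T *m (C^T *m Ri))), 
  (fun t => K *m ((Q *m X t + A *m Y t)^T *m (C^T *m Ri))).
split.
- move=> t; apply: dmxMl; apply: dmxMr; apply: dmxT; exact: dY.
- apply: cmxM; first exact: cmx_cst.
  apply: cmxM; last exact: cmx_cst.
  by apply: cmxT; apply: cmxD; apply: cmxM => //; exact: cmx_cst.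
- move=> t; apply: (dmx_eq (dmxMl K (dmxT (dX t)))).
  rewrite linearD /= linearN /= trmx_mul trmxK [(W *m _)^T]trmx_mul sW mulmxDr mulmxN /W !mulmxA.
  by [].
- by rewrite /K mulVmx// unitmx_tr.
rewrite /gain_cov X0 trmx1 mulmx1.
rewrite (imx_eq (G := fun t => K *m ((X t)^T *m Q *m X t + (Y t)^T *m W *m Y t) *m K^T)); last first.
  move=> s _; rewrite -/Q trmx_mul trmxK !trmx_mul !trmxK sR mulmxDr mulmxDl; congr (_ + _).
    by rewrite !mulmxA.
  rewrite /W !mulmxA; congr (_ *m _ *m _ *m _).
  by rewrite -(mulmxA _ D D^T) -(mulmxA _ Ri (D *m D^T)) mulVmx// mulmx1.
have T0' := ltW T0.
rewrite -imxMr ?lexx//; last first.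
  by apply: cmxM => //; exact: cmx_cst.
rewrite -imxMl ?lexx// iXY mulmxBr mulmxBl addrC subrK.
by rewrite YPX /K trmx_inv trmxK -!mulmxA mulKmx ?unitmx_tr// mulmxV// mulmx1.
Qed.

End optimal_gain.

Section global_primitive.
Context (R : realType).

(* needed because [prim] is a primitive only to the right of [-1] *)
Definition gprim (g : R -> R) (t : R) : R :=
  if 0 <= t then prim g t else - prim (fun s => g (- s)) (- t).

Definition gprimx m n (F : R -> 'M[R]_(m, n)) (t : R) : 'M[R]_(m, n) :=
  \matrix_(i, j) gprim (fun s => F s i j) t.

Lemma gprimE g t : 0 <= t -> gprim g t = prim g t.
Proof. by rewrite /gprim => ->. Qed.

Lemma gprimxE m n (F : R -> 'M[R]_(m, n)) t : 0 <= t -> gprimx F t = primx F t.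
Proof. by move=> t0; apply/matrixP => i j; rewrite !mxE gprimE. Qed.

Lemma is_derive_prim_rev g (t : R) : continuous g -> t < 1 ->
  is_derive t 1 (fun s => - prim (fun r => g (- r)) (- s)) (g t).
Proof.
move=> cg t1.
have cg' : continuous (fun r => g (- r)).
  by move=> x; apply: (@continuous_comp _ _ _ (fun r : R => - r) g); [exact: continuousN|exact: cg].
have d1 : is_derive (- t) 1 (prim (fun r => g (- r))) (g t).
  by have := is_derive_prim cg' (t := - t); rewrite opprK; apply; lra.
have h : is_derive t (1 : R) (fun s : R => - s) (-1 : R) by exact: is_deriveNid.
have d2 := @is_derive1_comp R (prim (fun r => g (- r))) (fun s => - s) t _ _ d1 h.
by apply: (is_derive_eq (is_deriveN d2)); rewrite mulrN1 opprK.
Qed.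

Lemma prim_rev g (t : R) : continuous g -> -1 < t -> t <= 0 ->
  prim g t = - prim (fun r => g (- r)) (- t).
Proof.
move=> cg t1 t0; apply/eqP; rewrite -subr_eq0.
pose f s := prim g s - (- prim (fun r => g (- r)) (- s)).
have : `|f 0 - f t| <= 0 * (0 - t).
  apply: (@deriv_le_bound R f (fun=> 0)) => // [s /andP[s1 s0]|s _]; last by rewrite normr0.
  have d1 := is_derive_prim cg (lt_le_trans t1 s1).
  have d2 := is_derive_prim_rev cg (le_lt_trans s0 ltr01).
  by have := is_deriveB d1 d2; rewrite subrr.
by rewrite mul0r normr_le0 {1}/f oppr0 !prim0 oppr0 subr0 sub0r oppr_eq0.
Qed.

Lemma is_derive_gprim g (t : R) : continuous g -> is_derive t 1 (gprim g) (g t).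
Proof.
move=> cg; have [t0|t0] := ltP t 0.
  apply: (near_eq_is_derive _ (is_derive_prim_rev cg (lt_trans t0 ltr01))).
  near=> s; rewrite /gprim lt_geF//; near: s; exact: lt_nbhsl.
have t1 : -1 < t by exact: lt_le_trans t0.
apply: (near_eq_is_derive _ (is_derive_prim cg t1)).
near=> s; rewrite /gprim; case: (leP 0 s) => // s0.
apply: prim_rev => //; last exact: ltW.
near: s; exact: lt_nbhsr.
Unshelve. all: by end_near. Qed.

Lemma dmx_gprimx m n (F : R -> 'M[R]_(m, n)) t : cmx F -> dmx (gprimx F) (F t) t.
Proof.
by move=> cF i j; under eq_fun do rewrite mxE; exact: is_derive_gprim.
Qed.

End global_primitive.

(** * Cutting off the gain near the final time *)

Section dominated_families.
Context (R : realType) (T : R).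
Notation leb := (@lebesgue_measure R).

(* [F e], [0 < e <= T / 2], is entrywise O(h e) on [0, T], uniformly in [e] *)
Definition dom m n (h : R -> R -> R) (F : R -> R -> 'M[R]_(m, n)) : Prop :=
  exists2 c : R, 0 <= c & forall e t i j, 0 < e -> e <= T / 2 -> 0 <= t <= T -> `|F e t i j| <= c * h e t.

Lemma domW m n (h h' : R -> R -> R) (F : R -> R -> 'M[R]_(m, n)) (k : R) : 0 <= k ->
  (forall e t, 0 < e -> e <= T / 2 -> 0 <= t <= T -> h e t <= k * h' e t) -> dom h F -> dom h' F.
Proof.
move=> k0 hh [c c0 hc]; exists (c * k); first exact: mulr_ge0.
move=> e t i j e0 eT tT; apply: le_trans (hc e t i j e0 eT tT) _.
by rewrite -mulrA ler_wpM2l// hh.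
Qed.

Lemma dom_cmx m n (F : R -> 'M[R]_(m, n)) : cmx F -> dom (fun _ _ => 1) (fun=> F).
Proof.
move=> cF; have [c c0 hc] := cmx_bounded 0 T cF.
by exists c => // e t i j _ _ tT; rewrite mulr1; exact: hc.
Qed.

Lemma domD m n (h : R -> R -> R) (F G : R -> R -> 'M[R]_(m, n)) : dom h F -> dom h G ->
  dom h (fun e t => F e t + G e t).
Proof.
move=> [c c0 hc] [c' c0' hc']; exists (c + c'); first exact: addr_ge0.
move=> e t i j e0 eT tT; rewrite mxE mulrDl; apply: le_trans (ler_normD _ _) _.
by rewrite lerD ?hc ?hc'.
Qed.

Lemma domT m n (h : R -> R -> R) (F : R -> R -> 'M[R]_(m, n)) : dom h F -> dom h (fun e t => (F e t)^T).
Proof. by move=> [c c0 hc]; exists c => // e t i j e0 eT tT; rewrite mxE hc. Qed.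

Lemma domM m n p (h : R -> R -> R) (F : R -> R -> 'M[R]_(m, n)) (G : R -> R -> 'M[R]_(n, p)) :
  dom h F -> dom (fun _ _ => 1) G -> dom h (fun e t => F e t *m G e t).
Proof.
move=> [c c0 hc] [c' c0' hc']; exists (n%:R * (c * c')); first by rewrite !mulr_ge0.
move=> e t i j e0 eT tT.
have -> : n%:R * (c * c') * h e t = n%:R * (c * h e t * (c' * 1)) by ring.
by apply: mulmx_entry_le => k l; [apply: hc|apply: hc'].
Qed.

Lemma domMl m n p (h : R -> R -> R) (F : R -> R -> 'M[R]_(m, n)) (G : R -> R -> 'M[R]_(n, p)) :
  dom (fun _ _ => 1) F -> dom h G -> dom h (fun e t => F e t *m G e t).
Proof.
move=> hF hG; have [c c0 hc] := domT (domM (domT hG) (domT hF)).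
exists c => // e t i j e0 eT tT; have := hc e t i j e0 eT tT.
by rewrite trmx_mul !trmxK.
Qed.

Lemma dom_imx m n (h : R -> R -> R) (F : R -> R -> 'M[R]_(m, n)) (K : R) : 0 <= T -> 0 <= K ->
  dom h F -> (forall e, 0 < e -> cmx (F e)) -> (forall e, 0 < e -> continuous (h e)) ->
  (forall e, 0 < e -> e <= T / 2 -> prim (h e) T <= K * e) ->
  exists2 c : R, 0 <= c & forall e i j, 0 < e -> e <= T / 2 -> `|imx (F e) 0 T i j| <= c * e.
Proof.
move=> T0 K0 [c c0 hc] cF ch hK; exists (c * K); first exact: mulr_ge0.
move=> e i j e0 eT; rewrite mxE -primE//; last exact: cF.
have := @prim_dom R (fun t => F e t i j) (h e) c 0 T (cF e e0 i j) (ch e e0) (lexx _) T0.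
rewrite !prim0 !subr0 => /(_ (fun t tT => hc e t i j e0 eT tT)) h1.
by apply: le_trans h1 _; rewrite -mulrA ler_wpM2l// hK.
Qed.

Lemma domZ m n (h : R -> R -> R) (F : R -> 'M[R]_(m, n)) : (forall e t, 0 < e -> 0 <= h e t) ->
  cmx F -> dom h (fun e t => h e t *: F t).
Proof.
move=> h0 cF; have [c c0 hc] := cmx_bounded 0 T cF.
exists c => // e t i j e0 _ tT; rewrite mxE normrM ger0_norm ?h0// mulrC.
by rewrite ler_wpM2r ?h0// hc.
Qed.

Lemma dom_gprimx m n (h : R -> R -> R) (F : R -> R -> 'M[R]_(m, n)) (K : R) : 0 <= K ->
  (forall e t, 0 < e -> 0 <= h e t) ->
  dom h F -> (forall e, 0 < e -> cmx (F e)) -> (forall e, 0 < e -> continuous (h e)) ->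
  (forall e, 0 < e -> e <= T / 2 -> prim (h e) T <= K * e) ->
  dom (fun e _ => e) (fun e t => gprimx (F e) t - gprimx (F e) T).
Proof.
move=> K0 h0 [c c0 hc] cF ch hK; exists (c * K); first exact: mulr_ge0.
move=> e t i j e0 eT /andP[t0 tT].
have T0 := le_trans t0 tT.
rewrite !gprimxE// !mxE distrC.
have h1 := @prim_dom R (fun t => F e t i j) (h e) c t T (cF e e0 i j) (ch e e0) t0 tT.
apply: le_trans (h1 _) _.
  by move=> s /andP[ts sT]; apply: hc => //; rewrite sT (le_trans t0).
rewrite -mulrA ler_wpM2l//; apply: le_trans (hK e e0 eT).
rewrite lerBlDr lerDl -(prim0 (h e)).
apply: (@derive_ge0_mono _ _ (h e)) => //.
- by move=> s /andP[s0 _]; apply: is_derive_prim; [exact: ch|exact: lt_le_trans s0].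
- by move=> s _; exact: h0.
Qed.

(* The cut-off [chi e] vanishes on [T - e, +oo[ and is e-close to 1 before
   T - 2e; [cochi e] is 1 - [chi e]. *)
Definition ramp (e t : R) : R := Num.max 0 (T - e - t).
Definition chi (e t : R) : R := ramp e t ^+ 2 / (ramp e t ^+ 2 + e ^+ 3).
Definition cochi (e t : R) : R := e ^+ 3 / (ramp e t ^+ 2 + e ^+ 3).

Lemma continuous_ramp e : continuous (ramp e).
Proof.
move=> x; apply: (@continuous_max R R^o (fun=> 0) (fun y => T - e - y)); first exact: cst_continuous.
by apply: cvgB; [exact: cst_continuous|exact: cvg_id].
Qed.

Lemma ramp_ge0 e t : 0 <= ramp e t.
Proof. by rewrite le_max lexx. Qed.

Lemma ramp_late e t : T - e <= t -> ramp e t = 0.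
Proof. by move=> h; rewrite /ramp max_l// subr_le0. Qed.

Lemma ramp_den_gt0 e t : 0 < e -> 0 < ramp e t ^+ 2 + e ^+ 3.
Proof. by move=> e0; rewrite ltr_wpDl ?sqr_ge0// exprn_gt0. Qed.

Lemma chiE e t : 0 < e -> chi e t = 1 - cochi e t.
Proof.
move=> e0; have h := ramp_den_gt0 t e0.
by rewrite /chi /cochi; field; rewrite gt_eqF.
Qed.

Lemma cochi_in e t : 0 < e -> 0 <= cochi e t <= 1.
Proof.
move=> e0; rewrite /cochi divr_ge0 ?exprn_ge0 ?(ltW e0)// ?(ltW (ramp_den_gt0 t e0))//=.
by rewrite ler_pdivrMr ?ramp_den_gt0// mul1r lerDr sqr_ge0.
Qed.

(** The ramp is at least e here, so the quotient is at most e^3 / e^2. This is the reason for the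
    cube in [chi]. *)
Lemma cochi_early e t : 0 < e -> t <= T - 2 * e -> cochi e t <= e.
Proof.
move=> e0 te; rewrite /cochi ler_pdivrMr ?ramp_den_gt0//.
have : e <= ramp e t by rewrite le_max; apply/orP; right; lra.
move=> h1; have h : e ^+ 2 <= ramp e t ^+ 2 by rewrite ler_pXn2r// nnegrE ?ramp_ge0// ltW.
rewrite mulrDr exprS; apply: le_trans (_ : e * ramp e t ^+ 2 <= _); first by rewrite ler_wpM2l// ltW.
by have e0' := ltW e0; rewrite lerDl !mulr_ge0 ?exprn_ge0.
Qed.

Lemma is_derive_ramp2 e (t : R) : is_derive t 1 (fun s => ramp e s ^+ 2) (- (2 * ramp e t)).
Proof.
have h : is_derive t (1 : R) (fun s : R => T - e - s) (-1).
  have := is_deriveB (is_derive_cst (T - e) t (1 : R)) (is_derive_id t (1 : R)).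
  by rewrite sub0r.
have := @is_derive1_comp R (fun x => Num.max 0 x ^+ 2) (fun s => T - e - s) t _ _ (is_derive_pos2 _) h.
by rewrite mulrN1.
Qed.

Lemma continuous_ramp2 e : continuous (fun s => ramp e s ^+ 2).
Proof. by move=> x; exact: is_derive_continuous (is_derive_ramp2 e x). Qed.

Lemma continuous_cochi e : 0 < e -> continuous (cochi e).
Proof.
move=> e0 x; apply: cvgM; first exact: cvg_cst.
apply: cvgV; first by rewrite gt_eqF// ramp_den_gt0.
apply: cvgD; last exact: cvg_cst.
exact: continuous_ramp2.
Qed.

Definition dchi (e t : R) : R := - (2 * ramp e t) * e ^+ 3 / (ramp e t ^+ 2 + e ^+ 3) ^+ 2.

Lemma is_derive_chi e (t : R) : 0 < e -> is_derive t 1 (chi e) (dchi e t).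
Proof.
move=> e0; have g0 := ramp_den_gt0 t e0.
have d1 := is_derive_ramp2 e t.
have d2 : is_derive t (1 : R) (fun s => ramp e s ^+ 2 + e ^+ 3) (- (2 * ramp e t)).
  have := is_deriveD d1 (is_derive_cst (e ^+ 3) t (1 : R)).
  by rewrite addr0.
have d3 := is_deriveM d1 (@is_deriveV R (fun s => ramp e s ^+ 2 + e ^+ 3) t _ 1 (lt0r_neq0 g0) d2).
apply: (is_derive_eq d3); rewrite /dchi /GRing.scale /=.
by field; rewrite gt_eqF.
Qed.

Lemma continuous_dchi e : 0 < e -> continuous (dchi e).
Proof.
move=> e0 x; apply: cvgM.
  apply: cvgM; last exact: cvg_cst.
  by apply: cvgN; apply: cvgM; [exact: cvg_cst|exact: continuous_ramp].
apply: cvgV; first by rewrite expf_neq0// gt_eqF// ramp_den_gt0.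
have h : {for x, continuous (fun s => ramp e s ^+ 2 + e ^+ 3)}.
  apply: cvgD; last exact: cvg_cst.
  exact: continuous_ramp2.
exact: (cvgM h h).
Qed.

(** Dominates both the defect [cochi] of the cut-off and quantities of size e. Its integral over
    [0, T] is still O(e): [cochi] is at most e before T - 2e and at most 1 on the remaining length
    2e. *)
Definition gap (e t : R) : R := cochi e t + e.

Lemma continuous_gap e : 0 < e -> continuous (gap e).
Proof. by move=> e0 x; apply: cvgD; [exact: continuous_cochi|exact: cvg_cst]. Qed.

Lemma prim_gap e : 0 < e -> e <= T / 2 -> prim (gap e) T <= 4 * (T + 1) * e.
Proof.
move=> e0 eT.
have d (t : R) : 0 <= t -> is_derive t 1 (prim (gap e)) (gap e t).
  by move=> t0; apply: is_derive_prim; [exact: continuous_gap|exact: lt_le_trans t0].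
have g0 t : 0 <= gap e t by rewrite addr_ge0 ?(ltW e0)//; case/andP: (cochi_in t e0).
have h1 : `|prim (gap e) (T - 2 * e) - prim (gap e) 0| <= (2 * e) * (T - 2 * e - 0).
  apply: deriv_le_bound; first lra.
    by move=> t /andP[t0 _]; exact: d.
  move=> t /andP[t0 tT]; rewrite ger0_norm//.
  by have := cochi_early e0 tT; rewrite /gap; lra.
have h2 : `|prim (gap e) T - prim (gap e) (T - 2 * e)| <= (1 + T) * (T - (T - 2 * e)).
  apply: deriv_le_bound; first lra.
    by move=> t /andP[t0 _]; apply: d; apply: le_trans t0; lra.
  move=> t /andP[t0 tT]; rewrite ger0_norm//.
  by have /andP[_] := cochi_in t e0; rewrite /gap; lra.
rewrite prim0 in h1.
have : prim (gap e) T <= 2 * e * (T - 2 * e - 0) + (1 + T) * (T - (T - 2 * e)).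
  by move: h1 h2; rewrite !ler_norml => /andP[_ h1] /andP[_ h2]; lra.
move=> h; apply: le_trans h _.
have := mulr_ge0 (ltW e0) (ltW e0).
nra.
Qed.

End dominated_families.

Section smooth_gain.
Context (R : realType).

Lemma imx_sub_eq m n (F G H : R -> 'M[R]_(m, n)) (T : R) : 0 <= T -> cmx G -> cmx H ->
  (forall t, F t = G t + H t) -> imx F 0 T - imx G 0 T = imx H 0 T.
Proof.
move=> T0 cG cH E; rewrite (imx_eq (G := fun t => G t + H t)) ?imxD ?lexx//.
by rewrite addrAC subrr add0r.
Qed.

Lemma congr_perturb n p (S : 'M[R]_p) (X Y : 'M[R]_(n, p)) : 
  (X + Y) *m S *m (X + Y)^T = X *m S *m X^T + (Y *m S *m (X + Y)^T + X *m S *m Y^T).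
Proof.
by rewrite mulmxDl mulmxDl [in X in X + _ = _]linearD /= [X in X + _ = _]mulmxDr addrAC addrA.
Qed.

(** The change [H] of the gain is not small near T, but it is dominated by [gap], whose integral is
    O(e). Hence L moves by O(e) uniformly, and the covariance, quadratic in L and F, moves by O(e)
    as well. *)
Lemma smooth_gain n m1 p (A : 'M[R]_n) (B1 : 'M[R]_(n, m1)) (C : 'M[R]_(p, n)) (D : 'M[R]_p)
    (T : R) (S0 : 'M[R]_n) (L : R -> 'M[R]_n) (F F' : R -> 'M[R]_(n, p)) (dl : R) :
  0 < T -> (forall t, dmx F (F' t) t) -> cmx F' ->
  (forall t, dmx L (- (L t *m A) + F t *m C) t) -> L T = 1%:M -> 0 < dl ->
  exists (e : R) (L0 : R -> 'M[R]_n) (F0 F0' : R -> 'M[R]_(n, p)),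
  [/\ 0 < e <= T / 2, (forall t, dmx F0 (F0' t) t) /\ cmx F0',
   forall t, T - e <= t -> F0 t = 0 /\ F0' t = 0,
   (forall t, dmx L0 (- (L0 t *m A) + F0 t *m C) t) /\ L0 T = 1%:M &
   forall i j, `|(gain_cov B1 D S0 T L0 F0 - gain_cov B1 D S0 T L F) i j| <= dl].
Proof.
move=> T0 dF cF' dL LT dl0; have T0' := ltW T0.
have cF := dmx_cmx dF; have cL := dmx_cmx dL.
pose H e t := - (cochi T e t *: F t).
pose f e t := H e t *m (C *m expm A t).
(* Variation of constants for ell' = - ell A + H C with ell(T) = 0, the correction to L caused by
   [H]. *)
pose ell e t := (gprimx (f e) t - gprimx (f e) T) *m expm A (- t).
pose F0 e t := chi T e t *: F t.
pose F0' e t := dchi T e t *: F t + chi T e t *: F' t.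
pose L0 e t := L t + ell e t.
have F0E e t : 0 < e -> F0 e t = F t + H e t.
  by move=> e0; rewrite /F0 chiE// scalerBl scale1r.
have cH e : 0 < e -> cmx (H e).
  by move=> e0; apply: cmxN; apply: cmxZ => //; exact: continuous_cochi.
have cf e : 0 < e -> cmx (f e).
  move=> e0; apply: cmxM; first exact: cH.
  by apply: cmxM; [exact: cmx_cst|exact: cmx_expm].
have dell e t : 0 < e -> dmx (ell e) (- (ell e t *m A) + H e t *m C) t.
  move=> e0.
  have h := dmxM (dmxB (dmx_gprimx t (cf e e0)) (dmx_cst (gprimx (f e) T) t)) (dmx_expmN A t).
  apply: (dmx_eq h); rewrite subr0 mulmxN /ell addrC mulmxA; congr (_ + _).
  by rewrite /f -!mulmxA expmKN mulmx1.
have cell e : 0 < e -> cmx (ell e) by move=> e0; apply: dmx_cmx => t; exact: dell.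
have cochi0 e t : 0 < e -> 0 <= cochi T e t by move=> /(cochi_in T t)/andP[].
have gap0 e t : 0 < e -> 0 <= gap T e t by move=> e0; rewrite addr_ge0 ?cochi0// ltW.
have domN m' n' h (G : R -> R -> 'M[R]_(m', n')) : dom T h G -> dom T h (fun e t => - G e t).
  by move=> [c c0 hc]; exists c => // e t i j e0 eT tT; rewrite mxE normrN hc.
have domH : dom T (gap T) H.
  apply: domN; apply: (@domW R T _ _ (cochi T) (gap T) _ 1) => // [e t e0 _ _|].
    by rewrite mul1r lerDl ltW.
  exact: domZ.
have dom1 m' n' (G : R -> R -> 'M[R]_(m', n')) : dom T (gap T) G -> dom T (fun _ _ => 1) G.
  apply: (@domW R T _ _ (gap T) _ _ (1 + T)); first by rewrite addr_ge0.
  move=> e t e0 eT tT; rewrite mulr1; have /andP[_] := cochi_in T t e0.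
  by rewrite /gap; lra.
have domc m' n' (G : 'M[R]_(m', n')) : dom T (fun _ _ => 1) (fun _ _ => G).
  by apply: (@dom_cmx R T _ _ (fun=> G)); exact: cmx_cst.
have K0 : 0 <= 4 * (T + 1) by rewrite mulr_ge0// addr_ge0.
have domell' : dom T (fun e _ => e) ell.
  apply: domM; last by apply: (@dom_cmx R T _ _ (fun t => expm A (- t))); exact: cmx_expmN.
  apply: (dom_gprimx K0 gap0) => //.
  - apply: domM => //; apply: (@dom_cmx R T _ _ (fun t => C *m expm A t)).
    by apply: cmxM; [exact: cmx_cst|exact: cmx_expm].
  - exact: continuous_gap.
  - exact: prim_gap.
have domell : dom T (gap T) ell.
  apply: (@domW R T _ _ (fun e _ => e) (gap T) _ 1) => // e t e0 _ _.
  by rewrite mul1r lerDr cochi0.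
have domL0 : dom T (fun _ _ => 1) L0 by apply: domD; [exact: dom_cmx|exact: dom1].
pose Q := B1 *m B1^T; pose Rm := D *m D^T.
pose D1 e t := ell e t *m S0 *m (L0 e t)^T + L t *m S0 *m (ell e t)^T.
pose D2 e t := (ell e t *m Q *m (L0 e t)^T + L t *m Q *m (ell e t)^T)
  + (H e t *m Rm *m (F t + H e t)^T + F t *m Rm *m (H e t)^T).
have [c1 c10 hc1] : dom T (fun e _ => e) D1.
  apply: domD.
    by apply: domM; [apply: domM|apply: domT].
  by apply: domMl; [apply: domM => //; exact: dom_cmx|exact: domT].
have domD2 : dom T (gap T) D2.
  apply: domD; apply: domD.
  - by apply: domM; [apply: domM|apply: domT].
  - by apply: domMl; [apply: domM => //; exact: dom_cmx|exact: domT].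
  - apply: domM; [exact: domM|apply: domT; apply: domD; [exact: dom_cmx|exact: dom1]].
  - by apply: domMl; [apply: domM => //; exact: dom_cmx|exact: domT].
have cD2 e : 0 < e -> cmx (D2 e).
  move=> e0; have h1 := cell e e0; have h2 := cH e e0.
  have hL0 : cmx (L0 e) by exact: cmxD.
  by apply: cmxD; apply: cmxD; apply: cmxM; (try (apply: cmxM => //; exact: cmx_cst));
    apply: cmxT => //; exact: cmxD.
have [c2 c20 hc2] := dom_imx T0' K0 domD2 cD2 (fun e e0 => @continuous_gap R T e e0) (@prim_gap R T).
(* The covariance moves by at most (c1 + c2) e, with [c1] from the initial term and [c2] from the
   integral. *)
pose e := Num.min (T / 2) (dl / (c1 + c2 + 1)).
have c0 : 0 < c1 + c2 + 1 by rewrite ltr_wpDl// addr_ge0.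
have e0 : 0 < e by rewrite lt_min !divr_gt0.
have eT : e <= T / 2 by rewrite ge_min lexx.
have edl : (c1 + c2) * e <= dl.
  have : e <= dl / (c1 + c2 + 1) by rewrite ge_min lexx orbT.
  rewrite ler_pdivlMr// => h; apply: le_trans h.
  by rewrite mulrC ler_wpM2l ?(ltW e0)// lerDl.
exists e, (L0 e), (F0 e), (F0' e); split.
- by rewrite e0 eT.
- split=> [t|]; first exact: dmxZ (is_derive_chi _ _ _) _.
  apply: cmxD; apply: cmxZ => //; first exact: continuous_dchi.
  by move=> t; exact: is_derive_continuous (is_derive_chi T t e0).
- move=> t te; rewrite /F0 /F0' /chi /dchi ramp_late// expr0n /= !(mul0r, mulr0, oppr0, scale0r).
  by rewrite addr0.
- split=> [t|]; last by rewrite /L0 LT /ell subrr mul0mx addr0.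
  apply: (dmx_eq (dmxD (dL t) (dell e t e0))).
  by rewrite addrACA -opprD -mulmxDl -mulmxDl F0E.
move=> i j.
have -> : gain_cov B1 D S0 T (L0 e) (F0 e) - gain_cov B1 D S0 T L F = D1 e 0 + imx (D2 e) 0 T.
  rewrite /gain_cov opprD addrACA; congr (_ + _).
    by rewrite /L0 congr_perturb addrAC subrr add0r.
  apply: imx_sub_eq => //; last 2 first.
  - exact: cD2.
  - move=> t; rewrite F0E// /L0 congr_perturb [in X in _ + X]congr_perturb.
    by rewrite addrACA.
  - by apply: cmxD; apply: cmxM; (try (apply: cmxM => //; exact: cmx_cst)); exact: cmxT.
rewrite mxE; apply: le_trans (ler_normD _ _) _; apply: le_trans edl.
rewrite mulrDl lerD//; last exact: hc2.
by apply: hc1 => //; rewrite lexx.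
Qed.

End smooth_gain.

(** * Adjusting the gain to the target covariance *)

Section filter_gain.
Context (R : realType).

Lemma gain_cov_sym n m1 p (B1 : 'M[R]_(n, m1)) (D : 'M[R]_p) (T : R) (S0 : 'M[R]_n)
    (L : R -> 'M[R]_n) (F : R -> 'M[R]_(n, p)) : S0^T = S0 ->
  (gain_cov B1 D S0 T L F)^T = gain_cov B1 D S0 T L F.
Proof.
move=> s; rewrite /gain_cov linearD /= imxT !trmx_mul trmxK s mulmxA; congr (_ + _).
by apply: imx_eq => t _; rewrite linearD /= !trmx_mul !trmxK !mulmxA.
Qed.

Lemma gain_state n p (A : 'M[R]_n) (C : 'M[R]_(p, n)) (T : R) (H : R -> 'M[R]_(n, p)) : cmx H ->
  exists2 ell : R -> 'M[R]_n, (forall t, dmx ell (- (ell t *m A) + H t *m C) t) & ell T = 0.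
Proof.
move=> cH; pose f t := H t *m (C *m expm A t).
have cf : cmx f.
  by apply: cmxM => //; apply: cmxM; [exact: cmx_cst|exact: cmx_expm].
exists (fun t => (gprimx f t - gprimx f T) *m expm A (- t)); last by rewrite subrr mul0mx.
move=> t.
have h := dmxM (dmxB (dmx_gprimx t cf) (dmx_cst (gprimx f T) t)) (dmx_expmN A t).
apply: (dmx_eq h); rewrite subr0 mulmxN addrC mulmxA; congr (_ + _).
by rewrite /f -!mulmxA expmKN mulmx1.
Qed.

(** With V = N N' and c = b N'^-1 the left side is (G N + c)(G N + c)' - c c', so G N + c is taken
    to be a Cholesky factor M of Q + c c'. *)
Lemma complete_square n (Q b V : 'M[R]_n) : posdef Q -> posdef V ->
  exists G, b *m G^T + (b *m G^T)^T + G *m V *m G^T = Q.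
Proof.
move=> pQ pV; have [N VN] := posdef_cholesky pV.
have uN : N \in unitmx by have := posdef_unit pV; rewrite VN unitmx_mul => /andP[].
pose c := b *m (invmx N)^T.
have pM : posdef (Q + c *m c^T).
  apply: posdefD => //; first by rewrite trmx_mul trmxK.
  by move=> z; rewrite -{1}[c]trmxK qf_sqr_ge0.
have [M hM] := posdef_cholesky pM.
exists ((M - c) *m invmx N).
have -> : b *m ((M - c) *m invmx N)^T = c *m (M - c)^T by rewrite trmx_mul mulmxA.
have -> : (M - c) *m invmx N *m V *m ((M - c) *m invmx N)^T = (M - c) *m (M - c)^T.
  rewrite VN trmx_mul !mulmxA mulmxKV// -!mulmxA [N^T *m (_ *m _)]mulmxA -trmx_mul mulVmx//.
  by rewrite trmx1 mul1mx.
rewrite trmx_mul trmxK [(M - c)^T]linearB /= !(mulmxBl, mulmxBr) -hM.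
move: (M *m c^T) (c *m M^T) (c *m c^T) => a1 a2 a3.
by apply/matrixP => i j; rewrite !mxE; ring.
Qed.

(** The bilinear form that polarises [gain_cov]. *)
Definition gain_cross n m1 p (B1 : 'M[R]_(n, m1)) (D : 'M[R]_p) (S0 : 'M[R]_n) (T : R)
    (L : R -> 'M[R]_n) (F : R -> 'M[R]_(n, p)) (l : R -> 'M[R]_n) (f : R -> 'M[R]_(n, p)) : 'M[R]_n :=
  L 0 *m S0 *m (l 0)^T
  + imx (fun t => L t *m (B1 *m B1^T) *m (l t)^T + F t *m (D *m D^T) *m (f t)^T) 0 T.

Lemma congr_cross n p (S : 'M[R]_p) (X Y : 'M[R]_(n, p)) (G : 'M[R]_n) : S^T = S ->
  (X + G *m Y) *m S *m (X + G *m Y)^T = X *m S *m X^T +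
   (X *m S *m Y^T *m G^T + (X *m S *m Y^T *m G^T)^T) + G *m (Y *m S *m Y^T) *m G^T.
Proof.
move=> s; rewrite !mulmxDl [(X + _)^T]linearD /= !mulmxDr !trmx_mul !trmxK s !mulmxA.
by rewrite !addrA.
Qed.

Lemma imx_affine n (M1 M2 M3 : R -> 'M[R]_n) (G : 'M[R]_n) (T : R) : 0 <= T ->
  cmx M1 -> cmx M2 -> cmx M3 ->
  imx (fun t => M1 t + ((M2 t *m G^T + (M2 t *m G^T)^T) + G *m M3 t *m G^T)) 0 T =
  imx M1 0 T + ((imx M2 0 T *m G^T + (imx M2 0 T *m G^T)^T) + G *m imx M3 0 T *m G^T).
Proof.
move=> T0 c1 c2 c3.
have c2G : cmx (fun t => M2 t *m G^T) by apply: cmxM => //; exact: cmx_cst.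
have c2GT : cmx (fun t => (M2 t *m G^T)^T) by exact: cmxT.
have c3G : cmx (fun t => G *m M3 t) by apply: cmxM => //; exact: cmx_cst.
have c3GG : cmx (fun t => G *m M3 t *m G^T) by apply: cmxM => //; exact: cmx_cst.
have c22 : cmx (fun t => M2 t *m G^T + (M2 t *m G^T)^T) by exact: cmxD.
have c223 : cmx (fun t => (M2 t *m G^T + (M2 t *m G^T)^T) + G *m M3 t *m G^T) by exact: cmxD.
rewrite (imxD c1 c223)// (imxD c22 c3GG)// (imxD c2G c2GT)// imxMr// imxT imxMl//.
by rewrite imxMr.
Qed.

Lemma gain_cov_affine n m1 p (B1 : 'M[R]_(n, m1)) (D : 'M[R]_p) (S0 : 'M[R]_n) (T : R)
    (L : R -> 'M[R]_n) (F : R -> 'M[R]_(n, p)) (l : R -> 'M[R]_n) (f : R -> 'M[R]_(n, p)) (G : 'M[R]_n) :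
  0 <= T -> S0^T = S0 -> cmx L -> cmx F -> cmx l -> cmx f ->
  let b := gain_cross B1 D S0 T L F l f in
  gain_cov B1 D S0 T (fun t => L t + G *m l t) (fun t => F t + G *m f t) =
  gain_cov B1 D S0 T L F + (b *m G^T + (b *m G^T)^T + G *m gain_cov B1 D S0 T l f *m G^T).
Proof.
move=> T0 s cL cF cl cf b.
pose Q := B1 *m B1^T; pose Rm := D *m D^T.
have sQ : Q^T = Q by rewrite trmx_mul trmxK.
have sR : Rm^T = Rm by rewrite trmx_mul trmxK.
pose M1 t := L t *m Q *m (L t)^T + F t *m Rm *m (F t)^T.
pose M2 t := L t *m Q *m (l t)^T + F t *m Rm *m (f t)^T.
pose M3 t := l t *m Q *m (l t)^T + f t *m Rm *m (f t)^T.
have cq m' n' (X Y : R -> 'M[R]_(m', n')) (S : 'M[R]_n') : cmx X -> cmx Y -> cmx (fun t => X t *m S *m (Y t)^T).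
  by move=> cX cY; apply: cmxM; [apply: cmxM => //; exact: cmx_cst|exact: cmxT].
have c1 : cmx M1 by apply: cmxD; exact: cq.
have c2 : cmx M2 by apply: cmxD; exact: cq.
have c3 : cmx M3 by apply: cmxD; exact: cq.
rewrite /b /gain_cross /gain_cov -/Q -/Rm congr_cross//.
rewrite (imx_eq (G := fun t => M1 t + ((M2 t *m G^T + (M2 t *m G^T)^T) + G *m M3 t *m G^T))); last first.
  move=> t _; rewrite congr_cross// [X in _ + X]congr_cross//.
  rewrite /M1 /M2 /M3 mulmxDl [(_ + _ *m G^T)^T]linearD /= mulmxDr mulmxDl.
  move: (L t *m Q *m (L t)^T) (F t *m Rm *m (F t)^T) (L t *m Q *m (l t)^T *m G^T) => a1 a2 a3.
  move: (F t *m Rm *m (f t)^T *m G^T) (G *m (l t *m Q *m (l t)^T) *m G^T) (G *m (f t *m Rm *m (f t)^T) *m G^T) => a4 a5 a6.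
  move: a3^T a4^T => a7 a8.
  by apply/matrixP => i j; rewrite !mxE; ring.
rewrite imx_affine//.
rewrite -[imx (fun t => L t *m Q *m (l t)^T + _) 0 T]/(imx M2 0 T) -[imx (fun t => l t *m Q *m (l t)^T + _) 0 T]/(imx M3 0 T).
rewrite -[imx (fun t => L t *m Q *m (L t)^T + _) 0 T]/(imx M1 0 T).
rewrite !(mulmxDl, mulmxDr) ![(_ + _ *m G^T)^T]linearD /=.
move: (imx M1 0 T) (imx M2 0 T *m G^T) (G *m imx M3 0 T *m G^T) => a1 a2 a3.
move: (L 0 *m S0 *m (L 0)^T) (L 0 *m S0 *m (l 0)^T *m G^T) (G *m (l 0 *m S0 *m (l 0)^T) *m G^T) => a4 a5 a6.
move: a2^T a5^T => a7 a8.
by apply/matrixP => i j; rewrite !mxE; ring.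
Qed.

(** The measurement noise term alone is an observability Gramian, with the fourth power of the ramp
    as weight, positive on ]0, T - e[; D is invertible, so it hides no direction. The other terms
    are positive semidefinite. *)
Lemma gain_cov_posdef n m1 p (A : 'M[R]_n) (C : 'M[R]_(p, n)) (B1 : 'M[R]_(n, m1)) (D : 'M[R]_p)
   (S0 : 'M[R]_n) (T e : R) (l : R -> 'M[R]_n) :
  observable A C -> D \in unitmx -> psd S0 -> cmx l -> 0 < e < T ->
  posdef (gain_cov B1 D S0 T l (fun t => ramp T e t ^+ 2 *: (C *m expm A t)^T)).
Proof.
move=> obs uD pS cl /andP[e0 eT].
have T0 : 0 <= T by exact: ltW (lt_trans e0 eT).
have cCE : cmx (fun t => C *m expm A t) by apply: cmxM; [exact: cmx_cst|exact: cmx_expm].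
have cr := @continuous_ramp2 R T e.
pose Lo t := D^T *m (C *m expm A t).
pose be t := ramp T e t ^+ 2 * ramp T e t ^+ 2.
have cb : continuous be by move=> x; apply: cvgM; exact: cr.
have cLo : cmx Lo by apply: cmxM => //; exact: cmx_cst.
have c1 : cmx (fun t => l t *m (B1 *m B1^T) *m (l t)^T).
  by apply: cmxM; [apply: cmxM => //; exact: cmx_cst|exact: cmxT].
have c2 : cmx (fun t => be t *: ((Lo t)^T *m Lo t)).
  by apply: cmxZ => //; apply: cmxM => //; exact: cmxT.
have psdQ : psd (B1 *m B1^T).
  split; first by rewrite trmx_mul trmxK.
  by move=> z; rewrite -{1}[B1]trmxK qf_sqr_ge0.
rewrite /gain_cov (imx_eq (G := fun t => l t *m (B1 *m B1^T) *m (l t)^T + be t *: ((Lo t)^T *m Lo t))); last first.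
  move=> t _; congr (_ + _); rewrite /be /Lo [(_ *: _)^T]linearZ /= trmxK.
  by rewrite -!scalemxAl -scalemxAr scalerA [(D^T *m _)^T]trmx_mul trmxK !mulmxA.
rewrite imxD ?lexx// addrA addrC; apply: posdefD.
- apply: (@weighted_gramian_posdef R p n Lo be T 0 (T - e)) => //.
  + by move=> t; rewrite mulr_ge0 ?sqr_ge0.
  + move=> t /andP[t0 tT]; split; first by rewrite t0/=; lra.
    have : 0 < ramp T e t by rewrite lt_max; apply/orP; right; lra.
    by move=> r0; rewrite mulr_gt0// exprn_gt0.
  + move=> z hz; apply: (observable_kernel (a := 0) (b := T - e) obs); first lra.
    move=> t tt; have := hz t tt; rewrite /Lo => /(congr1 (mulmx (invmx D^T))).
    by rewrite mulmx0 -!mulmxA mulKmx ?unitmx_tr// mulmxA.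
- rewrite linearD /= imxT; have [sS _] := psd_congr (l 0) pS.
  rewrite sS; congr (_ + _); apply: imx_eq => t _.
  by have [-> _] := psd_congr (l t) psdQ.
- move=> z; rewrite qfD addr_ge0//; first by have [_ h] := psd_congr (l 0) pS.
  by apply: imx_qf_ge0 => // t _; have [_ h] := psd_congr (l t) psdQ.
Qed.

Lemma filter_gain n m1 p (A : 'M[R]_n) (B1 : 'M[R]_(n, m1)) (C : 'M[R]_(p, n)) (D : 'M[R]_p)
    (T : R) (S0 ST : 'M[R]_n) (P : R -> 'M[R]_n) :
  0 < T -> posdef S0 -> observable A C -> D \in unitmx ->
  riccati_solution A B1 C D T S0 P -> posdef (ST - P T) ->
  exists (tau : R) (L : R -> 'M[R]_n) (F F' : R -> 'M[R]_(n, p)),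
  [/\ 0 < tau < T, (forall t, dmx F (F' t) t) /\ cmx F',
   forall t, tau <= t -> F t = 0 /\ F' t = 0,
   (forall t, dmx L (- (L t *m A) + F t *m C) t) /\ L T = 1%:M &
   gain_cov B1 D S0 T L F = ST].
Proof.
move=> T0 pS obs uD ric pP.
have [sS0 _] := pS.
have [L1 [F1 [F1' [dF1 cF1' dL1 L1T E1]]]] := optimal_gain T0 pS uD ric.
(* [dl] is the room left by the strict inequality: a covariance within [dl] of P(T), entry by entry,
   still lies below SigmaT. *)
have [dl dl0 hdl] := posdef_open pP.
have [e [L0 [F0 [F0' [/andP[e0 eT] [dF0 cF0'] F0z [dL0 L0T] hd]]]]] := smooth_gain B1 D S0 T0 dF1 cF1' dL1 L1T dl0.
have eT' : 0 < e < T by rewrite e0/=; lra.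
pose J0 := gain_cov B1 D S0 T L0 F0.
have pQ : posdef (ST - J0).
  have -> : ST - J0 = ST - P T + (P T - J0) by rewrite addrA subrK.
  apply: hdl; first by rewrite linearB /= -E1 !gain_cov_sym.
  by move=> i j; have := hd i j; rewrite E1 -/J0 -normrN -[(J0 - P T)]opprB [in X in X -> _]mxE opprK.
(* The direction in which the gain is modified uses the ramp of the cut-off itself, so the modified
   gain also vanishes after T - e. *)
pose psi t := ramp T e t ^+ 2 *: (C *m expm A t)^T.
pose psi' t := - (2 * ramp T e t) *: (C *m expm A t)^T + ramp T e t ^+ 2 *: (C *m (A *m expm A t))^T.
have dpsi t : dmx psi (psi' t) t.
  apply: dmxZ; first exact: is_derive_ramp2.
  by apply: dmxT; apply: dmxMl; exact: dmx_expm.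
have cE : cmx (expm A) by exact: cmx_expm.
have cpsi : cmx psi by exact: dmx_cmx dpsi.
have cpsi' : cmx psi'.
  apply: cmxD; apply: cmxZ.
  - move=> x; apply: cvgN; apply: cvgM; [exact: cvg_cst|exact: continuous_ramp].
  - by apply: cmxT; apply: cmxM => //; exact: cmx_cst.
  - exact: continuous_ramp2.
  - by apply: cmxT; apply: cmxM; [exact: cmx_cst|apply: cmxM => //; exact: cmx_cst].
have [l dl' lT] := gain_state A C T cpsi.
have cl := dmx_cmx dl'.
have pV := gain_cov_posdef B1 obs uD (posdef_psd pS) cl eT'.
have [G hG] := complete_square (gain_cross B1 D S0 T L0 F0 l psi) pQ pV.
exists (T - e), (fun t => L0 t + G *m l t), (fun t => F0 t + G *m psi t), (fun t => F0' t + G *m psi' t).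
split.
- by apply/andP; split; lra.
- split=> [t|]; first by apply: dmxD => //; exact: dmxMl.
  by apply: cmxD => //; apply: cmxM => //; exact: cmx_cst.
- move=> t te; have [-> ->] := F0z t te.
  by rewrite /psi /psi' ramp_late// expr0n /= mulr0 oppr0 !scale0r addr0 !mulmx0 addr0.
- split=> [t|]; last by rewrite L0T lT mulmx0 addr0.
  apply: (dmx_eq (dmxD (dL0 t) (dmxMl G (dl' t)))).
  by rewrite mulmxDr mulmxN mulmxDl [in RHS]mulmxDl !mulmxA opprD addrACA.
rewrite gain_cov_affine//; [|exact: ltW|exact: dmx_cmx dL0|exact: dmx_cmx dF0].
by rewrite hG addrC subrK.
Qed.

End filter_gain.

(** * Wiener integrals *)

Section generated.
Context (R : realType) (d : measure_display) (Omega : measurableType d).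

Definition gen_measurable (I : Type) (k n : nat) (J : set I) (Z : I -> Omega -> 'cV[R]_k)
    (f : Omega -> 'cV[R]_n) : Prop :=
  forall E, borel_cV E -> sigma_gen J Z (f @^-1` E).

(** Omega with the generated sigma-algebra as its own structure, so that general measurability
    lemmas also prove adaptedness. *)
Definition gen_type (I : Type) (k : nat) (J : set I) (Z : I -> Omega -> 'cV[R]_k) :=
  g_sigma_algebraType (\bigcup_(t in J) [set Z t @^-1` E | E in @borel_cV R k]).

Lemma gen_measurableP (I : Type) (k n : nat) (J : set I) (Z : I -> Omega -> 'cV[R]_k)
    (f : Omega -> 'cV[R]_n) :
  gen_measurable J Z f <-> measurable_fun setT (f : gen_type J Z -> 'cV[R]_n).
Proof.
split=> [h _ E mE|h E mE]; first by rewrite setTI; exact: h.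
by have := h measurableT E mE; rewrite setTI.
Qed.

Lemma gen_process (I : Type) (k : nat) (J : set I) (Z : I -> Omega -> 'cV[R]_k) t : J t ->
  gen_measurable J Z (Z t).
Proof. by move=> Jt E mE; apply: sub_sigma_algebra; exists t => //; exists E. Qed.

Lemma gen_mulmx (I : Type) (k m n : nat) (J : set I) (Z : I -> Omega -> 'cV[R]_k) (M : 'M[R]_(m, n)) f :
  gen_measurable J Z f -> gen_measurable J Z (fun w => M *m f w).
Proof. by move=> /gen_measurableP h; apply/gen_measurableP; exact: measurable_mulmx. Qed.

Lemma gen_add (I : Type) (k n : nat) (J : set I) (Z : I -> Omega -> 'cV[R]_k) (f g : Omega -> 'cV[R]_n) :
  gen_measurable J Z f -> gen_measurable J Z g -> gen_measurable J Z (fun w => f w + g w).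
Proof.
by move=> /gen_measurableP hf /gen_measurableP hg; apply/gen_measurableP; exact: measurable_cVD.
Qed.

Lemma gen_sub (I : Type) (k n : nat) (J : set I) (Z : I -> Omega -> 'cV[R]_k) (f g : Omega -> 'cV[R]_n) :
  gen_measurable J Z f -> gen_measurable J Z g -> gen_measurable J Z (fun w => f w - g w).
Proof.
by move=> /gen_measurableP hf /gen_measurableP hg; apply/gen_measurableP; exact: measurable_cVB.
Qed.

Lemma gen_cst (I : Type) (k n : nat) (J : set I) (Z : I -> Omega -> 'cV[R]_k) (z : 'cV[R]_n) :
  gen_measurable J Z (fun=> z).
Proof. by apply/gen_measurableP; exact: measurable_cst. Qed.

Lemma sigma_gen_sub (I I' : Type) (k k' : nat) (J : set I) (J' : set I')
    (Z : I -> Omega -> 'cV[R]_k) (Z' : I' -> Omega -> 'cV[R]_k') :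
  (forall t, J t -> gen_measurable J' Z' (Z t)) -> sigma_gen J Z `<=` sigma_gen J' Z'.
Proof.
move=> h; apply: smallest_sub; first exact: smallest_sigma_algebra.
by move=> _ [t Jt [E mE <-]]; exact: h.
Qed.

Lemma gen_measurableW (I I' : Type) (k k' n : nat) (J : set I) (J' : set I')
    (Z : I -> Omega -> 'cV[R]_k) (Z' : I' -> Omega -> 'cV[R]_k') (f : Omega -> 'cV[R]_n) :
  (forall t, J t -> gen_measurable J' Z' (Z t)) -> gen_measurable J Z f -> gen_measurable J' Z' f.
Proof. by move=> h hf E mE; apply: sigma_gen_sub (hf E mE). Qed.

End generated.

Section matrix_integrals.
Context (R : realType).
Notation leb := (@lebesgue_measure R).

Lemma imx_mulmxE m n p (G : R -> 'M[R]_(m, n)) (Y : R -> 'M[R]_(n, p)) (T : R) i j :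
  0 <= T -> cmx G -> cmx Y ->
  imx (fun s => G s *m Y s) 0 T i j = \sum_l \int[leb]_(s in `[0, T]) (G s i l * Y s l j).
Proof.
move=> T0 cG cY; rewrite mxE.
have c l : continuous (fun s => G s i l * Y s l j).
  by move=> x; apply: cvgM; [exact: cG|exact: cY].
pose F t := \sum_l prim (fun s => G s i l * Y s l j) t.
have cGY : continuous (fun s => (G s *m Y s) i j).
  by have := cmxM cG cY; move=> /(_ i j).
have dF (t : R) : 0 <= t <= T -> is_derive t 1 F ((G t *m Y t) i j).
  move=> /andP[t0 _]; rewrite mxE; apply: is_derive_sumR => l; apply: is_derive_prim => //.
  exact: lt_le_trans t0.
have -> := FTC2 T0 dF cGY.
rewrite /F [X in _ - X]big1 => [|l _]; last by rewrite prim0.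
by rewrite subr0; apply: eq_bigr => l _; rewrite primE.
Qed.

Lemma measurable_imx d (Om : measurableType d) m n (G : R -> 'M[R]_(m, n)) (Y : R -> Om -> 'cV[R]_n) (T : R) :
  0 <= T -> cmx G -> (forall w, cmx (Y ^~ w)) ->
  (forall t, 0 <= t <= T -> measurable_fun setT (Y t)) ->
  measurable_fun setT (fun w => imx (fun s => G s *m Y s w) 0 T).
Proof.
move=> T0 cG cY mY; apply/measurable_fun_cVP => i.
under eq_fun do rewrite imx_mulmxE//.
apply: measurable_sum => l; apply: (@measurable_path_integral R _ _ _ (fun s w => Y s w l 0)) => //.
- by move=> w; exact: cY.
- by move=> t tT; have /measurable_fun_cVP := mY t tT; exact.
Qed.

(** Riemann sums are Stieltjes sums against the identity, and one integration by parts rewrites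
    their limit. *)
Lemma riemann_cvg (g g' : R -> R) (T : R) : 0 <= T ->
  (forall t : R, is_derive t 1 g (g' t)) -> continuous g' ->
  \sum_(j < k.+1) (T / k.+1%:R) * g (grid T k.+1 j) @[k --> \oo] --> \int[leb]_(s in `[0, T]) g s.
Proof.
move=> T0 dg cg'.
have cg : continuous g by move=> t; exact: is_derive_continuous (dg t).
have cid : continuous (id : R -> R) by move=> x; exact: cvg_id.
have := stieltjes_cvg T0 (fun t _ => dg t) cg' cid.
have -> : g T * id T - g 0 * id 0 - \int[leb]_(s in `[0, T]) (g' s * id s) = \int[leb]_(s in `[0, T]) g s.
  pose F t := g t * t - prim g t.
  have c' : continuous (fun s => g' s * s).
    by move=> x; apply: cvgM; [exact: cg'|exact: cvg_id].
  have dF (t : R) : 0 <= t <= T -> is_derive t 1 F (g' t * t); last first.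
    have -> := FTC2 T0 dF c'.
    by rewrite /F prim0 -primE// !mulr0; ring.
  move=> /andP[t0 _]; have d1 := is_deriveM (dg t) (is_derive_id t (1 : R)).
  have d2 := is_derive_prim cg (lt_le_trans (ltrN10 R) t0).
  by apply: (is_derive_eq (is_deriveB d1 d2)); rewrite /GRing.scale /=; ring.
apply: cvg_trans; rewrite (_ : (fun k => \sum_(j < k.+1) _) = (fun k => stieltjes g id T k.+1))//.
apply/funext => k; apply: eq_bigr => j _.
by rewrite gridS mulrC.
Qed.

(** The Wiener integral of G over [0, T], taken path by path through integration by parts; the
    boundary term at 0 is absent because W starts at 0. *)
Definition wint m n (T : R) (G G' : R -> 'M[R]_(m, n)) (W : R -> 'cV[R]_n) : 'cV[R]_m :=
  G T *m W T - imx (fun s => G' s *m W s) 0 T.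

(** The number J of cells is separate from the mesh N so that an induction on J can add one
    increment at a time. *)
Definition wsum m n (T : R) (G : R -> 'M[R]_(m, n)) (W : R -> 'cV[R]_n) (N J : nat) : 'cV[R]_m :=
  \sum_(j < J) G (grid T N j) *m (W (grid T N j.+1) - W (grid T N j)).

Lemma wsum_cvg m n (T : R) (G G' : R -> 'M[R]_(m, n)) (W : R -> 'cV[R]_n) : 0 <= T ->
  (forall t, dmx G (G' t) t) -> cmx G' -> cmx W -> W 0 = 0 ->
  mxcvg (fun k => wsum T G W k.+1 k.+1) (wint T G G' W).
Proof.
move=> T0 dG cG' cW W0 i j.
rewrite [X in _ --> X]mxE [X in _ + X]mxE imx_mulmxE// [X in X - _]mxE -sumrB.
rewrite (_ : (fun k => _) = (fun k => \sum_l stieltjes (fun s => G s i l) (fun s => W s l j) T k.+1)); last first.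
  apply/funext => k; rewrite /wsum summxE /stieltjes exchange_big /=; apply: eq_bigr => a _.
  by rewrite mxE; apply: eq_bigr => l _; rewrite !mxE.
apply: cvg_sumF => l.
have := stieltjes_cvg T0 (fun t _ => dG t i l) (cG' i l) (cW l j).
by rewrite W0 [(0 : 'cV_n) l j]mxE mulr0 subr0.
Qed.

Definition csum m n (T : R) (G : R -> 'M[R]_(m, n)) (N J : nat) : 'M[R]_m :=
  \sum_(j < J) (T / N%:R) *: (G (grid T N j) *m (G (grid T N j))^T).

Lemma csum_cvg m n (T : R) (G G' : R -> 'M[R]_(m, n)) : 0 <= T ->
  (forall t, dmx G (G' t) t) -> cmx G' ->
  mxcvg (fun k => csum T G k.+1 k.+1) (imx (fun s => G s *m (G s)^T) 0 T).
Proof.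
move=> T0 dG cG' i j; rewrite mxE.
have cG := dmx_cmx dG.
pose g' t := (G' t *m (G t)^T + G t *m (G' t)^T) i j.
have h := @riemann_cvg (fun s => (G s *m (G s)^T) i j) g' T T0.
rewrite (_ : (fun k => _) = (fun k => \sum_(j0 < k.+1) (T / k.+1%:R) * (G (grid T k.+1 j0) *m (G (grid T k.+1 j0))^T) i j)).
  apply: h => [t|]; first exact: (dmxM (dG t) (dmxT (dG t))).
  have : cmx (fun t => G' t *m (G t)^T + G t *m (G' t)^T).
    by apply: cmxD; apply: cmxM => //; exact: cmxT.
  by move=> /(_ i j).
by apply/funext => k; rewrite /csum summxE; apply: eq_bigr => a _; rewrite mxE.
Qed.

End matrix_integrals.

(** * Gaussian law of Wiener integrals *)

Section wiener_integral.
Context (R : realType) (d : measure_display) (Omega : measurableType d).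
Context (Pr : probability Omega R).

Lemma isgauss0 n : isgauss Pr (fun=> 0 : 'cV[R]_n) 0.
Proof.
split; first exact: measurable_cst.
  by split=> [|z]; rewrite ?trmx0// /qf mulmx0 mul0mx mxE.
move=> k M a; rewrite mulmx0 mul0mx addr0.
have -> : gauss_bump 1%:M a = bump M a 0.
  by rewrite /gauss_bump /bump det1 sqrtr1 invr1 mul1r invmx1 mulmx0 sub0r qfN.
rewrite integral_cst//; transitivity ((bump M a 0)%:E * 1)%E; last by rewrite mule1.
by congr (_ * _)%E; exact: probability_setT.
Qed.

Lemma independent_preimage (I I' : Type) (k k' m n : nat) (J : set I) (J' : set I')
    (Z : I -> Omega -> 'cV[R]_k) (Z' : I' -> Omega -> 'cV[R]_k') (f : Omega -> 'cV[R]_m) (g : Omega -> 'cV[R]_n) :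
  independent Pr (sigma_gen J Z) (sigma_gen J' Z') -> gen_measurable J Z f -> gen_measurable J' Z' g ->
  forall A B, measurable A -> measurable B ->
  Pr (f @^-1` A `&` g @^-1` B) = (Pr (f @^-1` A) * Pr (g @^-1` B))%E.
Proof. by move=> ind hf hg A B mA mB; apply: ind; [exact: hf|exact: hg]. Qed.

(** The partial sum is measurable for the past of the next cell, whose increment is independent of
    that past; so measurability travels with the Gaussian law through the induction. *)
Lemma wsum_gauss k n (T : R) (W : R -> Omega -> 'cV[R]_k) (G : R -> 'M[R]_(n, k)) (N J : nat) :
  0 < T -> (0 < N)%N -> (J <= N)%N -> wiener Pr T W ->
  isgauss Pr (fun w => wsum T G (W ^~ w) N J) (csum T G N J) /\ gen_measurable `[0, grid T N J] W (fun w => wsum T G (W ^~ w) N J).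
Proof.
move=> T0 N0 + [mW _ _ dW iW]; elim: J => [|J IH] JN.
  rewrite /wsum /csum; under eq_fun do rewrite big_ord0; rewrite big_ord0.
  by split; [exact: isgauss0|exact: gen_cst].
have [IH1 IH2] := IH (ltnW JN).
have /andP[s0 sT] := grid_in (ltW T0) (ltnW JN).
have /andP[t0 tT] := grid_in (ltW T0) JN.
have dlt : grid T N J.+1 - grid T N J = T / N%:R := gridS T N J.
have dl0 : 0 < T / N%:R by rewrite divr_gt0// ltr0n.
have st : grid T N J < grid T N J.+1 by rewrite -subr_gt0 dlt.
pose inc (t' : R) w := W t' w - W (grid T N J) w.
have ginc := isgauss_linear (G (grid T N J)) (density_isgauss (posdef_scalar k dl0) (eq_ind _ (fun c => has_density Pr _ (gaussian_density c%:M)) (dW _ _ s0 st tT) _ dlt)).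
have minc : gen_measurable [set grid T N J.+1] inc (fun w => G (grid T N J) *m inc (grid T N J.+1) w).
  by apply: gen_mulmx; exact: gen_process.
have ind := independent_preimage (iW _ _ s0 st tT) IH2 minc.
have -> : (fun w => wsum T G (W ^~ w) N J.+1) =
    (fun w => wsum T G (W ^~ w) N J + G (grid T N J) *m inc (grid T N J.+1) w).
  by apply/funext => w; rewrite /wsum big_ord_recr.
split.
  have -> : csum T G N J.+1 = csum T G N J + G (grid T N J) *m (T / N%:R)%:M *m (G (grid T N J))^T.
    by rewrite /csum big_ord_recr /= mul_mx_scalar -scalemxAl.
  exact: isgauss_add.
have sub : forall t, `[0, grid T N J]%classic t -> gen_measurable `[0, grid T N J.+1] W (W t).
  move=> t; rewrite /= in_itv /= => /andP[t1 t2]; apply: gen_process.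
  by rewrite /= in_itv /= t1 (le_trans t2)// ltW.
apply: gen_add; first exact: (gen_measurableW sub).
apply: gen_mulmx; apply: gen_sub; apply: gen_process; rewrite /= in_itv /=.
  by rewrite t0 lexx.
by rewrite s0 ltW.
Qed.

(* The paths of [W'] are continuous for every omega, so that path integrals of
   [W'] are random variables and not only almost everywhere limits of such. *)
Definition regular k (T : R) (W W' : R -> Omega -> 'cV[R]_k) : Prop :=
  [/\ forall w, cmx (W' ^~ w), forall w, W' 0 w = 0,
      forall t, measurable_fun setT (W' t) &
      {ae Pr, forall w, forall t, 0 <= t <= T -> W' t w = W t w}].

Lemma wiener_regular k (T : R) (W : R -> Omega -> 'cV[R]_k) : 0 <= T -> wiener Pr T W ->
  exists W', regular T W W'.
Proof.
move=> T0 [mW W0 cW _ _].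
(* The outcomes with a bad path need not form a measurable set; a measurable null set [N] around
   them does, and zeroing the path on [N] keeps each [W' t] measurable. *)
have [N [mN PN hN]] : Pr.-negligible (~` [set w | W 0 w = 0 /\ {within `[0, T], continuous (W ^~ w)}]).
  have : {ae Pr, forall w, W 0 w = 0 /\ {within `[0, T], continuous (W ^~ w)}}.
    by apply: filterS2 W0 cW => w.
  by [].
have good w : ~ N w -> W 0 w = 0 /\ {within `[0, T], continuous (W ^~ w)}.
  by move=> nN; apply: contrapT => h; apply: nN; exact: hN.
pose W' t w := (\1_(~` N) w : R) *: W (clamp T t) w.
have WE w t : ~ N w -> W' t w = W (clamp T t) w.
  by move=> nN; rewrite /W' indicE mem_set// scale1r.
have W'0 w t : N w -> W' t w = 0.
  by move=> nN; rewrite /W' indicE memNset ?scale0r//; apply.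
exists W'; split.
- move=> w i j; have [Nw|Nw] := pselect (N w).
    by under eq_fun do rewrite W'0//; exact: cst_continuous.
  under eq_fun do rewrite WE//.
  apply: (@clamp_continuous R T (fun t => W t w i j)) => //.
  by apply: within_coord; have [] := good w Nw.
- move=> w; have [Nw|Nw] := pselect (N w); first exact: W'0.
  by rewrite WE// clamp_id ?lexx//; have [] := good w Nw.
- move=> t; apply/measurable_fun_cVP => i.
  under eq_fun do rewrite mxE.
  apply: measurable_funM; last by apply: mW; exact: clamp_in.
  by apply: measurable_indic; exact: measurableC.
- exists N; split=> // w /= h; apply: contrapT => Nw; apply: h => t tT.
  by rewrite WE// clamp_id.
Qed.

(** For each mesh the three terms are independent Gaussian vectors, and [isgauss_lim] passes to the
    limit. Each term may be degenerate, so the argument stays with [isgauss] and no densities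
    appear. *)
Lemma wiener_integral n k l q (T : R) (w : R -> Omega -> 'cV[R]_k) (v : R -> Omega -> 'cV[R]_l)
    (x0 : Omega -> 'cV[R]_q) (S0 : 'M[R]_q) w' v' (M0 : 'M[R]_(n, q))
    (G G' : R -> 'M[R]_(n, k)) (H H' : R -> 'M[R]_(n, l)) :
  0 < T -> posdef S0 -> has_density Pr x0 (gaussian_density S0) ->
  wiener Pr T w -> wiener Pr T v ->
  independent Pr (sigma_gen `[0, T] w) (sigma_gen `[0, T] v) ->
  independent Pr (sigma_gen [set tt] (fun=> x0))
    (sigma_gen `[0, T] (fun t omega => col_mx (w t omega) (v t omega))) ->
  regular T w w' -> regular T v v' ->
  (forall t, dmx G (G' t) t) -> cmx G' -> (forall t, dmx H (H' t) t) -> cmx H' ->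
  isgauss Pr (fun o => M0 *m x0 o + (wint T G G' (w' ^~ o) + wint T H H' (v' ^~ o)))
    (M0 *m S0 *m M0^T + (imx (fun s => G s *m (G s)^T) 0 T + imx (fun s => H s *m (H s)^T) 0 T)).
Proof.
move=> T0 pS hx ww wv iwv ixwv [cw w0 mw ew] [cv v0 mv ev] dG cG' dH cH'.
have T0' := ltW T0.
have gx := isgauss_linear M0 (density_isgauss pS hx).
pose SW N o := wsum T G (w ^~ o) N N; pose SV N o := wsum T H (v ^~ o) N N.
(* [x0] is independent of the stacked process, of which each noise is a linear image; so it is
   independent of any sum built from both noises. *)
have subw t : `[0, T]%classic t -> gen_measurable `[0, T] (fun t omega => col_mx (w t omega) (v t omega)) (w t).
  move=> tT; have -> : w t = fun o => row_mx 1%:M 0 *m col_mx (w t o) (v t o).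
    by apply/funext => o; rewrite mul_row_col mul1mx mul0mx addr0.
  by apply: gen_mulmx; exact: (gen_process (Z := fun t omega => col_mx (w t omega) (v t omega))).
have subv t : `[0, T]%classic t -> gen_measurable `[0, T] (fun t omega => col_mx (w t omega) (v t omega)) (v t).
  move=> tT; have -> : v t = fun o => row_mx 0 1%:M *m col_mx (w t o) (v t o).
    by apply/funext => o; rewrite mul_row_col mul1mx mul0mx add0r.
  by apply: gen_mulmx; exact: (gen_process (Z := fun t omega => col_mx (w t omega) (v t omega))).
have gridT N : (0 < N)%N -> grid T N N = T.
  by move=> N0; rewrite /grid mulfK// pnatr_eq0 -lt0n.
apply: (@isgauss_lim R _ _ Pr _ (fun N o => M0 *m x0 o + (SW N.+1 o + SV N.+1 o))
   (fun N => M0 *m S0 *m M0^T + (csum T G N.+1 N.+1 + csum T H N.+1 N.+1))).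
- move=> N; have [gw mw'] := wsum_gauss G T0 (ltn0Sn N) (leqnn _) ww.
  have [gv mv'] := wsum_gauss H T0 (ltn0Sn N) (leqnn _) wv.
  have gT := gridT N.+1 (ltn0Sn N); rewrite gT in mw' mv'.
  apply: isgauss_add gx _ _; first exact: isgauss_add gw gv (independent_preimage iwv mw' mv').
  apply: (independent_preimage ixwv).
    by apply: gen_mulmx; exact: (gen_process (Z := fun=> x0) (t := tt)).
  by apply: gen_add; [exact: (gen_measurableW subw)|exact: (gen_measurableW subv)].
- have mwint a (K K' : R -> 'M[R]_(n, a)) (W : R -> Omega -> 'cV[R]_a) : cmx K' -> (forall o, cmx (W ^~ o)) ->
    (forall t, measurable_fun setT (W t)) -> measurable_fun setT (fun o => wint T K K' (W ^~ o)).
    move=> cK cW mW; apply: measurable_cVB; first exact: measurable_mulmx.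
    exact: measurable_imx.
  apply: measurable_cVD; first by apply: measurable_mulmx; apply/random_vectorP; case: hx.
  by apply: measurable_cVD; exact: mwint.
- apply: filterS2 ew ev => o eo eo'.
  apply: mxcvgD; first exact: mxcvg_cst.
  have wsumE a (K : R -> 'M[R]_(n, a)) (W W' : R -> 'cV[R]_a) N : (forall t, 0 <= t <= T -> W' t = W t) ->
    wsum T K W N.+1 N.+1 = wsum T K W' N.+1 N.+1.
    by move=> h; apply: eq_bigr => j _; rewrite !h ?grid_in// ltnW.
  rewrite /SW /SV; apply: mxcvgD.
    rewrite (_ : (fun N => _) = fun N => wsum T G (w' ^~ o) N.+1 N.+1); first exact: wsum_cvg.
    by apply/funext => N; exact: wsumE.
  rewrite (_ : (fun N => _) = fun N => wsum T H (v' ^~ o) N.+1 N.+1); first exact: wsum_cvg.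
  by apply/funext => N; exact: wsumE.
- by apply: mxcvgD; [exact: mxcvg_cst|apply: mxcvgD; exact: csum_cvg].
Qed.

End wiener_integral.

(** * The closed loop *)

Section paths.
Context (R : realType).
Notation leb := (@lebesgue_measure R).

Lemma gprimx_imx m n (F : R -> 'M[R]_(m, n)) (t : R) : cmx F -> 0 <= t -> gprimx F t = imx F 0 t.
Proof. by move=> cF t0; rewrite gprimxE// imx_primx// primx0 subr0. Qed.

Lemma gprimx0 m n (F : R -> 'M[R]_(m, n)) : gprimx F 0 = 0.
Proof. by rewrite gprimxE// primx0. Qed.

Lemma solvesW k (T t : R) (z0 : 'cV[R]_k) b g z : t <= T -> solves T z0 b g z -> solves t z0 b g z.
Proof.
move=> tT [ib h]; split=> [i|s /andP[s0 st]].
  by apply: integrableS (ib i) => //; apply: subset_itvl.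
by apply: h; rewrite s0 (le_trans st).
Qed.

Lemma solves_dmx k (T : R) (b g z : R -> 'cV[R]_k) : (forall t, dmx z (b t) t) -> cmx b ->
  solves T (z 0) b g (fun t => z t + g t).
Proof.
move=> dz cb; split=> [i|t /andP[t0 tT]]; first exact: (integrable_cont _ _ (cb i 0)).
congr (_ + _).
rewrite (_ : (\col_i _) = imx b 0 t); last by apply/matrixP => i j; rewrite !mxE (ord1 j).
by rewrite (imx_FTC t0 (fun s _ => dz s) cb) addrC subrK.
Qed.

(** Noise and control cancel in the difference of two solutions, which is left with a homogeneous
    integral equation. *)
Lemma state_unique n m (A : 'M[R]_n) (B : 'M[R]_(n, m)) (t : R) (x0 : 'cV[R]_n) g
    (u u' : R -> 'cV[R]_m) (x x' : R -> 'cV[R]_n) : 0 <= t ->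
  solves t x0 (fun s => A *m x s + B *m u s) g x ->
  solves t x0 (fun s => A *m x' s + B *m u' s) g x' ->
  (forall s, 0 <= s <= t -> u' s = u s) -> forall s, 0 <= s <= t -> x' s = x s.
Proof.
move=> t0 [ib hx] [ib' hx'] uu s st.
pose b s := A *m x s + B *m u s; pose b' s := A *m x' s + B *m u' s.
have bb r : 0 <= r <= t -> A *m (x' r - x r) = b' r - b r.
  by move=> rt; rewrite /b /b' uu// opprD addrACA subrr addr0 mulmxBr.
apply/eqP; rewrite -subr_eq0; apply/eqP.
apply: (@int_fixpoint_eq0 R n A t (fun s => x' s - x s)) => //.
  move=> i.
  have h : leb.-integrable `[0, t] (fun r => ((b' r i 0)%:E - (b r i 0)%:E)%E).
    by apply: integrableB.
  apply: eq_integrable h => // r; rewrite inE /= in_itv /= => rt.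
  by rewrite bb// [in RHS]mxE [in X in _ = (_ + X)%:E]mxE EFinB.
move=> r rt; rewrite hx'// hx// opprD addrACA subrr addr0 opprD addrACA subrr add0r.
apply/matrixP => i j; rewrite !mxE.
have /andP[r0 r1] := rt.
have ir k (f : R -> 'cV[R]_k) : integrable_cV t f -> forall i, leb.-integrable `[0, r] (fun s => (f s i 0)%:E).
  by move=> h i'; apply: integrableS (h i') => //; apply: subset_itvl.
rewrite -RintegralB//; [|exact: (ir _ _ ib')|exact: (ir _ _ ib)].
apply: eq_Rintegral => a; rewrite inE /= in_itv /= => /andP[a0 ar].
by rewrite bb ?a0 ?(le_trans ar)// !mxE.
Qed.

End paths.

Section steering.
Context (R : realType) (n m m1 p : nat).
Context (A : 'M[R]_n) (B : 'M[R]_(n, m)) (B1 : 'M[R]_(n, m1)) (C : 'M[R]_(p, n)) (D : 'M[R]_p).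
Context (T tau : R) (F F' : R -> 'M[R]_(n, p)).
Notation leb := (@lebesgue_measure R).
Notation E := (expm A).

(** A ramp rather than an indicator keeps [ctrl] continuous across tau. *)
Definition late (t : R) : R := Num.max 0 (t - tau).

Definition gramian : 'M[R]_n :=
  imx (fun t => late t *: ((B^T *m (E (- t))^T)^T *m (B^T *m (E (- t))^T))) 0 T.

(* The open-loop control [ctrl t *m z] is zero before [tau] and drives the state
   from 0 at time 0 to [z] at time [T]. *)
Definition ctrl (t : R) : 'M[R]_(m, n) :=
  late t *: (B^T *m (E (- t))^T *m (invmx gramian *m E (- T))).

Definition steer (t : R) : 'M[R]_n := E t *m gprimx (fun s => E (- s) *m (B *m ctrl s)) t.

(** Minus the integral of F against d eta, by parts, when eta starts at 0 and F vanishes at tau; in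
    this form it makes sense for every continuous path. *)
Definition observed (eta : R -> 'cV[R]_p) : 'cV[R]_n := imx (fun s => F' s *m eta s) 0 tau.

(** Causal although it mentions eta on all of [0, tau]: before tau the factor [ctrl t] is zero. *)
Definition feedback (t : R) (eta : R -> 'cV[R]_p) : 'cV[R]_m := ctrl t *m observed eta.

Lemma cmx_ctrl : cmx ctrl.
Proof.
apply: cmxZ; first exact: continuous_pos.
apply: cmxM; last exact: cmx_cst.
by apply: cmxM; [exact: cmx_cst|apply: cmxT; exact: cmx_expmN].
Qed.

Lemma ctrl_early t : t <= tau -> ctrl t = 0.
Proof. by move=> tt; rewrite /ctrl /late max_l ?scale0r// subr_le0. Qed.

Lemma cmx_steer_rate : cmx (fun s => E (- s) *m (B *m ctrl s)).
Proof.
apply: cmxM; first exact: cmx_expmN.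
by apply: cmxM; [exact: cmx_cst|exact: cmx_ctrl].
Qed.

Lemma dmx_steer t : dmx steer (A *m steer t + B *m ctrl t) t.
Proof.
apply: (dmx_eq (dmxM (dmx_expm A t) (dmx_gprimx t cmx_steer_rate))).
by rewrite /steer !mulmxA expmKN mul1mx.
Qed.

Lemma steer_early t : 0 <= t <= tau -> steer t = 0.
Proof.
move=> /andP[t0 tt]; rewrite /steer gprimx_imx//; last exact: cmx_steer_rate.
rewrite (imx_eq (G := fun=> 0)) => [|s /andP[_ st]].
  rewrite (_ : imx _ _ _ = 0) ?mulmx0//; apply/matrixP => i j; rewrite !mxE.
  by rewrite Rintegral_cst// mul0r.
by rewrite ctrl_early ?mulmx0// (le_trans st).
Qed.

Lemma steer_final : 0 <= tau < T -> controllable A B -> steer T = 1%:M.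
Proof.
move=> tT ctr; have /andP[tau0 tauT] := tT.
have T0 : 0 <= T by exact: le_trans (ltW tauT).
have pG : posdef gramian by exact: gramian_posdef ctr tT.
have cG : cmx (fun t => late t *: ((B^T *m (E (- t))^T)^T *m (B^T *m (E (- t))^T))).
  have cb : cmx (fun t => B^T *m (E (- t))^T).
    by apply: cmxM; [exact: cmx_cst|apply: cmxT; exact: cmx_expmN].
  apply: cmxZ; first exact: continuous_pos.
  by apply: cmxM => //; exact: cmxT.
rewrite /steer gprimx_imx//; last exact: cmx_steer_rate.
rewrite (imx_eq (G := fun t => (late t *: ((B^T *m (E (- t))^T)^T *m (B^T *m (E (- t))^T))) *m (invmx gramian *m E (- T)))).
  rewrite -imxMr ?lexx// -/gramian mulKVmx ?posdef_unit//; exact: expmKN.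
move=> s _; rewrite /ctrl -!(scalemxAr, scalemxAl); congr (_ *: _).
by rewrite [(B^T *m _)^T]trmx_mul !trmxK !mulmxA.
Qed.

Context (x0 : 'cV[R]_n) (W : R -> 'cV[R]_m1) (V : R -> 'cV[R]_p).

(** The uncontrolled state minus B1 W. This part is differentiable and solves z' = A (z + B1 W)
    along each path, so variation of constants applies to it although W has no derivative. *)
Definition free_drift (t : R) : 'cV[R]_n :=
  E t *m (x0 + gprimx (fun s => E (- s) *m (A *m (B1 *m W s))) t).
Definition free_state (t : R) : 'cV[R]_n := free_drift t + B1 *m W t.
Definition free_output (t : R) : 'cV[R]_p := gprimx (fun s => C *m free_state s) t + D *m V t.
(** Defined from the output of the uncontrolled system, which breaks the circle between control and
    output. Both outputs agree up to tau, so the law reads the same value from either. *)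
Definition state (t : R) : 'cV[R]_n := free_state t + steer t *m observed free_output.
Definition output (t : R) : 'cV[R]_p := gprimx (fun s => C *m state s) t + D *m V t.

Context (cW : cmx W) (cV : cmx V).
Context (tau0 : 0 <= tau) (tauT : tau <= T).

Lemma dmx_free_drift t : dmx free_drift (A *m free_state t) t.
Proof.
have c : cmx (fun s => E (- s) *m (A *m (B1 *m W s))).
  by apply: cmxM; [exact: cmx_expmN|]; do 2 (apply: cmxM; first exact: cmx_cst).
apply: (dmx_eq (dmxM (dmx_expm A t) (dmxD (dmx_cst x0 t) (dmx_gprimx t c)))).
by rewrite add0r mulmxA expmKN mul1mx -mulmxA -mulmxDr.
Qed.

Lemma cmx_free_state : cmx free_state.
Proof.
apply: cmxD; first exact: dmx_cmx dmx_free_drift.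
by apply: cmxM => //; exact: cmx_cst.
Qed.

Lemma cmx_Cfree : cmx (fun s => C *m free_state s).
Proof. by apply: cmxM; [exact: cmx_cst|exact: cmx_free_state]. Qed.

Lemma cmx_state : cmx state.
Proof.
apply: cmxD; first exact: cmx_free_state.
by apply: cmxM; [exact: dmx_cmx dmx_steer|exact: cmx_cst].
Qed.

Lemma cmx_Cstate : cmx (fun s => C *m state s).
Proof. by apply: cmxM; [exact: cmx_cst|exact: cmx_state]. Qed.

Lemma cmx_output : cmx output.
Proof.
apply: cmxD; first by apply: dmx_cmx => t; exact: dmx_gprimx cmx_Cstate.
by apply: cmxM => //; exact: cmx_cst.
Qed.

Lemma state_early t : 0 <= t <= tau -> state t = free_state t.
Proof. by move=> /steer_early st; rewrite /state st mul0mx addr0. Qed.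

Lemma output_early t : 0 <= t <= tau -> output t = free_output t.
Proof.
move=> /andP[t0 tt]; rewrite /output /free_output; congr (_ + _).
rewrite (gprimx_imx cmx_Cstate t0) (gprimx_imx cmx_Cfree t0).
by apply: imx_eq => s /andP[s0 st]; rewrite state_early// s0 (le_trans st).
Qed.

Lemma observed_output : observed output = observed free_output.
Proof. by apply: imx_eq => s st; rewrite output_early. Qed.

Lemma state_solves : solves T x0 (fun t => A *m state t + B *m feedback t output) (fun t => B1 *m W t) state.
Proof.
pose z t := free_drift t + steer t *m observed free_output.
have dz t : dmx z (A *m state t + B *m feedback t output) t.
  apply: (dmx_eq (dmxD (dmx_free_drift t) (dmxMr (observed free_output) (dmx_steer t)))).
  rewrite /feedback observed_output.
  have -> : state t = free_state t + steer t *m observed free_output by [].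
  by rewrite (mulmxDr A (free_state t)) mulmxDl !mulmxA addrA.
have := solves_dmx T (fun t => B1 *m W t) dz.
have -> : z 0 = x0.
  by rewrite /z /free_drift steer_early ?lexx// mul0mx addr0 gprimx0 addr0 expm0 mul1mx.
have -> : (fun t => z t + B1 *m W t) = state.
  by apply/funext => t; rewrite /z /state /free_state addrAC.
apply; apply: cmxD; apply: cmxM; try exact: cmx_cst; first exact: cmx_state.
by apply: cmxM; [exact: cmx_ctrl|exact: cmx_cst].
Qed.

Lemma output_solves : solves T 0 (fun t => C *m state t) (fun t => D *m V t) output.
Proof.
have := solves_dmx T (fun t => D *m V t) (fun t => dmx_gprimx t cmx_Cstate) cmx_Cstate.
by rewrite gprimx0.
Qed.

(** Uniqueness comes in two stages. Up to tau the control is zero whatever the output is, so state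
    and output are determined there; this fixes the observed value, hence the control at all later
    times. *)
Lemma loop_produced (w : R -> 'cV[R]_m1) (v : R -> 'cV[R]_p) :
  (forall t, 0 <= t <= T -> W t = w t) -> (forall t, 0 <= t <= T -> V t = v t) ->
  produced_by A B B1 C D feedback T x0 w v state output.
Proof.
move=> Ww Vv.
have sx : solves T x0 (fun t => A *m state t + B *m feedback t output) (fun t => B1 *m w t) state.
  by have [ib h] := state_solves; split=> // t tT; rewrite h// Ww.
have sy : solves T 0 (fun t => C *m state t) (fun t => D *m v t) output.
  by have [ib h] := output_solves; split=> // t tT; rewrite h// Vv.
split=> // t x' y' /andP[t0 tT] [sx' sy'].
have agree r : 0 <= r <= t -> (forall s, 0 <= s <= r -> feedback s y' = feedback s output) ->
    forall s, 0 <= s <= r -> x' s = state s /\ y' s = output s.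
  move=> /andP[r0 rt] fb.
  have xx : forall s, 0 <= s <= r -> x' s = state s.
    exact: (state_unique r0 (solvesW (le_trans rt tT) sx) (solvesW rt sx') fb).
  move=> s /andP[s0 sr]; split; first by rewrite xx// s0.
  have [_ ->] := sy; last by rewrite s0 (le_trans sr)// (le_trans rt).
  have [_ ->] := sy'; last by rewrite s0 (le_trans sr).
  congr (_ + _ + _); apply/matrixP => i j; rewrite !mxE; apply: eq_Rintegral => a.
  by rewrite inE /= in_itv /= => /andP[a0 as_]; rewrite xx// a0 (le_trans as_).
have early s : s <= tau -> feedback s y' = feedback s output.
  by move=> st; rewrite /feedback ctrl_early// !mul0mx.
have [tt|tt] := leP t tau.
  apply: agree; first by rewrite t0 lexx.
  by move=> s /andP[_ st]; apply: early; exact: le_trans tt.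
have obs : observed y' = observed output.
  apply: imx_eq => s st.
  have [|r /andP[_ rt]|_ ->//] := @agree tau _ _ s st; last exact: early.
  by rewrite tau0 ltW.
by apply: agree; [rewrite t0 lexx|move=> s _; rewrite /feedback obs].
Qed.

Context (L : R -> 'M[R]_n) (dF : forall t, dmx F (F' t) t) (cF' : cmx F').
Context (Fz : forall t, tau <= t -> F t = 0 /\ F' t = 0).
Context (dL : forall t, dmx L (- (L t *m A) + F t *m C) t) (LT : L T = 1%:M).
Context (ctr : controllable A B) (tauT' : tau < T).

Lemma state_final : state T = L 0 *m x0 +
  (wint T (fun t => L t *m B1) (fun t => (- (L t *m A) + F t *m C) *m B1) W
   + wint T (fun t => - (F t *m D)) (fun t => - (F' t *m D)) V).
Proof.
have T0 : 0 <= T by exact: le_trans tauT.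
have cF := dmx_cmx dF; have cL := dmx_cmx dL.
pose Y t := gprimx (fun s => C *m free_state s) t.
have dY t : dmx Y (C *m free_state t) t by exact: dmx_gprimx cmx_Cfree.
have cY := dmx_cmx dY.
pose L' t := - (L t *m A) + F t *m C.
have cL' : cmx L'.
  apply: cmxD; first by apply: cmxN; apply: cmxM => //; exact: cmx_cst.
  by apply: cmxM => //; exact: cmx_cst.
have cLW : cmx (fun t => L' t *m B1 *m W t).
  by apply: cmxM => //; apply: cmxM => //; exact: cmx_cst.
have cFY : cmx (fun t => F' t *m Y t) by exact: cmxM.
have cFV : cmx (fun t => F' t *m D *m V t).
  by apply: cmxM => //; apply: cmxM => //; exact: cmx_cst.
have cN k l (G : R -> 'M[R]_(k, l)) : cmx G -> imx (fun s => - G s) 0 T = - imx G 0 T.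
  move=> cG; apply/eqP; rewrite -subr_eq0 opprK -imxD//; last exact: cmxN.
  apply/eqP/matrixP => i j; rewrite !mxE.
  by under eq_Rintegral do rewrite !mxE addNr; rewrite Rintegral_cst// mul0r.
(* The upper limit tau becomes T because [F'] vanishes after tau. *)
have E1 : observed free_output = imx (fun s => F' s *m Y s) 0 T + imx (fun s => F' s *m D *m V s) 0 T.
  rewrite -imxD//.
  have cFo : cmx (fun s => F' s *m Y s + F' s *m D *m V s) by exact: cmxD.
  have -> : observed free_output = imx (fun s => F' s *m Y s + F' s *m D *m V s) 0 tau.
    by apply: imx_eq => s _; rewrite /free_output mulmxDr mulmxA.
  apply/eqP; rewrite -subr_eq0 -opprB oppr_eq0 -!gprimx_imx// !gprimxE// -imx_primx//.
  rewrite (imx_eq (G := fun=> 0)) => [|s /andP[st _]].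
    by apply/eqP/matrixP => i j; rewrite !mxE Rintegral_cst// mul0r.
  by have [_ ->] := Fz st; rewrite !mul0mx addr0.
(* L is the adjoint that eliminates the state: differentiating L z - F Y, with z the drift and Y the
   noiseless part of the output, all terms in z cancel by L' = - L A + F C. *)
have E2 : free_drift T - L 0 *m x0 = - (imx (fun t => L' t *m B1 *m W t) 0 T + imx (fun s => F' s *m Y s) 0 T).
  pose Z t := L t *m free_drift t - F t *m Y t.
  have dZ t : dmx Z (- (L' t *m B1 *m W t + F' t *m Y t)) t.
    apply: (dmx_eq (dmxB (dmxM (dL t) (dmx_free_drift t)) (dmxM (dF t) (dY t)))).
    rewrite /L' /free_state !(mulmxDl, mulmxDr, mulNmx) !mulmxA.
    move: (L t *m A *m free_drift t) (F t *m C *m free_drift t) (L t *m A *m B1 *m W t) => a1 a2 a3.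
    move: (F t *m C *m B1 *m W t) (F' t *m Y t) => a4 a5.
    by apply/matrixP => i j; rewrite !mxE; ring.
  have cs : cmx (fun t => L' t *m B1 *m W t + F' t *m Y t) by exact: cmxD.
  rewrite -imxD// -cN// (imx_FTC T0 (fun t _ => dZ t) (cmxN cs)) /Z.
  have [-> _] := Fz tauT.
  rewrite LT mul0mx subr0 mul1mx /Y gprimx0 mulmx0 subr0 [free_drift 0]/free_drift gprimx0 addr0.
  by rewrite expm0 mul1mx.
rewrite /state steer_final ?tau0// mul1mx /free_state /wint LT mul1mx E1.
have [-> _] := Fz tauT.
rewrite mul0mx oppr0 mul0mx sub0r.
have -> : imx (fun s => - (F' s *m D) *m V s) 0 T = - imx (fun s => F' s *m D *m V s) 0 T.
  by rewrite -cN//; apply: imx_eq => s _; rewrite mulNmx.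
have -> : free_drift T = L 0 *m x0 - (imx (fun t => L' t *m B1 *m W t) 0 T + imx (fun s => F' s *m Y s) 0 T).
  by rewrite -E2 addrC subrK.
rewrite opprK -[imx (fun s => (- (L s *m A) + F s *m C) *m B1 *m W s) 0 T]/(imx (fun t => L' t *m B1 *m W t) 0 T).
move: (imx (fun t => L' t *m B1 *m W t) 0 T) (imx (fun s => F' s *m Y s) 0 T) (imx (fun s => F' s *m D *m V s) 0 T) => a1 a2 a3.
move: (B1 *m W T) (L 0 *m x0) => a4 a5.
by apply/matrixP => i j; rewrite !mxE; ring.
Qed.

End steering.

(** * Measurability and adaptedness of the closed loop *)

Section random_loop.
Context (R : realType) (n m m1 p : nat).
Context (A : 'M[R]_n) (B : 'M[R]_(n, m)) (B1 : 'M[R]_(n, m1)) (C : 'M[R]_(p, n)) (D : 'M[R]_p).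
Context (T tau : R) (F' : R -> 'M[R]_(n, p)) (cF' : cmx F') (tau0 : 0 <= tau).
Context (d : measure_display) (Omega : measurableType d).
Context (x0 : Omega -> 'cV[R]_n) (W : R -> Omega -> 'cV[R]_m1) (V : R -> Omega -> 'cV[R]_p).
Context (mx0 : measurable_fun setT x0).
Context (cW : forall o, cmx (W ^~ o)) (mW : forall t, measurable_fun setT (W t)).
Context (cV : forall o, cmx (V ^~ o)) (mV : forall t, measurable_fun setT (V t)).

Let fstate t o := free_state A B1 (x0 o) (W ^~ o) t.
Let foutput t o := free_output A B1 C D (x0 o) (W ^~ o) (V ^~ o) t.
Let rstate t o := state A B B1 C D T tau F' (x0 o) (W ^~ o) (V ^~ o) t.
Let routput t o := output A B B1 C D T tau F' (x0 o) (W ^~ o) (V ^~ o) t.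

Lemma measurable_free_state t : 0 <= t -> measurable_fun setT (fstate t).
Proof.
move=> t0; apply: measurable_cVD; last exact: measurable_mulmx.
apply: measurable_mulmx; apply: measurable_cVD => //.
have cG : cmx (fun s => expm A (- s) *m A *m B1).
  by apply: cmxM; [apply: cmxM; [exact: cmx_expmN|]|]; exact: cmx_cst.
rewrite (_ : (fun o => _) = (fun o => imx (fun s => expm A (- s) *m A *m B1 *m W s o) 0 t)).
  exact: measurable_imx.
apply/funext => o; rewrite gprimx_imx//.
  by apply: imx_eq => s _; rewrite !mulmxA.
by apply: cmxM; [exact: cmx_expmN|]; do 2 (apply: cmxM; first exact: cmx_cst).
Qed.

Lemma measurable_free_output t : 0 <= t -> measurable_fun setT (foutput t).
Proof.
move=> t0; apply: measurable_cVD; last exact: measurable_mulmx.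
rewrite (_ : (fun o => _) = (fun o => imx (fun s => C *m fstate s o) 0 t)).
  apply: (@measurable_imx R _ Omega _ _ (fun=> C) fstate) => //.
  - exact: cmx_cst.
  - by move=> o; exact: cmx_free_state.
  - by move=> s /andP[s0 _]; exact: measurable_free_state.
by apply/funext => o; rewrite gprimx_imx//; exact: cmx_Cfree.
Qed.

Lemma measurable_observed : measurable_fun setT (fun o => observed tau F' (foutput ^~ o)).
Proof.
apply: (@measurable_imx R _ Omega _ _ F' foutput) => //.
- move=> o; apply: cmxD; first by apply: dmx_cmx => t; apply: dmx_gprimx; exact: cmx_Cfree.
  by apply: cmxM => //; exact: cmx_cst.
- by move=> s /andP[s0 _]; exact: measurable_free_output.
Qed.

Lemma measurable_state t : 0 <= t -> measurable_fun setT (rstate t).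
Proof.
move=> t0; apply: measurable_cVD; first exact: measurable_free_state.
by apply: measurable_mulmx; exact: measurable_observed.
Qed.

Lemma measurable_output t : 0 <= t -> measurable_fun setT (routput t).
Proof.
move=> t0; apply: measurable_cVD; last exact: measurable_mulmx.
rewrite (_ : (fun o => _) = (fun o => imx (fun s => C *m rstate s o) 0 t)).
  apply: (@measurable_imx R _ Omega _ _ (fun=> C) rstate) => //.
  - exact: cmx_cst.
  - by move=> o; exact: cmx_state.
  - by move=> s /andP[s0 _]; exact: measurable_state.
by apply/funext => o; rewrite gprimx_imx//; exact: cmx_Cstate.
Qed.

(** The measurable space is left open: Omega itself gives a random vector, and Omega with the
    sigma-algebra of the outputs up to t gives adaptedness. *)
Lemma measurable_feedback d' (Om : measurableType d') (Y : R -> Om -> 'cV[R]_p) t :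
  (forall o, cmx (Y ^~ o)) -> (forall s, 0 <= s <= t -> measurable_fun setT (Y s)) ->
  measurable_fun setT (fun o => feedback A B T tau F' t (Y ^~ o)).
Proof.
move=> cY mY; have [tt|tt] := leP t tau.
  by rewrite /feedback ctrl_early//; under eq_fun do rewrite mul0mx; exact: measurable_cst.
apply: measurable_mulmx; apply: measurable_imx => // s /andP[s0 st].
by apply: mY; rewrite s0 (le_trans st)// ltW.
Qed.

Lemma feedback_causal : causal T (feedback A B T tau F').
Proof.
move=> t eta eta' _ h; have [tt|tt] := leP t tau.
  by rewrite /feedback ctrl_early// !mul0mx.
congr (_ *m _); apply: imx_eq => s /andP[s0 st].
by rewrite h// s0 (le_trans st)// ltW.
Qed.

Lemma feedback_adapted : adapted T (fun t o => feedback A B T tau F' t (routput ^~ o)) routput.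
Proof.
move=> t /andP[t0 tT]; apply: sigma_gen_sub => _ ->.
apply/gen_measurableP.
apply: (@measurable_feedback _ (gen_type `[0, t] routput) routput).
  by move=> o; exact: cmx_output.
move=> s st; apply/gen_measurableP; apply: gen_process.
by rewrite /= in_itv.
Qed.

End random_loop.

Theorem theorem1 (R : realType) (n m m1 p : nat)
    (A : 'M[R]_n) (B : 'M[R]_(n, m)) (B1 : 'M[R]_(n, m1))
    (C : 'M[R]_(p, n)) (D : 'M[R]_p)
    (T : R) (Sigma0 SigmaT : 'M[R]_n) (P : R -> 'M[R]_n)
    (d : measure_display) (Omega : measurableType d) (Pr : probability Omega R)
    (x0 : Omega -> 'cV[R]_n)
    (w : R -> Omega -> 'cV[R]_m1) (v : R -> Omega -> 'cV[R]_p) :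
  0 < T ->
  posdef Sigma0 ->
  posdef SigmaT ->
  controllable A B ->
  observable A C ->
  D \in unitmx ->
  has_density Pr x0 (gaussian_density Sigma0) ->
  wiener Pr T w ->
  wiener Pr T v ->
  independent Pr (sigma_gen `[0, T] w) (sigma_gen `[0, T] v) ->
  independent Pr (sigma_gen [set tt] (fun=> x0))
    (sigma_gen `[0, T] (fun t omega => col_mx (w t omega) (v t omega))) ->
  riccati_solution A B1 C D T Sigma0 P ->
  posdef (SigmaT - P T) ->
  exists (law : R -> (R -> 'cV[R]_p) -> 'cV[R]_m)
         (u : R -> Omega -> 'cV[R]_m)
         (x : R -> Omega -> 'cV[R]_n) (y : R -> Omega -> 'cV[R]_p),
    [/\ causal T law /\
          (forall t omega, 0 <= t <= T -> u t omega = law t (y ^~ omega)),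
        forall t, 0 <= t <= T ->
          [/\ random_vector (u t), random_vector (x t) & random_vector (y t)],
        adapted T u y,
        {ae Pr, forall omega,
           produced_by A B B1 C D law T (x0 omega) (w ^~ omega) (v ^~ omega)
             (x ^~ omega) (y ^~ omega)} &
        has_density Pr (x T) (gaussian_density SigmaT)].
Proof.
move=> T0 pS0 pST ctr obs uD hx ww wv iwv ix ric pP.
have T0' := ltW T0.
have [tau [L [F [F' [/andP[tau0 tauT] [dF cF'] Fz [dL LT] cov]]]]] := filter_gain T0 pS0 obs uD ric pP.
have [W rW] := wiener_regular T0' ww.
have [V rV] := wiener_regular T0' wv.
have [cW W0 mW eW] := rW; have [cV V0 mV eV] := rV.
have tau0' := ltW tau0; have tauT' := ltW tauT.
have mx0 : measurable_fun setT x0 by apply/random_vectorP; case: hx.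
pose x t o := state A B B1 C D T tau F' (x0 o) (W ^~ o) (V ^~ o) t.
pose y t o := output A B B1 C D T tau F' (x0 o) (W ^~ o) (V ^~ o) t.
have cy o : cmx (y ^~ o) by exact: cmx_output.
have my t : 0 <= t -> measurable_fun setT (y t) by move=> t0; exact: measurable_output.
exists (feedback A B T tau F'), (fun t o => feedback A B T tau F' t (y ^~ o)), x, y; split.
- by split=> //; exact: feedback_causal.
- move=> t /andP[t0 tT]; split; apply/random_vectorP.
  + by apply: measurable_feedback => // s /andP[s0 _]; exact: my.
  + exact: measurable_state.
  + exact: my.
- exact: feedback_adapted.
- apply: filterS2 eW eV => o hw hv.
  exact: (@loop_produced R n m m1 p A B B1 C D T tau F' (x0 o) (W ^~ o) (V ^~ o) (cW o) tau0').
apply: isgauss_density => //.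
have cF := dmx_cmx dF; have cL := dmx_cmx dL.
have cL' : cmx (fun t => (- (L t *m A) + F t *m C) *m B1).
  apply: cmxM; last exact: cmx_cst.
  by apply: cmxD; [apply: cmxN|]; apply: cmxM => //; exact: cmx_cst.
have cH' : cmx (fun t => - (F' t *m D)) by apply: cmxN; apply: cmxM => //; exact: cmx_cst.
have := wiener_integral (L 0) T0 pS0 hx ww wv iwv ix rW rV
  (fun t => dmxMr B1 (dL t)) cL' (fun t => dmxN (dmxMr D (dF t))) cH'.
have -> : (fun o => L 0 *m x0 o + (wint T (fun t => L t *m B1) (fun t => (- (L t *m A) + F t *m C) *m B1) (W ^~ o) +
    wint T (fun t => - (F t *m D)) (fun t => - (F' t *m D)) (V ^~ o))) = x T.
  by apply/funext => o; rewrite /x (state_final B1 D (x0 o) (cW o) (cV o) tau0' tauT' dF cF' Fz dL LT ctr tauT).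
congr (isgauss _ _ _); rewrite -cov /gain_cov -imxD//; first last.
- by apply: cmxM; [apply: cmxN|apply: cmxT; apply: cmxN]; apply: cmxM => //; exact: cmx_cst.
- by apply: cmxM; [|apply: cmxT]; apply: cmxM => //; exact: cmx_cst.
(* The sign of the measurement noise integrand disappears in the quadratic expression, so the two
   Wiener covariances add up to the integrand of [gain_cov]. *)
congr (_ + _); apply: imx_eq => t _.
by rewrite !trmx_mul linearN /= mulNmx mulmxN opprK !trmx_mul !mulmxA.
Qed.
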